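(* Let $V\subseteq H\equiv H^*\subseteq V^*$ be a Gelfand triple, let $A:V\to V^*$ be measurable, let $((\Omega,\mathcal F,\mathbf P),(\theta_t)_{t\in\mathbb R})$ be a metric dynamical system with a filtration $(\mathcal F_t)$, and let $(N_t)_{t\in\mathbb R}$ be a $V$-valued $(\mathcal F_t)$-adapted process. Suppose there exist $\alpha>1$, $\delta>0$ and $K,C\in\mathbb R$ such that for all $v,v_1,v_2\in V$: (H1) $s\mapsto {}_{V^*}\langle A(v_1+sv_2),v\rangle_V$ is continuous on $\mathbb R$; (H2) $2\,{}_{V^*}\langle A(v_1)-A(v_2),v_1-v_2\rangle_V\le C\|v_1-v_2\|_H^2$; (H3) $2\,{}_{V^*}\langle A(v),v\rangle_V+\delta\|v\|_V^\alpha\le C+K\|v\|_H^2$; (H4) $\|A(v)\|_{V^*}\le C(1+\|v\|_V^{\alpha-1})$; and suppose that (S1) $N_t(\omega)-N_s(\omega)=N_{t-s}(\theta_s\omega)-N_0(\theta_s\omega)$ for all $s,t\in\mathbb R$, $\omega\in\Omega$; (S2) for each $\omega\in\Omega$, $N_\cdot(\omega)\in L^\alpha_{loc}(\mathbb R;V)\cap L^2_{loc}(\mathbb R;H)$ (with the same $\alpha$); (S3) $N:\mathbb R\times\Omega\to V$ is $\mathcal B(\mathbb R)\otimes\mathcal F/\mathcal B(V)$-measurable. For $s\in\mathbb R$, $\omega\in\Omega$, $x\in H$ let $Z(\cdot,s;\omega)x$ denote the solution of the equation $Z_t=x-N_s(\omega)+\int_s^t A(Z_r+N_r(\omega))\,dr$,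 $t\ge s$, and define $S(t,s;\omega)x:=Z(t,s;\omega)x+N_t(\omega)$ for $t\ge s$ and $\varphi(t,\omega)x:=S(t,0;\omega)x$ for $t\ge0$. Then $S$ is a continuous stochastic flow and $\varphi$ is a continuous random dynamical system over $(\theta_t)$.
   Context: A Gelfand triple $V\subseteq H\equiv H^*\subseteq V^*$ means: $(H,\langle\cdot,\cdot\rangle_H)$ is a separable Hilbert space identified with its dual by the Riesz isomorphism, $V$ is a reflexive Banach space continuously and densely embedded in $H$, and ${}_{V^*}\langle\cdot,\cdot\rangle_V$ denotes the dualization between $V^*$ and $V$. A metric dynamical system $((\Omega,\mathcal F,\mathbf P),(\theta_t)_{t\in\mathbb R})$ is a probability space with a family of maps $\theta_t:\Omega\to\Omega$ such that $(t,\omega)\mapsto\theta_t\omega$ is $\mathcal B(\mathbb R)\otimes\mathcal F/\mathcal F$-measurable, $\theta_0=\mathrm{id}$, $\theta_{t+s}=\theta_t\circ\theta_s$, and each $\theta_t$ preserves $\mathbf P$. The solution $Z(\cdot,s;\omega)x$ of the random equation is understood $\omega$-wise as the unique function in $L^\alpha_{loc}([s,\infty);V)\cap C([s,\infty);H)$ satisfying the integral equation (in $V^*$) for all $t\ge s$. A random dynamical system (RDS) over $\theta$ is a measurable map $\varphi:\mathbb R_+\times H\times\Omega\to H$, $(t,x,\omega)\mapsto\varphi(t,\omega)x$, with $\varphi(0,\omega)=\mathrm{id}$ and $\varphi(t+s,\omega)=\varphi(t,\theta_s\omega)\circ\varphi(s,\omega)$ for all $t,s\ge0$, $\omega\in\Omega$;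 it is continuous if $x\mapsto\varphi(t,\omega)x$ is continuous for all $t,\omega$. A stochastic flow is a family of maps $S(t,s;\omega):H\to H$, $-\infty<s\le t<\infty$, such that $(t,s,x,\omega)\mapsto S(t,s;\omega)x$ is $\mathcal B(\mathbb R)\otimes\mathcal B(\mathbb R)\otimes\mathcal B(H)\otimes\mathcal F/\mathcal B(H)$-measurable and $S(t,r;\omega)S(r,s;\omega)x=S(t,s;\omega)x$, $S(t,s;\omega)x=S(t-s,0;\theta_s\omega)x$ for all $s\le r\le t$, $\omega\in\Omega$; it is continuous if $x\mapsto S(t,s;\omega)x$ is continuous for all $s\le t$, $\omega$. *)

(* Defs.v *)
From HB Require Import structures.
From mathcomp Require Import all_boot all_order all_algebra.
From mathcomp Require Import all_classical all_reals all_analysis.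
Set Implicit Arguments. Unset Strict Implicit. Unset Printing Implicit Defensive.
Import Order.TTheory GRing.Theory Num.Theory.
Import numFieldNormedType.Exports.
Local Open Scope classical_set_scope.
Local Open Scope ring_scope.

Section Defs.
Variable R : realType.

Definition borel (T : topologicalType) : set (set T) := <<s open >>.

Definition prod_sigma (T1 T2 : Type) (G1 : set (set T1)) (G2 : set (set T2))
  : set (set (T1 * T2)) :=
  <<s [set X | exists A1 A2, G1 A1 /\ G2 A2 /\ X = A1 `*` A2] >>.

Definition is_dual (V : normedModType R) (f : V -> R) : Prop :=
  (forall (a : R) (x y : V), f (a *: x + y) = a * f x + f y) /\ continuous f.

Definition opnorm (V : normedModType R) (f : V -> R) : R :=
  sup ((fun w : V => `|f w|) @` [set w : V | `|w| <= 1]).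

Definition dual_open (V : normedModType R) (U : set (V -> R)) : Prop :=
  U `<=` @is_dual V /\
  forall f, U f -> exists2 e : R, 0 < e &
    forall g, is_dual g -> opnorm (fun w => g w - f w) < e -> U g.

Definition borel_dual (V : normedModType R) : set (set (V -> R)) :=
  <<s @is_dual V, @dual_open V >>.

Definition reflexive (V : normedModType R) : Prop :=
  forall Phi : (V -> R) -> R,
    (forall (a : R) (f g : V -> R), is_dual f -> is_dual g ->
       Phi (fun w => a * f w + g w) = a * Phi f + Phi g) ->
    (exists c : R, forall f, is_dual f -> `|Phi f| <= c * opnorm f) ->
    exists v : V, forall f, is_dual f -> Phi f = f v.

Definition gelfand_triple (V H : completeNormedModType R)
  (ip : H -> H -> R) (i : V -> H) : Prop :=
  [/\ (forall x y, ip x y = ip y x),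
      (forall (a : R) x y z, ip (a *: x + y) z = a * ip x z + ip y z),
      (forall x, ip x x = `|x| ^+ 2),
      (exists D : set H, countable D /\ closure D = setT) &
  [/\ reflexive V,
      (forall (a : R) x y, i (a *: x + y) = a *: i x + i y),
      injective i, continuous i &
      closure (range i) = setT]].

Definition metric_dyn_sys d (Omega : measurableType d)
  (P : probability Omega R) (theta : R -> Omega -> Omega) : Prop :=
  [/\ (forall B, measurable B ->
         prod_sigma (@borel R) measurable
           [set p : R * Omega | B (theta p.1 p.2)]),
      (forall w, theta 0 w = w),
      (forall t s w, theta (t + s) w = theta t (theta s w)) &
      (forall t B, measurable B -> P (theta t @^-1` B) = P B)].

Definition filtration d (Omega : measurableType d) (Ft : R -> set (set Omega))
  : Prop :=
  [/\ (forall t, sigma_algebra setT (Ft t)),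
      (forall t A, Ft t A -> measurable A) &
      (forall s t A, s <= t -> Ft s A -> Ft t A)].

Definition locLp (T : normedModType R) (p : R) (D : set R) (f : R -> T) : Prop :=
  (forall B, @borel T B -> @borel R (D `&` f @^-1` B)) /\
  forall a b : R,
    (\int[@lebesgue_measure R]_(t in D `&` `[a, b]) ((`|f t| `^ p)%:E) < +oo)%E.

(** Z : R -> H is a solution on [s, oo) of
      Z_t = x - N_s + int_s^t A(Z_r + N_r) dr   (in V^star)
    in the class L^alpha_loc([s,oo);V) ∩ C([s,oo);H). Elements h of H act on
    V as functionals w |-> <h, i w>_H (Riesz identification H ≡ H^star ⊆ V^star). *)
Definition is_solution (V H : completeNormedModType R) (ip : H -> H -> R)
  (i : V -> H) (A : V -> V -> R) (alpha : R) (Nw : R -> V)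
  (s : R) (x : H) (Z : R -> H) : Prop :=
  {within `[s, +oo[, continuous Z} /\
  exists Zv : R -> V,
    [/\ locLp alpha `[s, +oo[ Zv,
        {ae @lebesgue_measure R, forall t, `[s, +oo[%classic t -> Z t = i (Zv t)} &
        forall t (w : V), s <= t ->
          (@lebesgue_measure R).-integrable `[s, t]
              (fun r => (A (Zv r + Nw r) w)%:E) /\
          ip (Z t) (i w) = ip (x - i (Nw s)) (i w)
             + Rintegral (@lebesgue_measure R) `[s, t] (fun r => A (Zv r + Nw r) w)].

Definition cont_stochastic_flow d (Omega : measurableType d)
  (theta : R -> Omega -> Omega) (H : normedModType R)
  (S : R -> R -> Omega -> H -> H) : Prop :=
  [/\ (forall B, @borel H B ->
         prod_sigma (prod_sigma (prod_sigma (@borel R) (@borel R)) (@borel H))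
           measurable
           [set p | p.1.1.2 <= p.1.1.1 /\ B (S p.1.1.1 p.1.1.2 p.2 p.1.2)]),
      (forall s r t w x, s <= r -> r <= t -> S t r w (S r s w x) = S t s w x),
      (forall s t w x, s <= t -> S t s w x = S (t - s) 0 (theta s w) x) &
      (forall s t w, s <= t -> continuous (S t s w))].

Definition cont_RDS d (Omega : measurableType d)
  (theta : R -> Omega -> Omega) (H : normedModType R)
  (phi : R -> Omega -> H -> H) : Prop :=
  [/\ (forall B, @borel H B ->
         prod_sigma (prod_sigma (@borel R) (@borel H)) measurable
           [set p | 0 <= p.1.1 /\ B (phi p.1.1 p.2 p.1.2)]),
      (forall w x, phi 0 w x = x),
      (forall t s w x, 0 <= t -> 0 <= s ->
         phi (t + s) w x = phi t (theta s w) (phi s w x)) &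
      (forall t w, 0 <= t -> continuous (phi t w))].

End Defs.

(* Main.v *)
(** Difference quotients in time yield the energy identity
    |Z_b|^2 - |Z_a|^2 = 2 int_a^b <A(Z + N), Z>.  With (H2), (H3) and Gronwall it
    bounds Z + N in L^alpha(V), and it bounds the difference of two solutions in
    C([a, b]; H) by the distance of the initial values and the integral of
    |N - N'|_V^alpha + |N - N'|_H^2.  Hence uniqueness, continuity, and a closure
    property: by Minty's trick, limits of solutions for converging data are
    solutions.

    Existence for N = 0 and an initial value v with A v in H follows from the implicit
    Euler scheme, whose steps are solvable by the Browder-Minty theorem; such v are
    dense in H.  A constant noise is removed by a shift, a step noise is treated by
    concatenation, and step functions are dense among the admissible noises.

    The flow identities follow from uniqueness and (S1).  For joint measurability, the
    solution is the pointwise limit of solutions driven by step noises from a countable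
    family which are selected measurably; the integral distance between N(w) and a
    step noise is measurable in w by Tonelli's theorem. *)
Require Import Defs.
From HB Require Import structures.
From mathcomp Require Import all_boot all_order all_algebra.
From mathcomp Require Import all_classical all_reals all_analysis.
From mathcomp Require Import measurable_realfun ring lra.
Import Order.TTheory GRing.Theory Num.Theory.
Import numFieldNormedType.Exports.
Local Open Scope classical_set_scope.
Local Open Scope ring_scope.
Set Implicit Arguments. Unset Strict Implicit. Unset Printing Implicit Defensive.

(** * Hahn-Banach and limits along ultrafilters *)

Section HahnBanach.
Variables (R : realType) (V : lmodType R).
Implicit Types (p q : V -> R) (x y v : V).

(** Neither Bochner integrals nor weak compactness in spaces of V-valued or dual-valued functions
    occur: every equation is tested with a fixed vector of V, so that all integrals are scalar, and
    weak compactness is used in V only. In time-dependent problems it enters through Fatou's lemma: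
    at almost every t infinitely many approximations stay below one finite bound in V. The price is
    that a uniform limit Z of solutions has no known time derivative before Minty's trick is
    completed; difference quotients of Z, tested with step functions and then by density with the
    limit itself, take its place. Convergence in C([a, b]; H) is always strong and comes from
    monotonicity. This is why existence starts from v with A v in H: there the implicit Euler scheme
    keeps A bounded in H, and errors that are small in H but merely bounded in V still give a Cauchy
    sequence. Reflexivity of V also carries the measurability: V inherits separability from H, and i
    maps closed balls of V to closed sets of H, so that the inverse of i is Borel. *)

Definition sublinear p :=
  (forall x y, p (x + y) <= p x + p y) /\
  (forall t x, 0 <= t -> p (t *: x) = t * p x).

(** The missing inequality is the assumed one for the factor t^-1 at the vector t x. *)
Lemma sublinear_suff p : (forall x y, p (x + y) <= p x + p y) ->
  (forall t x, 0 < t -> p (t *: x) <= t * p x) -> p 0 = 0 -> sublinear p.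
Proof.
move=> pD pZ p0; split => // t x; rewrite le_eqVlt => /orP[/eqP <-|t0].
  by rewrite scale0r mul0r.
apply/eqP; rewrite eq_le pZ//=.
have tV : 0 < t^-1 by rewrite invr_gt0.
have := pZ _ (t *: x) tV.
by rewrite scalerA mulVf ?gt_eqF// scale1r mulrC ler_pdivlMr// mulrC.
Qed.

Lemma sublinear0 p : sublinear p -> p 0 = 0.
Proof. by case=> _ /(_ 0 0 (lexx _)); rewrite scale0r mul0r. Qed.

Lemma sublinearN p x : sublinear p -> - p (- x) <= p x.
Proof.
move=> sp; rewrite -subr_ge0 opprK -(sublinear0 sp) -(subrr x).
by case: sp => pD _; exact: pD.
Qed.

(* For minimal sublinear q one gets q = slope q v0, so q (- v0) = - q v0 by
   slopeN: a minimal sublinear functional is linear. *)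
Definition slope p v0 v := inf [set p (v + t *: v0) - t * p v0 | t in [set t | 0 <= t]].

Lemma slope_lb p v0 v t : sublinear p -> 0 <= t ->
  - p (- v) <= p (v + t *: v0) - t * p v0.
Proof.
move=> [pD pZ] t0; rewrite lerBrDr -(pZ t v0)// addrC lerBlDr.
by rewrite (le_trans _ (pD _ _))// addrAC subrr add0r.
Qed.

Lemma slope_has_lb p v0 v : sublinear p ->
  has_lbound [set p (v + t *: v0) - t * p v0 | t in [set t | 0 <= t]].
Proof. by move=> sp; exists (- p (- v)) => _ [t t0 <-]; exact: slope_lb. Qed.

Lemma slope_le p v0 v t : sublinear p -> 0 <= t ->
  slope p v0 v <= p (v + t *: v0) - t * p v0.
Proof. by move=> sp t0; apply: ge_inf; [exact: slope_has_lb|exists t]. Qed.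

Lemma le_slope p v0 v c : 
  (forall t, 0 <= t -> c <= p (v + t *: v0) - t * p v0) -> c <= slope p v0 v.
Proof.
move=> h; apply: lb_le_inf; first by exists (p (v + 0 *: v0) - 0 * p v0), 0 => /=.
by move=> _ [t t0 <-]; exact: h.
Qed.

Lemma slope_lep p v0 v : sublinear p -> slope p v0 v <= p v.
Proof.
move=> sp; rewrite (le_trans (slope_le v0 v sp (lexx 0)))//.
by rewrite scale0r addr0 mul0r subr0.
Qed.

Lemma slope_sublinear p v0 : sublinear p -> sublinear (slope p v0).
Proof.
move=> sp; have [pD pZ] := sp; apply: sublinear_suff.
- move=> x y; rewrite -lerBlDr; apply: le_slope => s s0.
  rewrite lerBlDr -lerBlDl; apply: le_slope => t t0.
  rewrite lerBlDr (le_trans (slope_le _ _ sp (addr_ge0 s0 t0)))//.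
  have -> : x + y + (s + t) *: v0 = x + s *: v0 + (y + t *: v0).
    by rewrite scalerDl addrACA.
  have := pD (x + s *: v0) (y + t *: v0); rewrite mulrDl; lra.
- move=> t x t0; rewrite -ler_pdivrMl//; apply: le_slope => s s0.
  rewrite ler_pdivrMl// (le_trans (slope_le _ _ sp (mulr_ge0 (ltW t0) s0)))//.
  by rewrite -scalerA -scalerDr (pZ _ _ (ltW t0)) mulrBr mulrA.
- apply/eqP; rewrite eq_le (le_trans (slope_lep v0 0 sp)) ?(sublinear0 sp)//=.
  by apply: le_slope => t t0; rewrite add0r pZ// subrr.
Qed.

Lemma slopeN p v0 : sublinear p -> slope p v0 (- v0) <= - p v0.
Proof.
move=> sp; rewrite (le_trans (slope_le v0 (-v0) sp ler01))//.
by rewrite scale1r addNr sublinear0// mul1r sub0r.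
Qed.

(** Zorn's lemma for the reversed pointwise order. A chain is bounded below by its pointwise
    infimum: [- p (- v)] keeps the infimum finite, and subadditivity survives because of two members
    of a chain the smaller one serves at both points. *)
Lemma sublinear_min p : sublinear p -> exists q, [/\ sublinear q, (forall v, q v <= p v) &
  forall r, sublinear r -> (forall v, r v <= q v) -> r = q].
Proof.
move=> sp; pose T := {q | sublinear q /\ forall v, q v <= p v}.
pose Rel (q1 q2 : T) := `[< forall v, sval q2 v <= sval q1 v >].
have [||||[q [sq qp]] qmin] := @Zorn T Rel.
- by move=> t; apply/asboolP.
- by move=> r s t /asboolP h1 /asboolP h2; apply/asboolP => v; exact: le_trans (h2 v) (h1 v).
- move=> [s ps] [t pt] /asboolP /= h1 /asboolP /= h2; apply: eq_exist.
  by apply/funext => v; apply/eqP; rewrite eq_le h1 h2.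
- move=> A Atot; have [[a Aa]|nA] := pselect (exists a, A a); last first.
    by exists (exist _ p (conj sp (fun v => lexx _))) => s As; exfalso; apply: nA; exists s.
  have lb (q : T) v : - p (- v) <= sval q v.
    case: q => q [sq qp] /=; rewrite (le_trans _ (sublinearN v sq))// lerN2; exact: qp.
  pose r v := inf [set sval q v | q in A].
  have rle (q : T) v : A q -> r v <= sval q v.
    by move=> Aq; apply: ge_inf; [exists (- p (- v)) => _ [? _ <-]; exact: lb|exists q].
  have ler v c : (forall q : T, A q -> c <= sval q v) -> c <= r v.
    by move=> h; apply: lb_le_inf; [exists (sval a v), a|move=> _ [q Aq <-]; exact: h].
  have sr : sublinear r.
    apply: sublinear_suff.
    + move=> x y; rewrite -lerBlDr; apply: (ler _ _) => q Aq.
      rewrite lerBlDr -lerBlDl; apply: (ler _ _) => q' Aq'; rewrite lerBlDl.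
      have [/asboolP h|/asboolP h] := Atot _ _ Aq Aq'.
        rewrite (le_trans (rle q' _ Aq'))//.
        have [+ _] := proj1 (svalP q'); move=> /(_ x y)/le_trans; apply.
        by rewrite lerD2r h.
      rewrite (le_trans (rle q _ Aq))//.
      have [+ _] := proj1 (svalP q); move=> /(_ x y)/le_trans; apply.
      by rewrite lerD2l h.
    + move=> t x t0; rewrite -ler_pdivrMl//; apply: (ler _ _) => q Aq.
      rewrite ler_pdivrMl// (le_trans (rle q _ Aq))//.
      by have [_ h] := proj1 (svalP q); rewrite (h _ _ (ltW t0)).
    + apply/eqP; rewrite eq_le (le_trans (rle a _ Aa)) ?(sublinear0 (proj1 (svalP a)))//=.
      by apply: (ler _ _) => q Aq; rewrite (sublinear0 (proj1 (svalP q))).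
  have rp v : r v <= p v by rewrite (le_trans (rle a v Aa))//; have [_ ] := svalP a.
  exists (exist _ r (conj sr rp)) => s As; apply/asboolP => v /=; exact: rle.
exists q; split => // r sr rq.
have rp v : r v <= p v by exact: le_trans (rq v) (qp v).
by have := qmin (exist _ r (conj sr rp)) (introT (asboolP _) rq) => -[].
Qed.

(** The minimal functional q is taken below [slope p v0] and not merely below p. Then q (- v0) <= -
    p v0, which for a linear q <= p forces equality at v0. *)
Lemma hahn_banach p v0 : sublinear p ->
  exists f : V -> R, [/\ forall a x y, f (a *: x + y) = a * f x + f y,
    forall v, f v <= p v & f v0 = p v0].
Proof.
move=> sp; have [q [sq qp qmin]] := sublinear_min (slope_sublinear v0 sp).
have qN v : q (- v) = - q v.
  apply/eqP; rewrite eq_le lerNl sublinearN// andbT.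
  by rewrite -{1}(qmin _ (slope_sublinear v sq) (fun w => slope_lep v w sq)) slopeN.
have qD x y : q (x + y) = q x + q y.
  have [sD _] := sq; apply/eqP; rewrite eq_le sD/= -lerBrDr -qN.
  by rewrite -{1}(addrK y x) sD.
have qZ a x : q (a *: x) = a * q x.
  have [_ sZ] := sq; have [a0|a0] := leP 0 a; first exact: sZ.
  by rewrite -[a]opprK scaleNr qN sZ ?mulNr// oppr_ge0 ltW.
exists q; split => [a x y|v|]; first by rewrite qD qZ.
  exact: le_trans (qp v) (slope_lep _ _ sp).
apply/eqP; rewrite eq_le (le_trans (qp v0) (slope_lep _ _ sp))/=.
by rewrite -lerN2 -qN (le_trans (qp _))// slopeN.
Qed.

End HahnBanach.

Section Dual.
Variables (R : realType) (V : normedModType R).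
Implicit Types (f g : V -> R) (v w : V).

Section is_dual_theory.
Variables (f : V -> R) (df : is_dual f).

Lemma dual0 : f 0 = 0.
Proof. by have := df.1 (-1) 0 0; rewrite scaler0 addr0 mulN1r addNr. Qed.

Lemma dualD v w : f (v + w) = f v + f w.
Proof. by have := df.1 1 v w; rewrite scale1r mul1r. Qed.

Lemma dualZ a v : f (a *: v) = a * f v.
Proof. by have := df.1 a v 0; rewrite addr0 dual0 addr0. Qed.

Lemma dualN v : f (- v) = - f v.
Proof. by rewrite -scaleN1r dualZ mulN1r. Qed.

Lemma dualB v w : f (v - w) = f v - f w.
Proof. by rewrite dualD dualN. Qed.

Lemma dual_bounded : exists2 M, 0 <= M & forall v, `|f v| <= M * `|v|.
Proof.
have /cvgrPdist_lt/(_ 1 ltr01) := df.2 0.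
rewrite dual0 => /nbhs_ballP[e /= e0 he].
exists (2 / e) => [|v]; first by rewrite divr_ge0// ltW.
have [->|v0] := eqVneq v 0; first by rewrite dual0 !normr0 mulr0.
have vp : 0 < `|v| by rewrite normr_gt0.
pose c := e / 2 / `|v|.
have c0 : 0 < c by rewrite !divr_gt0.
have cv : c * `|v| = e / 2 by rewrite mulfVK ?gt_eqF.
have := he (c *: v); rewrite -ball_normE /= !sub0r !normrN normrZ (gtr0_norm c0) cv.
rewrite dualZ normrM (gtr0_norm c0) => h.
have {}h : c * `|f v| < 1 by apply: h; rewrite ltr_pdivrMr// ltr_pMr// ltr1n.
have -> : 2 / e * `|v| = c^-1.
  by rewrite /c invfM invrK invf_div.
by rewrite -[leRHS]mulr1 ler_pdivlMl// ltW.
Qed.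

Let dual_ball_has_sup : has_sup ((fun w : V => `|f w|) @` [set w : V | `|w| <= 1]).
Proof.
split; first by exists `|f 0|, 0 => //=; rewrite normr0.
have [M M0 hM] := dual_bounded; exists M => _ [w /= w1 <-].
by rewrite (le_trans (hM w))// ler_piMr.
Qed.

Lemma le_opnorm v : `|f v| <= opnorm f * `|v|.
Proof.
have [->|v0] := eqVneq v 0; first by rewrite dual0 !normr0 mulr0.
have vp : 0 < `|v| by rewrite normr_gt0.
rewrite -ler_pdivrMr//; apply: (ub_le_sup dual_ball_has_sup.2).
exists (`|v|^-1 *: v) => /=; first by rewrite normrZ normfV normr_id mulVf ?gt_eqF.
by rewrite dualZ normrM normfV normr_id mulrC.
Qed.

Lemma opnorm_ge0 : 0 <= opnorm f.
Proof.
by apply: (ub_le_sup dual_ball_has_sup.2); exists 0; rewrite /= ?normr0// dual0 normr0.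
Qed.

End is_dual_theory.

Lemma bounded_is_dual f M : (forall a v w, f (a *: v + w) = a * f v + f w) ->
  (forall v, `|f v| <= M * `|v|) -> is_dual f.
Proof.
move=> fl fM; split => // v; apply/cvgrPdist_lt => e e0.
have fB x y : f x - f y = f (x - y).
  have -> : x - y = -1 *: y + x by rewrite scaleN1r addrC.
  by rewrite fl mulN1r addrC.
near=> w; rewrite fB (le_lt_trans (fM _))//.
rewrite (@le_lt_trans _ _ ((`|M| + 1) * `|v - w|))//.
  by rewrite ler_wpM2r// ler_wpDr// ler_norm.
rewrite -ltr_pdivlMl ?ltr_wpDl// mulrC.
by near: w; apply: cvgr_dist_lt => //; rewrite divr_gt0// ltr_wpDl.
Unshelve. all: by end_near. Qed.

Lemma is_dual_lin f g a : is_dual f -> is_dual g -> is_dual (fun w => a * f w + g w).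
Proof.
move=> df dg; split => [b x y|x]; last first.
  apply: cvgD; last exact: dg.2.
  by apply: cvgM; [exact: cvg_cst|exact: df.2].
by rewrite df.1 dg.1; ring.
Qed.

Lemma norming_functional v : exists f, [/\ is_dual f, forall w, `|f w| <= `|w| & f v = `|v|].
Proof.
have sn : sublinear (fun w : V => `|w|).
  by split => [x y|t x t0]; [exact: ler_normD|rewrite normrZ ger0_norm].
have [f [fl fle fv]] := hahn_banach v sn.
have fN w : f (- w) = - f w.
  have f0 : f 0 = 0 by have := fl (-1) 0 0; rewrite scaler0 addr0 mulN1r addNr.
  by have := fl (-1) w 0; rewrite scaleN1r !addr0 f0 addr0 mulN1r.
have fb w : `|f w| <= 1 * `|w|.
  by rewrite mul1r ler_norml fle andbT lerNl -fN -[leRHS]normrN.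
by exists f; split => // [|w]; [exact: bounded_is_dual fb|rewrite -[leRHS]mul1r].
Qed.

End Dual.

Section UltraLimit.
Variables (R : realType).

Lemma bounded_ultra_cvg (I : Type) (U : set_system I) (g : I -> R) (M : R) :
  UltraFilter U -> (forall i, `|g i| <= M) -> exists l : R, g @ U --> l.
Proof.
move=> UU gM; have FU : ProperFilter (g @ U) by exact: fmap_proper_filter.
have GU : UltraFilter (g @ U).
  split => // G GF sub; apply/seteqP; split => // A GA.
  have [//|h] := in_ultra_setVsetC (g @^-1` A) UU.
  exfalso; have /sub GnA : (g @ U) (~` A) by [].
  by apply: (@filter_not_empty _ G); rewrite -(setICr A); exact: filterI.
have := @segment_compact R (- M) M.
rewrite compact_ultra => /(_ _ GU)[|l [_ h]]; last by exists l.
apply: (@filterS _ U _ setT) => [i _ /=|]; last exact: filterT.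
by rewrite in_itv/= -ler_norml.
Qed.

(** Weak compactness of balls without a weak topology: along U every bounded family of numbers f (v
    i) converges, the limits form a bounded linear function of f, and reflexivity represents this
    function by a vector. The norm bound follows by a norming functional. *)
Lemma reflexive_ultra (V : normedModType R) (I : Type) (U : set_system I) (v : I -> V) (M : R) :
  Defs.reflexive V -> UltraFilter U -> (forall i, `|v i| <= M) ->
  exists v0, `|v0| <= M /\ forall f, is_dual f -> f (v i) @[i --> U] --> f v0.
Proof.
move=> rV UU vM.
have ex f : is_dual f -> exists l : R, f (v i) @[i --> U] --> l.
  move=> df; apply: (@bounded_ultra_cvg _ _ _ (opnorm f * M)) => // i.
  by rewrite (le_trans (le_opnorm df _))// ler_wpM2l// opnorm_ge0.
pose Phi (f : V -> R) : R := lim (f (v i) @[i --> U]).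
have cvgPhi f : is_dual f -> f (v i) @[i --> U] --> Phi f.
  by move=> /ex[l hl]; apply/cvg_ex; exists l.
have [||v0 hv0] := rV Phi.
- move=> a f g df dg; apply/cvg_lim => //; apply: cvgD; last exact: cvgPhi.
  by apply: cvgM; [exact: cvg_cst|exact: cvgPhi].
- exists M => f df.
  have : `|f (v i)| @[i --> U] --> `|Phi f| by apply: cvg_norm; exact: cvgPhi.
  move=> /cvg_lim <-//; apply: limr_le.
    by apply/cvg_ex; exists `|Phi f|; apply: cvg_norm; exact: cvgPhi.
  apply: nearW => i; rewrite (le_trans (le_opnorm df _))// mulrC ler_wpM2r//.
  exact: opnorm_ge0.
exists v0; split; last by move=> f df; rewrite -hv0//; exact: cvgPhi.
have [f [df fb <-]] := norming_functional v0.
rewrite -hv0// /Phi; apply: limr_le; first by apply/cvg_ex; exists (Phi f); exact: cvgPhi.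
by apply: nearW => i; rewrite (le_trans (ler_norm _))// (le_trans (fb _)).
Qed.

(** If g stayed away from l on a set meeting every member of F, some ultrafilter finer than F would
    contain that set. This turns a limit that is the same along all finer ultrafilters into a limit
    along F. *)
Lemma ultra_cvgP (I : Type) (F : set_system I) (g : I -> R) (l : R) : ProperFilter F ->
  (forall U, UltraFilter U -> F `<=` U -> g @ U --> l) -> g @ F --> l.
Proof.
move=> FF h; apply/cvgrPdist_lt => e e0; apply: contrapT => nF.
pose B := [set i | `|l - g i| < e].
pose G : set_system I := filter_from F (fun A => A `&` ~` B).
have GF : ProperFilter G.
  apply: filter_from_proper; first apply: filter_from_filter.
  - by exists setT; exact: filterT.
  - by move=> A A' FA FA'; exists (A `&` A'); [exact: filterI|move=> i [[]]].
  - move=> A FA; apply/set0P/eqP => /disjoints_subset; rewrite setCK => AB.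
    by apply: nF; apply: filterS FA.
have [U [UU GU]] := ultraFilterLemma GF.
have FU : F `<=` U by move=> A FA; apply: GU; exists A => // i [].
have /cvgrPdist_lt/(_ e e0) UB := h _ UU FU.
have UnB : U (~` B) by apply: GU; exists setT; [exact: filterT|move=> i []].
by apply: (@filter_not_empty _ U); rewrite -(setICr B); exact: filterI.
Qed.

End UltraLimit.

(** * Gelfand triples *)

Section LinearBounded.
Variables (R : realType) (V W : normedModType R) (f : V -> W).
Hypothesis fl : forall (a : R) v w, f (a *: v + w) = a *: f v + f w.

Lemma lin0 : f 0 = 0.
Proof. by have := fl (-1) 0 0; rewrite scaler0 addr0 scaleN1r addNr. Qed.

Lemma linD v w : f (v + w) = f v + f w.
Proof. by have := fl 1 v w; rewrite !scale1r. Qed.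

Lemma linZ a v : f (a *: v) = a *: f v.
Proof. by have := fl a v 0; rewrite lin0 !addr0. Qed.

Lemma linN v : f (- v) = - f v.
Proof. by rewrite -scaleN1r linZ scaleN1r. Qed.

Lemma linB v w : f (v - w) = f v - f w.
Proof. by rewrite linD linN. Qed.

Lemma lin_bounded : continuous f -> exists2 M : R, 0 <= M & forall v, `|f v| <= M * `|v|.
Proof.
move=> fc; have /cvgrPdist_lt/(_ 1 ltr01) := fc 0.
rewrite lin0 => /nbhs_ballP[e /= e0 he].
exists (2 / e) => [|v]; first by rewrite divr_ge0// ltW.
have [->|v0] := eqVneq v 0; first by rewrite lin0 !normr0 mulr0.
have vp : 0 < `|v| by rewrite normr_gt0.
pose c := e / 2 / `|v|.
have c0 : 0 < c by rewrite !divr_gt0.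
have cv : c * `|v| = e / 2 by rewrite mulfVK ?gt_eqF.
have := he (c *: v); rewrite -ball_normE /= !sub0r !normrN normrZ (gtr0_norm c0) cv.
rewrite linZ normrZ (gtr0_norm c0) => h.
have {}h : c * `|f v| < 1 by apply: h; rewrite ltr_pdivrMr// ltr_pMr// ltr1n.
have -> : 2 / e * `|v| = c^-1 by rewrite /c invfM invrK invf_div.
by rewrite -[leRHS]mulr1 ler_pdivlMl// ltW.
Qed.

End LinearBounded.

Definition dense_seq (R : realType) (V : normedModType R) (d : nat -> V) :=
  forall v (e : R), 0 < e -> exists n, `|v - d n| < e.

Section Gelfand.
Variables (R : realType) (V H : completeNormedModType R) (ip : H -> H -> R) (i : V -> H).
Hypothesis hG : gelfand_triple ip i.
Implicit Types (x y z h : H) (v w : V) (a M : R).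

Lemma ipC x y : ip x y = ip y x. Proof. by case: hG. Qed.

Lemma ipl a x y z : ip (a *: x + y) z = a * ip x z + ip y z. Proof. by case: hG. Qed.

Lemma ipxx x : ip x x = `|x| ^+ 2. Proof. by case: hG. Qed.

Lemma ip0l z : ip 0 z = 0.
Proof. by have := ipl (-1) 0 0 z; rewrite scaler0 addr0 mulN1r addNr. Qed.

Lemma ipDl x y z : ip (x + y) z = ip x z + ip y z.
Proof. by have := ipl 1 x y z; rewrite scale1r mul1r. Qed.

Lemma ipZl a x z : ip (a *: x) z = a * ip x z.
Proof. by have := ipl a x 0 z; rewrite addr0 ip0l addr0. Qed.

Lemma ipNl x z : ip (- x) z = - ip x z.
Proof. by rewrite -scaleN1r ipZl mulN1r. Qed.

Lemma ipBl x y z : ip (x - y) z = ip x z - ip y z.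
Proof. by rewrite ipDl ipNl. Qed.

Lemma ip0r z : ip z 0 = 0. Proof. by rewrite ipC ip0l. Qed.
Lemma ipDr x y z : ip z (x + y) = ip z x + ip z y. Proof. by rewrite ipC ipDl !(ipC z). Qed.
Lemma ipZr a x z : ip z (a *: x) = a * ip z x. Proof. by rewrite ipC ipZl ipC. Qed.
Lemma ipNr x z : ip z (- x) = - ip z x. Proof. by rewrite ipC ipNl ipC. Qed.
Lemma ipBr x y z : ip z (x - y) = ip z x - ip z y. Proof. by rewrite ipDr ipNr. Qed.

Lemma normB2 x y : `|x - y| ^+ 2 = `|x| ^+ 2 - 2 * ip x y + `|y| ^+ 2.
Proof. by rewrite -!ipxx ipBl !ipBr (ipC y x); ring. Qed.

Lemma normD2 x y : `|x + y| ^+ 2 = `|x| ^+ 2 + 2 * ip x y + `|y| ^+ 2.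
Proof. by rewrite -!ipxx ipDl !ipDr (ipC y x); ring. Qed.

Lemma normD2_le x y : `|x + y| ^+ 2 <= 2 * `|x| ^+ 2 + 2 * `|y| ^+ 2.
Proof. by have := sqr_ge0 `|x - y|; rewrite normB2 normD2; lra. Qed.

Lemma cauchy_schwarz x y : `|ip x y| <= `|x| * `|y|.
Proof.
have key (u w : H) : ip u w <= `|u| * `|w|.
  have [->|u0] := eqVneq u 0; first by rewrite ip0l normr0 mul0r.
  have [->|w0] := eqVneq w 0; first by rewrite ip0r normr0 mulr0.
  have up : 0 < `|u| by rewrite normr_gt0.
  have wp : 0 < `|w| by rewrite normr_gt0.
  have := sqr_ge0 `|(`|w| *: u - `|u| *: w)|.
  rewrite normB2 ipZl ipZr !normrZ !normr_id => h.
  have : 0 <= (2 * (`|u| * `|w|)) * (`|u| * `|w| - ip u w).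
    by move: h; congr (_ <= _); ring.
  by rewrite pmulr_rge0 ?mulr_gt0// subr_ge0.
by rewrite ler_norml key andbT lerNl -ipNl -(normrN x) key.
Qed.

Lemma cvg_ip T (F : set_system T) (x y : T -> H) (a b : H) : Filter F ->
  x @ F --> a -> y @ F --> b -> ip (x t) (y t) @[t --> F] --> ip a b.
Proof.
move=> FF xa yb.
have -> : (fun t => ip (x t) (y t)) =
    (fun t => 2^-1 * (`|x t + y t| ^+ 2 - `|x t| ^+ 2 - `|y t| ^+ 2)).
  by apply/funext => t; rewrite normD2; field.
have -> : ip a b = 2^-1 * (`|a + b| ^+ 2 - `|a| ^+ 2 - `|b| ^+ 2).
  by rewrite normD2; field.
apply: cvgM; first exact: cvg_cst.
have sq (z : T -> H) c : z @ F --> c -> `|z t| ^+ 2 @[t --> F] --> `|c| ^+ 2.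
  by move=> zc; rewrite expr2; under eq_fun do rewrite expr2; apply: cvgM; exact: cvg_norm.
by apply: cvgB; [apply: cvgB|]; apply: sq => //; exact: cvgD.
Qed.

Lemma il a v w : i (a *: v + w) = a *: i v + i w. Proof. by case: hG => _ _ _ _ []. Qed.
Lemma i_inj : injective i. Proof. by case: hG => _ _ _ _ []. Qed.
Lemma i_cont : continuous i. Proof. by case: hG => _ _ _ _ []. Qed.
Lemma V_refl : Defs.reflexive V. Proof. by case: hG => _ _ _ _ []. Qed.
Definition i0 := lin0 il.
Definition iD := linD il.
Definition iZ := linZ il.
Definition iN := linN il.
Definition iB := linB il.

Lemma i_bounded : exists2 M : R, 0 <= M & forall v, `|i v| <= M * `|v|.
Proof. exact: lin_bounded il i_cont. Qed.

Lemma i_dense h (e : R) : 0 < e -> exists v, `|h - i v| < e.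
Proof.
move=> e0; have [_ _ _ _ [_ _ _ _ dn]] := hG.
have : closure (range i) h by rewrite dn.
move=> /(_ (ball h e)) []; first exact: nbhsx_ballx.
by move=> _ [[v _ <-]]; rewrite -ball_normE; exists v.
Qed.

Lemma ip_dual h : is_dual (fun w => ip h (i w)).
Proof.
have [M M0 hM] := i_bounded.
apply: (@bounded_is_dual _ _ _ (`|h| * M)) => [a v w|v].
  by rewrite il ipDr ipZr.
by rewrite (le_trans (cauchy_schwarz _ _))// -mulrA ler_wpM2l.
Qed.



Lemma norm_le_dense h M : 0 <= M -> (forall w, ip h (i w) <= M * `|i w|) -> `|h| <= M.
Proof.
move=> M0 hM; have [->|h0] := eqVneq h 0; first by rewrite normr0.
have hp : 0 < `|h| by rewrite normr_gt0.
apply/ler_addgt0Pr => e e0.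
have den0 : 0 < `|h| + M by rewrite ltr_wpDr.
(* Once |h - i w| < d, the splitting |h|^2 = <h, h - i w> + <h, i w> exceeds M |h| by at most d (|h|
   + M); this d makes the excess equal to e |h|. *)
have d0 : 0 < e * `|h| / (`|h| + M) by rewrite divr_gt0// mulr_gt0.
have [w hw] := i_dense h d0.
have d1 : e * `|h| / (`|h| + M) * (`|h| + M) = e * `|h| by rewrite mulfVK// gt_eqF.
set d := e * `|h| / (`|h| + M) in d0 d1 hw.
rewrite -(ler_pM2r hp) -expr2 -ipxx -{2}(subrK (i w) h) ipDr.
have h1 := le_trans (ler_norm _) (cauchy_schwarz h (h - i w)).
have h2 : `|i w| <= `|h| + d.
  rewrite -{1}(subrK h (i w)) addrC (le_trans (ler_normD _ _))// lerD2l.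
  by rewrite -normrN opprB ltW.
have h3 := hM w.
have h4 := ler_wpM2l M0 h2.
have h5 : `|h| * `|h - i w| <= `|h| * d by rewrite ler_wpM2l// ltW.
nra.
Qed.

Lemma dense_eq0 h : (forall w, ip h (i w) = 0) -> h = 0.
Proof.
move=> h0; apply/normr0_eq0/eqP; rewrite eq_le normr_ge0 andbT.
by apply: norm_le_dense => // w; rewrite h0 mul0r.
Qed.

Lemma dense_eq h h' : (forall w, ip h (i w) = ip h' (i w)) -> h = h'.
Proof.
by move=> e; apply/eqP; rewrite -subr_eq0; apply/eqP/dense_eq0 => w; rewrite ipBl e subrr.
Qed.

(** Along each ultrafilter finer than F there is a weak limit in V. Testing with the functionals <i
    w, i .> shows that i maps it to h, and injectivity of i makes all these limits equal. *)
Lemma weak_cvg T (F : set_system T) (v : T -> V) M h : ProperFilter F ->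
  (\forall t \near F, `|v t| <= M) -> i (v t) @[t --> F] --> h ->
  exists v0, [/\ i v0 = h, `|v0| <= M & forall f, is_dual f -> f (v t) @[t --> F] --> f v0].
Proof.
move=> FF vM vh.
pose v' t := if `|v t| <= M then v t else 0.
have M0 : 0 <= M.
  by have [t tM] := filter_ex vM; exact: le_trans (normr_ge0 _) tM.
have v'M t : `|v' t| <= M by rewrite /v'; case: ifP => //; rewrite normr0.
have v'E : \forall t \near F, v' t = v t by apply: filterS vM => t tM; rewrite /v' tM.
have ul U : UltraFilter U -> F `<=` U ->
    exists v0, [/\ i v0 = h, `|v0| <= M & forall f, is_dual f -> f (v t) @[t --> U] --> f v0].
  move=> UU FU; have [v0 [v0M hv0]] := reflexive_ultra V_refl UU v'M.
  have hv f : is_dual f -> f (v t) @[t --> U] --> f v0.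
    move=> df; apply: cvg_trans (hv0 _ df); apply: near_eq_cvg.
    by apply: FU; apply: filterS v'E => t ->.
  exists v0; split => //; apply: dense_eq => w.
  rewrite ipC (ipC h); have h1 := hv _ (ip_dual (i w)).
  have h2 : ip (i w) (i (v t)) @[t --> U] --> ip (i w) h.
    by apply: cvg_ip; [exact: cvg_cst|apply: cvg_trans vh => A /FU].
  exact: cvg_unique h1 h2.
have [U [UU FU]] := ultraFilterLemma FF.
have [v0 [iv0 v0M _]] := ul U UU FU.
exists v0; split => // f df; apply: ultra_cvgP => U' UU' FU'.
have [v1 [iv1 _ h1]] := ul U' UU' FU'.
by rewrite (_ : v0 = v1); [exact: h1|apply: i_inj; rewrite iv0 iv1].
Qed.


Lemma H_dense_seq : exists d : nat -> H, dense_seq d.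
Proof.
have [_ _ _ [D [cD dD]] _] := hG.
have D0 : D !=set0.
  have : closure D 0 by rewrite dD.
  by move=> /(_ setT (filterT)) [x [Dx _]]; exists x.
have [d hd] : exists d : nat -> H, D `<=` range d.
  by have /pcard_surjP[g gD] : (D #<= [set: nat])%card := cD; exists g.
exists d => x e e0.
have : closure D x by rewrite dD.
move=> /(_ (ball x e)) []; first exact: nbhsx_ballx.
by move=> _ [/hd[n _ <-]]; rewrite -ball_normE; exists n.
Qed.

(** Separability of H provides countably many vectors of V that approximate every v in the norm of H
    while staying bounded in V: one vector is picked for each small ball around a member of the
    dense sequence and each integer bound on the V-norm. Rounding M up to an integer costs the
    summand 1. *)
Lemma V_net : exists e : nat -> V, forall v (M : R), `|v| <= M -> exists k : nat -> nat,
    (forall n, `|e (k n)| <= M + 1) /\ i (e (k n)) @[n --> \oo] --> i v.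
Proof.
have [d hd] := H_dense_seq.
pose P (t : nat * nat * nat) : set V := [set v | `|v| <= t.2%:R /\ `|i v - d t.1.1| < t.1.2.+1%:R^-1].
pose e n := if unpickle n is Some t then xget 0 (P t) else 0.
exists e => v M vM.
have M0 : 0 <= M by exact: le_trans (normr_ge0 _) vM.
pose B := Num.truncn M; have [BM MB] : B%:R <= M /\ M < B.+1%:R.
  by have := truncn_itv M0; move=> /andP[].
have ex n : exists k, P (k, n, B.+1) v.
  have [k hk] : exists k, `|i v - d k| < n.+1%:R^-1 by apply: hd; rewrite invr_gt0.
  by exists k; split => //=; rewrite (le_trans vM)// ltW.
have [k hk] := choice ex.
exists (fun n => pickle (k n, n, B.+1)).
have ePk n : P (k n, n, B.+1) (e (pickle (k n, n, B.+1))).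
  by rewrite /e pickleK; case: xgetP => [u -> //|/(_ v)/(_ (hk n))].
split=> [n|].
  by have [h _] := ePk n; rewrite (le_trans h)//= -natr1 lerD2r.
apply/cvgrPdist_lt => eps eps0; have e2 : 0 < eps / 2 by rewrite divr_gt0.
near=> n; have [_ h1] := ePk n; have [_ h2] := hk n; move: h1 h2 => /= h1 h2.
have h3 : n.+1%:R^-1 < eps / 2 by near: n; have := near_infty_natSinv_lt (PosNum e2).
rewrite -(subrK (d (k n)) (i v)) -addrA (le_lt_trans (ler_normD _ _))//.
by rewrite (distrC (d (k n))) (splitr eps) ltrD// (lt_trans _ h3).
Unshelve. all: by end_near. Qed.

Definition comb (e : nat -> V) (L : seq (R * nat)) := \sum_(x <- L) x.1 *: e x.2.

(** Separability passes from H to V by reflexivity. The distance p to the span of the net is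
    sublinear. A linear functional below p vanishes on the net, hence also at v, which by [weak_cvg]
    is a weak limit of vectors of the net; Hahn-Banach at v then gives p v = 0. Rational
    coefficients make the span countable. *)
Lemma V_dense_seq : exists d : nat -> V, dense_seq d.
Proof.
have [e he] := V_net.
pose p v := inf [set `|v - comb e L| | L in setT].
have p_lb v : has_lbound [set `|v - comb e L| | L in setT] by exists 0 => _ [? _ <-].
have p_le v L : p v <= `|v - comb e L| by apply: ge_inf => //; exists L.
have le_p v c : (forall L, c <= `|v - comb e L|) -> c <= p v.
  move=> h; apply: lb_le_inf; first by exists `|v - comb e [::]|, [::].
  by move=> _ [L _ <-].
have cat_comb L L' : comb e (L ++ L') = comb e L + comb e L' by rewrite /comb big_cat.
have scale_comb a L : comb e [seq (a * x.1, x.2) | x : R * nat <- L] = a *: comb e L.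
  by rewrite /comb big_map scaler_sumr; apply: eq_bigr => x _; rewrite scalerA.
have comb0 : comb e [::] = 0 by rewrite /comb big_nil.
have p_norm v : p v <= `|v| by rewrite (le_trans (p_le v [::]))// comb0 subr0.
have sp : sublinear p.
  apply: sublinear_suff.
  - move=> x y; rewrite -lerBlDr; apply: (le_p _ _) => L.
    rewrite lerBlDr -lerBlDl; apply: (le_p _ _) => L'.
    rewrite lerBlDl (le_trans (p_le _ (L ++ L')))// cat_comb opprD addrACA.
    by rewrite (le_trans (ler_normD _ _)).
  - move=> t x t0; rewrite -ler_pdivrMl//; apply: (le_p _ _) => L.
    rewrite ler_pdivrMl// (le_trans (p_le _ [seq (t * x.1, x.2) | x : R * nat <- L]))//.
    by rewrite scale_comb -scalerBr normrZ gtr0_norm.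
  - apply/eqP; rewrite eq_le (le_trans (p_norm _)) ?normr0//=.
    exact: (le_p _ _).
have p0 v : p v = 0.
  have [f [fl fp fv]] := hahn_banach v sp.
  have f0 : f 0 = 0 by have := fl (-1) 0 0; rewrite scaler0 addr0 mulN1r addNr.
  have fN w : f (- w) = - f w.
    by have := fl (-1) w 0; rewrite scaleN1r !addr0 f0 addr0 mulN1r.
  have fe n : f (e n) = 0.
    have h a : f (a *: e n) <= 0.
      rewrite (le_trans (fp _))// (le_trans (p_le _ [:: (a, n)]))//.
      by rewrite /comb big_seq1 subrr normr0.
    apply/eqP; rewrite eq_le; have := h 1; rewrite scale1r => ->/=.
    by have := h (-1); rewrite scaleN1r fN oppr_le0.
  have df : is_dual f.
    apply: (@bounded_is_dual _ _ _ 1) => // w; rewrite mul1r ler_norml.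
    by rewrite lerNl -fN -{1}(normrN w) !(le_trans (fp _)).
  have [k [kM ki]] := he v `|v| (lexx _).
  have [v0 [iv0 _ /(_ f df)]] := weak_cvg _ (nearW _ kM) ki.
  rewrite (i_inj iv0) => h; rewrite -fv; apply: cvg_unique h _ => //.
  rewrite (_ : (fun n => f (e (k n))) = (fun=> 0)); first exact: cvg_cst.
  by apply/funext => n; rewrite fe.
pose d n := if unpickle n is Some L then comb e [seq (ratr x.1, x.2) | x : rat * nat <- L] else 0.
have approx L (eps : R) : 0 < eps -> exists n, `|comb e L - d n| < eps.
  suff : 0 < eps -> exists L' : seq (rat * nat),
      `|comb e L - comb e [seq (ratr x.1, x.2) | x : rat * nat <- L']| < eps.
    by move=> h /h[L' hL']; exists (pickle L'); rewrite /d pickleK.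
  elim: L eps => [|[a n] L IH] eps eps0.
    by exists [::]; rewrite subrr normr0.
  have e2 : 0 < eps / 2 by rewrite divr_gt0.
  have [L' hL'] := IH _ e2.
  have N0 : 0 < `|e n| + 1 by rewrite ltr_wpDl.
  have d0 : 0 < eps / 2 / (`|e n| + 1) by rewrite divr_gt0.
  have [q] : exists q : rat, a < ratr q < a + eps / 2 / (`|e n| + 1).
    have [q /itvP hq] := rat_in_itvoo (ltr_pwDr d0 (lexx a)).
    by exists q; rewrite !hq.
  move=> /andP[q1 q2]; exists ((q, n) :: L').
  rewrite /comb /= !big_cons -!/(comb _ _) /= opprD addrACA -scalerBl.
  rewrite (le_lt_trans (ler_normD _ _))// (splitr eps) ler_ltD// normrZ.
  rewrite distrC gtr0_norm ?subr_gt0// (@le_trans _ _ (eps / 2 / (`|e n| + 1) * (`|e n| + 1)))//.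
    by rewrite ler_pM// ?subr_ge0 ?ltW// ?ltrDl// ltrBlDl.
  by rewrite mulfVK// gt_eqF.
exists d => v eps eps0; have e2 : 0 < eps / 2 by rewrite divr_gt0.
have [L hL] : exists L, `|v - comb e L| < eps / 2.
  apply: contrapT => nL; have := p0 v; apply/eqP; rewrite gt_eqF//.
  rewrite (lt_le_trans e2)//; apply: (le_p _ _) => L; rewrite leNgt; apply/negP => h.
  by apply: nL; exists L.
have [n hn] := approx L _ e2; exists n.
rewrite -(subrK (comb e L) v) -addrA (le_lt_trans (ler_normD _ _))//.
by rewrite (splitr eps) ltrD.
Qed.

(* Junk value 0 outside the range of i. *)
Definition iinv (h : H) : V := xget 0 [set v | i v = h].

Lemma iinvK v : iinv (i v) = v.
Proof. by rewrite /iinv; case: xgetP => [u _ /= /i_inj //|/(_ v)/(_ erefl)]. Qed.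

Lemma i_iinv h : range i h -> i (iinv h) = h.
Proof. by move=> [v _ <-]; rewrite iinvK. Qed.

(** A limit in H of vectors bounded in V is the image of a weak limit in V, which keeps the bound.
    This closedness is what makes [range i] and [iinv] Borel measurable. *)
Lemma closed_i_ball M : closed [set h | exists2 v, i v = h & `|v| <= M].
Proof.
move=> h hcl.
have ex n : exists v, `|v| <= M /\ `|h - i v| < n.+1%:R^-1.
  have [|_ [[v <- vM]]] := hcl (ball h n.+1%:R^-1).
    by apply: nbhsx_ballx; rewrite invr_gt0.
  by rewrite -ball_normE => hv; exists v.
have [v hv] := choice ex.
have vh : i (v n) @[n --> \oo] --> h.
  apply/cvgrPdist_lt => eps eps0; near=> n; rewrite (lt_trans (hv n).2)//.
  by near: n; have := near_infty_natSinv_lt (PosNum eps0).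
have [v0 [iv0 v0M _]] := weak_cvg _ (nearW _ (fun n => (hv n).1)) vh.
by exists v0.
Unshelve. all: by end_near. Qed.

End Gelfand.

(** * The Browder-Minty theorem *)

Section Game.
Variables (R : realType) (I : finType) (a : I -> I -> R).

(* Minimise the sum of the squares of the negative parts r_i of (a l)_i over the
   simplex: moving l towards r / |r|_1 decreases it, because r^T a r >= 0. *)
Lemma copositive_game (j0 : I) (e : R) : 0 < e ->
  (forall m : I -> R, (forall i, 0 <= m i) -> 0 <= \sum_i \sum_j m i * m j * a i j) ->
  exists l : I -> R, [/\ forall i, 0 <= l i, \sum_i l i = 1 &
    forall i, - e <= \sum_j l j * a i j].
Proof.
move=> e0 cop.
pose simplex (l : I -> R) := (forall i, 0 <= l i) /\ \sum_i l i = 1.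
pose s (l : I -> R) i := \sum_j l j * a i j.
pose r (l : I -> R) i := Num.max 0 (- s l i).
pose phi l := \sum_i (r l i) ^+ 2.
have r0 l i : 0 <= r l i by rewrite le_max lexx.
have phi0 l : 0 <= phi l by apply: sumr_ge0 => i _; rewrite sqr_ge0.
pose L := \sum_i (\sum_j `|a i j|) ^+ 2 + 1.
have L0 : 0 < L by rewrite ltr_wpDl// sumr_ge0// => i _; rewrite sqr_ge0.
suff [l [[l0 l1] lphi]] : exists l, simplex l /\ phi l < e ^+ 2.
  exists l; split => // i; rewrite lerNl.
  have h1 : r l i ^+ 2 <= phi l.
    by rewrite /phi (bigD1 i)//= lerDl sumr_ge0// => k _; rewrite sqr_ge0.
  have h2 : r l i <= e.
    by rewrite -(@ler_pXn2r _ 2)// ?nnegrE ?(ltW e0)// (le_trans h1)// ltW.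
  by rewrite (le_trans _ h2)// le_max lexx orbT.
pose S := [set phi l | l in simplex].
have lbS : has_lbound S by exists 0 => _ [l _ <-].
have S0 : S !=set0.
  exists (phi (fun j => (j == j0)%:R)), (fun j => (j == j0)%:R) => //; split => //.
  rewrite (bigD1 j0)//= eqxx big1 ?addr0// => j /negbTE -> //.
(* If phi l >= e^2, the step of length t gives phi m <= phi l - 2 t phi l + t^2 L <= phi l - t e^2,
   since t L <= e^2. As l is chosen within t e^2 of the infimum, phi m would fall below it. *)
pose t := Num.min 1 (e ^+ 2 / L).
have t0 : 0 < t by rewrite lt_min ltr01 divr_gt0// exprn_gt0.
have t1 : t <= 1 by rewrite ge_min lexx.
have tL : t * L <= e ^+ 2 by rewrite -ler_pdivlMr// ge_min lexx orbT.
have te0 : 0 < t * e ^+ 2 by rewrite mulr_gt0// exprn_gt0.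
have [_ [l [l0 l1] <-] lS] := inf_adherent te0 (conj S0 lbS).
exists l; split => //; rewrite ltNge; apply/negP => le2.
pose r1 := \sum_i r l i.
have r1p : 0 < r1.
  rewrite lt_neqAle sumr_ge0// andbT eq_sym; apply/eqP => r10.
  have : phi l = 0.
    rewrite /phi big1// => i _; have /eqP := r10; rewrite psumr_eq0// => /allP/(_ i).
    by rewrite mem_index_enum => /(_ isT)/eqP ->; rewrite expr0n.
  by move=> p0; move: le2; rewrite p0 leNgt exprn_gt0.
pose l' i := r l i / r1.
have l'0 i : 0 <= l' i by rewrite divr_ge0// ltW.
have l'1 : \sum_i l' i = 1 by rewrite -mulr_suml divff// gt_eqF.
have le1 (m : I -> R) i : simplex m -> m i <= 1.
  by move=> [m0 <-]; rewrite (bigD1 i)//= lerDl sumr_ge0.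
pose d i := l' i - l i.
have d1 i : `|d i| <= 1.
  have := le1 _ i (conj l'0 l'1); have := le1 _ i (conj l0 l1); have := l'0 i; have := l0 i.
  by rewrite /d ler_norml; lra.
pose m i := l i + t * d i.
have mS : simplex m.
  split => [i|]; last first.
    by rewrite big_split/= -mulr_sumr sumrB l'1 l1 subrr mulr0 addr0.
  rewrite (_ : m i = (1 - t) * l i + t * l' i); last by rewrite /m /d; ring.
  by rewrite addr_ge0// mulr_ge0// ?subr_ge0// ltW.
have sm i : s m i = s l i + t * s d i.
  rewrite /s mulr_sumr -big_split/=; apply: eq_bigr => j _; rewrite /m; ring.
(* With r the negative part of x one has - (x + t y) <= r - t y, so the squared negative part of x +
   t y is at most (r - t y)^2. *)
have rm i : r m i ^+ 2 <= r l i ^+ 2 - 2 * t * (r l i * s d i) + t ^+ 2 * (s d i) ^+ 2.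
  rewrite /r sm; set x := s l i; set y := s d i.
  rewrite /Num.max; case: (ltP 0 (- (x + t * y))) => h1; case: (ltP 0 (- x)) => h2; nra.
have sd i : (s d i) ^+ 2 <= (\sum_j `|a i j|) ^+ 2.
  rewrite -[leLHS]ger0_norm ?sqr_ge0// normrX ler_sqr ?nnegrE// ?sumr_ge0//.
  rewrite (le_trans (ler_norm_sum _ _ _))// ler_sum// => j _.
  by rewrite normrM ler_piMl.
have rs : phi l <= \sum_i r l i * s d i.
  have -> : \sum_i r l i * s d i = \sum_i r l i * s l' i + phi l.
    rewrite /phi -big_split/=; apply: eq_bigr => i _.
    have -> : s d i = s l' i - s l i.
      by rewrite /s -sumrB; apply: eq_bigr => j _; rewrite /d; ring.
    rewrite /r; case: leP => h; ring.
  rewrite lerDr.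
  have -> : \sum_i r l i * s l' i = r1^-1 * \sum_i \sum_j r l i * r l j * a i j.
    rewrite mulr_sumr; apply: eq_bigr => i _; rewrite /s !mulr_sumr.
    by apply: eq_bigr => j _; rewrite /l'; ring.
  by rewrite mulr_ge0 ?invr_ge0 ?(ltW r1p)//; exact: cop.
have phim : phi m <= phi l - 2 * t * \sum_i r l i * s d i + t ^+ 2 * L.
  have h : phi m <= \sum_i (r l i ^+ 2 - 2 * t * (r l i * s d i) + t ^+ 2 * (s d i) ^+ 2).
    exact: ler_sum.
  rewrite (le_trans h)// big_split/= sumrB -!mulr_sumr lerD2l ler_pM2l ?exprn_gt0//.
  by rewrite /L -[leLHS]addr0 lerD// ler_sum.
have mge : inf S <= phi m by apply: ge_inf => //; exists m.
have h1 := ler_wpM2l (ltW t0) rs; have h2 := ler_wpM2l (ltW t0) tL.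
have h3 := ler_wpM2l (ltW t0) le2.
move: mge lS; set T := \sum_i _ in phim h1 *; lra.
Qed.

End Game.

Section BrowderMinty.
Variables (R : realType) (V : normedModType R) (B : V -> V -> R).
Hypothesis rV : Defs.reflexive V.
Hypothesis Bd : forall v, is_dual (B v).
Hypothesis Bm : forall v w, 0 <= B v (v - w) - B w (v - w).
Hypothesis Bh : forall v v1 v2 : V, continuous (fun s : R => B (v1 + s *: v2) v).
Implicit Types (u v w z : V) (M e : R).

(** u is sought among the convex combinations of F. The conditions then become the linear
    inequalities of [copositive_game] for a i j = B v_i (v_i - v_j), and monotonicity of B says
    exactly that a i j + a j i >= 0. *)
Lemma finite_minty (F : seq V) M e : 0 < e -> 0 <= M -> (forall v, v \in F -> `|v| <= M) ->
  exists2 u, `|u| <= M & forall v, v \in F -> - e <= B v (v - u).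
Proof.
move=> e0 M0 FM; case: F FM => [|v0 F'] FM; first by exists 0; rewrite ?normr0.
set F := v0 :: F' in FM *.
pose a (i j : 'I_(size F)) := B F`_i (F`_i - F`_j).
have j0 : 'I_(size F) by exact: ord0.
have [m m0|l [l0 l1 hl]] := @copositive_game R _ a j0 e e0.
  have -> : \sum_i \sum_j m i * m j * a i j =
      2^-1 * \sum_i \sum_j (m i * m j * (a i j + a j i)).
    under [in RHS]eq_bigr do under eq_bigr do rewrite mulrDr.
    under [in RHS]eq_bigr do rewrite big_split/=.
    rewrite big_split/= [in X in _ + X]exchange_big/=.
    under [in X in _ + X]eq_bigr do under eq_bigr do rewrite [m _ * m _]mulrC.
    by rewrite -mulr2n -[X in _ * X]mulr_natl mulrA mulVf ?mul1r.
  rewrite mulr_ge0// sumr_ge0// => i _; rewrite sumr_ge0// => j _.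
  rewrite !mulr_ge0// /a -[F`_j - F`_i]opprB (dualN (Bd _)).
  exact: Bm.
exists (\sum_j l j *: F`_j).
  rewrite (le_trans (ler_norm_sum _ _ _))//.
  rewrite -[leRHS]mul1r -l1 mulr_suml ler_sum// => j _.
  by rewrite normrZ ger0_norm// ler_wpM2l// FM// mem_nth.
move=> v vF; have vi : (index v F < size F)%N by rewrite index_mem.
have := hl (Ordinal vi); rewrite /a /= nth_index//.
rewrite (_ : B v _ = \sum_j l j * B v (v - F`_j))//.
rewrite -[X in X - \sum_j _]scale1r -l1 scaler_suml -sumrB.
have sumB (f : 'I_(size F) -> V) : B v (\sum_j f j) = \sum_j B v (f j).
  by apply: (big_morph (B v) (dualD (Bd v)) (dual0 (Bd v))).
by rewrite sumB; apply: eq_bigr => j _; rewrite -scalerBr (dualZ (Bd v)).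
Qed.

(** Pairs of a finite set of test points and a tolerance 1 / (n + 1) form a directed set; an
    ultrafilter finer than its filter yields a weak limit of the solutions for finite sets. For
    fixed v the expression B v (v - u) is affine and weakly continuous in u, so the inequalities
    pass to the limit and the tolerance disappears. *)
Lemma minty_ball M : 0 <= M ->
  exists2 u, `|u| <= M & forall v, `|v| <= M -> 0 <= B v (v - u).
Proof.
move=> M0.
have ex (p : seq V * nat) : exists u, `|u| <= M /\ forall v, v \in p.1 -> `|v| <= M ->
    - p.2.+1%:R^-1 <= B v (v - u).
  have [|v|u uM hu] := @finite_minty [seq v <- p.1 | `|v| <= M] M p.2.+1%:R^-1 _ M0.
  - by rewrite invr_gt0.
  - by rewrite mem_filter => /andP[].
  - by exists u; split => // v vp vM; apply: hu; rewrite mem_filter vM.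
have [u hu] := choice ex.
pose Fl : set_system (seq V * nat) :=
  filter_from setT (fun p : seq V * nat => [set q : seq V * nat | {subset p.1 <= q.1} /\ (p.2 <= q.2)%N]).
have FlF : ProperFilter Fl.
  apply: filter_from_proper; last by move=> p _; exists p; split.
  apply: filter_from_filter; first by exists ([::], 0%N).
  move=> p q _ _; exists (p.1 ++ q.1, maxn p.2 q.2) => // r [/= h1 h2].
  move: h2; rewrite geq_max => /andP[h2 h3].
  by split; split => // v vp; apply: h1; rewrite mem_cat vp ?orbT.
have [U [UU FU]] := ultraFilterLemma FlF.
have [u0 [u0M hu0]] := reflexive_ultra rV UU (fun p => (hu p).1).
exists u0 => // v vM.
have c1 : B v (v - u p) @[p --> U] --> B v (v - u0).
  have -> : (fun p => B v (v - u p)) = (fun p => B v v - B v (u p)).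
    by apply/funext => p; rewrite (dualB (Bd v)).
  by rewrite (dualB (Bd v)); apply: cvgB; [exact: cvg_cst|exact: hu0].
suff h c : 0 < c -> - c <= B v (v - u0).
  rewrite leNgt; apply/negP => n; have := h (- (B v (v - u0) / 2)).
  by rewrite oppr_gt0 ltr_pdivrMr// mul0r => /(_ n); lra.
move=> c0; rewrite -(cvg_lim _ c1)//; apply: limr_ge; first by apply/cvg_ex; exists (B v (v - u0)).
pose k := Num.truncn c^-1.
have kc : k.+1%:R^-1 <= c.
  rewrite invf_ple ?posrE//.
  by have := truncn_itv (ltW (eq_ind _ (fun b => is_true b) c0 _ (esym (invr_gt0 c)))); case/andP => _ /ltW.
apply: FU; exists ([:: v], k) => // p [/= h1 h2].
rewrite (le_trans _ ((hu p).2 v _ vM)) ?h1 ?mem_head// lerN2 (le_trans _ kc)//.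
by rewrite lef_pV2 ?posrE// ler_nat ltnS.
Qed.

(** Testing with u + t (w - u), dividing by t and letting t decrease to 0 replaces B v by B u, by
    hemicontinuity. The test w = 0 and coercivity exclude |u| = M, so u is interior to the ball,
    every direction is admissible, and the inequality for a direction and its opposite is an
    equation. *)
Lemma browder_minty M : 0 < M -> (forall v, M <= `|v| -> 0 < B v v) ->
  exists u, forall w, B u w = 0.
Proof.
move=> M0 Bc; have [u uM hu] := minty_ball (ltW M0).
have VI w : `|w| <= M -> 0 <= B u (w - u).
  move=> wM; have c1 : B (u + t *: (w - u)) (w - u) @[t --> 0^'+] --> B u (w - u).
    apply: cvg_at_right_filter.
    have h : continuous (fun s : R => B (u + s *: (w - u)) (w - u)) by exact: Bh.
    by have := h 0; rewrite /continuous_at scale0r addr0.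
  rewrite -(cvg_lim _ c1)//; apply: limr_ge; first by apply/cvg_ex; exists (B u (w - u)).
  near=> t; have t0 : 0 < t by [].
  have t1 : t <= 1 by near: t; exact: nbhs_right_le.
  have vE : u + t *: (w - u) = (1 - t) *: u + t *: w.
    by rewrite scalerBr scalerBl scale1r addrA addrAC.
  have : `|u + t *: (w - u)| <= M.
    have t10 : 0 <= 1 - t by rewrite subr_ge0.
    rewrite vE (le_trans (ler_normD _ _))// !normrZ (ger0_norm t10) (gtr0_norm t0).
    have := lerD (ler_wpM2l t10 uM) (ler_wpM2l (ltW t0) wM).
    by rewrite -[X in _ <= X -> _]mulrDl subrK mul1r.
  by move=> /hu; rewrite addrAC subrr add0r (dualZ (Bd _)) pmulr_rge0.
have uM' : `|u| < M.
  rewrite lt_neqAle uM andbT; apply/eqP => uE.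
  have := VI 0; rewrite normr0 sub0r (dualN (Bd _)) oppr_ge0 => /(_ (ltW M0)).
  by rewrite leNgt Bc// uE.
have ge0 z : 0 <= B u z.
  pose e := (M - `|u|) / (`|z| + 1).
  have z1 : 0 < `|z| + 1 by rewrite ltr_wpDl.
  have e0 : 0 < e by rewrite divr_gt0// subr_gt0.
  have := VI (u + e *: z); rewrite addrAC subrr add0r (dualZ (Bd _)) pmulr_rge0//; apply.
  rewrite (le_trans (ler_normD _ _))// -lerBrDl normrZ gtr0_norm//.
  rewrite (@le_trans _ _ (e * (`|z| + 1)))// ?ler_wpM2l ?(ltW e0)// ?lerDl//.
  by rewrite /e mulfVK// gt_eqF.
exists u => w; apply/eqP; rewrite eq_le ge0 andbT -oppr_ge0 -(dualN (Bd u)).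
exact: ge0.
Unshelve. all: by end_near. Qed.

End BrowderMinty.

(** * Power inequalities, the operator and its resolvent *)

Section Young.
Variable R : realType.
Implicit Types a b z al : R.

(** Young's inequality without the conjugate exponent: the first term dominates if b <= z a, the
    second one otherwise. A small z allows the first term to be absorbed, at the price of the factor
    z^(1 - al) on the second. *)
Lemma powR_youngl al a b z : 1 < al -> 0 <= a -> 0 <= b -> 0 < z ->
  a `^ (al - 1) * b <= z * a `^ al + z `^ (1 - al) * b `^ al.
Proof.
move=> al1 a0 b0 z0; have al0 : 0 < al by exact: lt_trans al1.
have [h|h] := leP b (z * a).
  rewrite ler_wpDr ?mulr_ge0 ?powR_ge0//.
  rewrite -(mulr_powRB1 a0 al0) mulrA [leLHS]mulrC ler_wpM2r ?powR_ge0//.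
rewrite ler_wpDl ?mulr_ge0 ?powR_ge0 ?(ltW z0)//.
rewrite -(mulr_powRB1 b0 al0) mulrCA [leLHS]mulrC ler_wpM2l//.
have e1 : 1 - al = - (al - 1) by rewrite opprB.
rewrite e1 powRN ler_pdivlMl ?powR_gt0//.
rewrite -powRM ?(ltW z0)// ge0_ler_powR ?nnegrE ?subr_ge0 ?(ltW al1)// ?mulr_ge0 ?(ltW z0)//.
exact: ltW.
Qed.

Lemma powRD_le al a b : 0 <= al -> 0 <= a -> 0 <= b ->
  (a + b) `^ al <= 2 `^ al * (a `^ al + b `^ al).
Proof.
move=> al0 a0 b0; wlog ab : a b a0 b0 / a <= b.
  by move=> h; have [/h|/ltW/h] := leP a b; [exact|rewrite addrC [X in _ * X]addrC; exact].
rewrite (@le_trans _ _ ((2 * b) `^ al))//.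
  by rewrite ge0_ler_powR ?nnegrE ?addr_ge0// ?mulr_ge0//; lra.
by rewrite powRM// ler_wpM2l ?powR_ge0// lerDr powR_ge0.
Qed.

Lemma le_powR1 al a : 1 <= al -> 0 <= a -> a <= 1 + a `^ al.
Proof.
move=> al1 a0; have [a1|/ltW a1] := leP a 1; first by rewrite ler_wpDr// powR_ge0.
by rewrite ler_wpDl// le1r_powR.
Qed.

End Young.

Record monotone_op (R : realType) (V H : completeNormedModType R) (ip : H -> H -> R)
  (i : V -> H) (A : V -> V -> R) (alpha delta K C : R) : Prop := MonotoneOp {
  mo_gel : gelfand_triple ip i;
  mo_dual : forall v, is_dual (A v);
  mo_meas : forall B, borel_dual B -> @borel V (A @^-1` B);
  mo_alpha : 1 < alpha;
  mo_delta : 0 < delta;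
  mo_hemi : forall v v1 v2 : V, continuous (fun s : R => A (v1 + s *: v2) v);
  mo_mono : forall v1 v2 : V,
     2 * (A v1 (v1 - v2) - A v2 (v1 - v2)) <= C * `|i (v1 - v2)| ^+ 2;
  mo_coer : forall v : V, 2 * A v v + delta * `|v| `^ alpha <= C + K * `|i v| ^+ 2;
  mo_grow : forall v : V, opnorm (A v) <= C * (1 + `|v| `^ (alpha - 1)) }.

Section Resolvent.
Variables (R : realType) (V H : completeNormedModType R) (ip : H -> H -> R) (i : V -> H).
Variables (A : V -> V -> R) (alpha delta K C : R).
Hypothesis mo : monotone_op ip i A alpha delta K C.
Let hG := mo_gel mo.
Let Ad := mo_dual mo.
Implicit Types (u v w : V) (x y h g : H).

Lemma mo_alpha0 : 0 < alpha. Proof. exact: lt_trans (mo_alpha mo). Qed.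

Lemma mo_C0 : 0 <= C.
Proof.
have := mo_grow mo 0; rewrite normr0 powR0 ?addr0 ?mulr1; last first.
  by rewrite gt_eqF// subr_gt0 (mo_alpha mo).
by apply: le_trans; exact: opnorm_ge0 (Ad 0).
Qed.

Lemma mo_growth v w : `|A v w| <= C * (1 + `|v| `^ (alpha - 1)) * `|w|.
Proof. by rewrite (le_trans (le_opnorm (Ad v) w))// ler_wpM2r// (mo_grow mo). Qed.

(** The operator sending v to <i v - x, i .> - l A v falls under [browder_minty]: smallness of l C
    lets |i (v - w)|^2 absorb the defect of monotonicity of A, and smallness of l |K| lets |i v|^2
    absorb the K-term of the coercivity bound. *)
Lemma resolvent (l : R) x : 0 < l -> l * (C + `|K|) <= 1 ->
  exists v, forall w, ip (i v - x) (i w) = l * A v w.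
Proof.
move=> l0 lCK; have C0 := mo_C0.
pose B v w := ip (i v - x) (i w) - l * A v w.
have d0 := mo_delta mo; have al1 := mo_alpha mo.
have Bd v : is_dual (B v).
  have := is_dual_lin (- l) (Ad v) (ip_dual hG (i v - x)).
  by congr (is_dual _); apply/funext => w; rewrite /B; ring.
have lK : l * `|K| <= 1 - l * C by rewrite lerBrDl -mulrDr.
have lC : 0 <= l * C by rewrite mulr_ge0// ltW.
have lK0 : 0 <= l * `|K| by rewrite mulr_ge0// ltW.
have Bm v w : 0 <= B v (v - w) - B w (v - w).
  rewrite /B (iB hG) !(ipBl hG) !(ipBr hG).
  have h1 : `|i v - i w| ^+ 2 = ip (i v) (i v) - ip (i v) (i w) - (ip (i w) (i v) - ip (i w) (i w)).
    by rewrite -(ipxx hG) !(ipBl hG) !(ipBr hG); ring.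
  have h2 := mo_mono mo v w; rewrite (iB hG) in h2.
  have h3 := sqr_ge0 `|i v - i w|.
  have h4 : l * C <= 1 by lra.
  have h5 := ler_wpM2r h3 h4.
  have h6 := ler_wpM2l (ltW l0) h2.
  set D := `|i v - i w| ^+ 2 in h1 h2 h3 h5 h6; nra.
have Bh (v v1 v2 : V) : continuous (fun s : R => B (v1 + s *: v2) v).
  move=> s.
  have -> : (fun s : R => B (v1 + s *: v2) v) = (fun s : R => ip (i v1 - x) (i v) + s * ip (i v2) (i v) - l * A (v1 + s *: v2) v).
    apply/funext => t; rewrite /B (iD hG) (iZ hG).
    have -> : i v1 + t *: i v2 - x = t *: i v2 + (i v1 - x) by rewrite addrCA addrA.
    by rewrite (ipl hG); ring.
  apply: cvgB; last by apply: cvgM; [exact: cvg_cst|exact: (mo_hemi mo)].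
  by apply: cvgD; [exact: cvg_cst|apply: cvgM; [exact: cvg_id|exact: cvg_cst]].
have ld : 0 < l * delta by rewrite mulr_gt0.
(* Twice B v v is at least l delta |v|^alpha - |x|^2 - l C. The summand 1 in the radius gives |v| <=
   |v|^alpha and makes the final inequality strict. *)
have M0 : 0 < 1 + (`|x| ^+ 2 + l * C) / (l * delta).
  by rewrite ltr_wpDr// divr_ge0 ?addr_ge0 ?sqr_ge0// ltW.
have [|u hu] := browder_minty (V_refl hG) Bd Bm Bh M0; last first.
  by exists u => w; apply/eqP; rewrite -subr_eq0; apply/eqP; exact: hu.
move=> v vM; rewrite /B (ipBl hG) (ipxx hG).
have v1 : 1 <= `|v|.
  by rewrite (le_trans _ vM)// lerDl divr_ge0 ?addr_ge0 ?sqr_ge0// ltW.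
have va := le1r_powR v1 (ltW al1).
have h1 := ler_wpM2l (ltW l0) (mo_coer mo v).
have h2 := le_trans (ler_norm _) (cauchy_schwarz hG x (i v)).
have h3 : `|x| ^+ 2 + l * C < l * delta * `|v|.
  by rewrite -ltr_pdivrMl// (lt_le_trans _ vM)// [_^-1 * _]mulrC ltrDr.
have h4 := ler_wpM2l (ltW ld) va.
have h5 : l * (K * `|i v| ^+ 2) <= `|i v| ^+ 2.
  rewrite mulrA ler_piMl ?sqr_ge0// (@le_trans _ _ (l * `|K|))//; last lra.
  by rewrite ler_pM2l// ler_norm.
set X := `|x| in h2 h3 *; set N := `|i v| in h1 h2 h5 *; set W := `|v| `^ alpha in h1 h4.
have h6 : 2 * (X * N) <= X ^+ 2 + N ^+ 2 by have := sqr_ge0 (X - N); nra.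
nra.
Qed.

(** Take v from [resolvent] with right-hand side i v0: there A v is represented by (i v - i v0) / l,
    which lies in H, and i v tends to i v0 in H as l tends to 0. *)
Lemma domain_dense x (e : R) : 0 < e ->
  exists v g, `|x - i v| < e /\ forall w, A v w = ip g (i w).
Proof.
move=> e0; have C0 := mo_C0; have d0 := mo_delta mo; have al1 := mo_alpha mo.
have e2 : 0 < e / 2 by rewrite divr_gt0.
have [v0 hv0] := i_dense hG x e2.
have [z [z0 hz]] : exists z, 0 < z /\ C * z <= delta / 2.
  exists (delta / 2 / (C + 1)); have C1 : 0 < C + 1 by rewrite ltr_wpDl.
  split; first by rewrite !divr_gt0.
  by rewrite mulrCA ler_piMr ?ler_pdivrMr ?mul1r ?lerDl// ltW// divr_gt0.
(* What remains of A v (v - v0) after coercivity and growth: |v|^alpha has been absorbed by the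
   choice of z, and |i v|^2 split into |i v - i v0|^2 and |i v0|^2. Then |i v - i v0|^2 <= l c + l
   |K| |i v - i v0|^2, and l |K| <= 1/2. *)
pose c := `|K| * `|i v0| ^+ 2 + C / 2 + C * `|v0| + C * (z `^ (1 - alpha) * `|v0| `^ alpha).
have c0 : 0 <= c by rewrite /c !addr_ge0 ?mulr_ge0 ?sqr_ge0 ?powR_ge0// divr_ge0.
have CK : 0 < 2 * (C + `|K| + 1) by rewrite mulr_gt0// ltr_wpDl// addr_ge0.
pose l := Num.min (2 * (C + `|K| + 1))^-1 ((e / 2) ^+ 2 / (2 * c + 1)).
have c1 : 0 < 2 * c + 1 by rewrite ltr_wpDl// mulr_ge0.
have l0 : 0 < l by rewrite lt_min invr_gt0 CK divr_gt0// exprn_gt0.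
have lCK : l * (2 * (C + `|K| + 1)) <= 1.
  by rewrite -ler_pdivlMr// div1r ge_min lexx.
have lc : l * (2 * c + 1) <= (e / 2) ^+ 2.
  by rewrite -ler_pdivlMr// ge_min lexx orbT.
have lK0 : 0 <= l * `|K| by rewrite mulr_ge0// ltW.
have lC0 : 0 <= l * C by rewrite mulr_ge0// ltW.
have [|v hv] := resolvent (i v0) l0; first by move: lCK; lra.
exists v, (l^-1 *: (i v - i v0)); split; last first.
  by move=> w; rewrite (ipZl hG) hv mulrA mulVf ?mul1r ?gt_eqF.
rewrite (splitr e) -(subrK (i v0) x) -addrA (le_lt_trans (ler_normD _ _))// ltrD//.
rewrite -(ltr_pXn2r (n := 2))// ?nnegrE ?(ltW e2)//.
have h0 := hv (v - v0); rewrite (iB hG) (ipxx hG) (dualB (Ad v)) in h0.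
have h1 := mo_coer mo v.
have h2 := le_trans (ler_norm _) (mo_growth v (- v0)); rewrite (dualN (Ad v)) normrN in h2.
have h3 := powR_youngl al1 (normr_ge0 v) (normr_ge0 v0) z0.
have h4 : `|i v| ^+ 2 <= 2 * `|i v - i v0| ^+ 2 + 2 * `|i v0| ^+ 2.
  by rewrite -{1}(subrK (i v0) (i v)) (normD2_le hG).
have h5 : K * `|i v| ^+ 2 <= `|K| * `|i v| ^+ 2 by rewrite ler_wpM2r ?sqr_ge0// ler_norm.
have h6 := ler_wpM2l (normr_ge0 K) h4.
have h7 := ler_wpM2l C0 h3.
have h8 := ler_wpM2r (powR_ge0 `|v| alpha) hz.
rewrite distrC h0.
set W := `|v| `^ alpha in h1 h3 h7 h8; set P := `|v| `^ (alpha - 1) in h2 h3 h7.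
have h9 : A v v - A v v0 <= c + `|K| * `|i v - i v0| ^+ 2.
  rewrite /c; nra.
have h10 := ler_wpM2l (ltW l0) h9; rewrite -h0 in h10.
have h11 : l * `|K| <= 2^-1 by lra.
have h12 := ler_wpM2r (sqr_ge0 `|i v - i v0|) h11.
rewrite -h0; lra.
Qed.

End Resolvent.

(** * Integrals over compact intervals and Gronwall's inequality *)

Section Intervals.
Variable R : realType.
Notation mu := (@lebesgue_measure R).
Notation RM := (measurableTypeR R).
Implicit Types (f g h : R -> R) (a b c t s : R).

(* Measurability is required on the whole line, integrability on [a, b] only. *)
Definition intg a b g := measurable_fun [set: RM] g /\ mu.-integrable `[a, b] (EFin \o g).
Definition I a b g := \int[mu]_(t in `[a, b]) g t.
Definition aeab a b (P : R -> Prop) := {ae mu, forall t, a <= t <= b -> P t}.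

Lemma aeF : Filter (almost_everywhere mu).
Proof. exact: (ae_filter_ringOfSetsType mu). Qed.

Lemma mitv a b : @measurable _ RM `[a, b]. Proof. exact: measurable_itv. Qed.
Hint Resolve mitv : core.

Lemma aeabW a b (P : R -> Prop) : (forall t, a <= t <= b -> P t) -> aeab a b P.
Proof. by move=> h; rewrite /aeab; apply: aeW. Qed.

Lemma aeab_filter a b (P Q : R -> Prop) : (forall t, a <= t <= b -> P t -> Q t) -> aeab a b P -> aeab a b Q.
Proof. by move=> PQ; rewrite /aeab; apply: (@filterS _ _ aeF) => t h tab; apply: PQ => //; exact: h. Qed.

Lemma aeabI a b (P Q : R -> Prop) : aeab a b P -> aeab a b Q -> aeab a b (fun t => P t /\ Q t).
Proof. by rewrite /aeab; apply: (@filterS2 _ _ aeF) => t h1 h2 tab; split; [exact: h1|exact: h2]. Qed.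

Lemma aeab2 a b (P Q S : R -> Prop) : (forall t, a <= t <= b -> P t -> Q t -> S t) ->
  aeab a b P -> aeab a b Q -> aeab a b S.
Proof. by move=> PQS h1 h2; apply: aeab_filter (aeabI h1 h2) => t tab [p q]; exact: PQS. Qed.

Lemma aeab_seq a b (P : nat -> R -> Prop) : (forall n, aeab a b (P n)) ->
  aeab a b (fun t => forall n, P n t).
Proof.
by move=> h; rewrite /aeab; apply: (@filterS _ _ aeF) (ae_foralln h) => t /= ht tab n; exact: ht.
Qed.

Lemma aeabS a b c d (P : R -> Prop) : a <= c -> d <= b -> aeab a b P -> aeab c d P.
Proof.
move=> ac db; rewrite /aeab; apply: (@filterS _ _ aeF) => t h /andP[ct td]; apply: h.
by rewrite (le_trans ac ct) (le_trans td db).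
Qed.

Lemma subitv a b c d : a <= c -> d <= b -> `[c, d] `<=` `[a, b].
Proof.
move=> ac db t /=; rewrite !in_itv/= => /andP[ct td].
by rewrite (le_trans ac ct) (le_trans td db).
Qed.

Lemma intgS a b c d g : a <= c -> d <= b -> intg a b g -> intg c d g.
Proof.
move=> ac db [mg ig]; split => //.
by apply: integrableS ig => //; exact: subitv.
Qed.

Lemma intgD a b f g : intg a b f -> intg a b g -> intg a b (fun t => f t + g t).
Proof.
by move=> [mf if_] [mg ig]; split; [exact: measurable_funD|exact: (integrableD (mitv a b) if_ ig)].
Qed.

Lemma intgZ a b k g : intg a b g -> intg a b (fun t => k * g t).
Proof.
by move=> [mg ig]; split; [exact: measurable_funM|exact: (integrableZl (mitv a b) k ig)].
Qed.

Lemma intgN a b g : intg a b g -> intg a b (fun t => - g t).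
Proof. by move=> /(intgZ (-1)); under eq_fun do rewrite mulN1r. Qed.

Lemma intgB a b f g : intg a b f -> intg a b g -> intg a b (fun t => f t - g t).
Proof. by move=> hf hg; apply: intgD => //; exact: intgN. Qed.

Lemma intg_norm a b g : intg a b g -> intg a b (fun t => `|g t|).
Proof. by move=> [mg ig]; split; [exact: measurableT_comp|exact: integrable_norm]. Qed.

Lemma intg_le a b f g : measurable_fun [set: RM] f -> (forall t, a <= t <= b -> `|f t| <= g t) ->
  intg a b g -> intg a b f.
Proof.
move=> mf fg [mg ig]; split => //; apply: le_integrable ig => //.
  by apply/measurable_EFinP; exact: measurable_funTS.
move=> t; rewrite /= in_itv/= => tab; rewrite lee_fin (le_trans (fg t tab))//.
exact: ler_norm.
Qed.

Lemma intg_cst a b k : intg a b (fun=> k).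
Proof.
split; first exact: measurable_cst.
apply/integrableP; split; first exact: measurable_cst.
under eq_integral do rewrite /=.
rewrite integral_cst//= lebesgue_measure_itv/=; case: ifP => _; rewrite ?mule0 ?ltry//.
Qed.

Lemma intg_cont a b g : continuous g -> intg a b g.
Proof.
move=> cg; split; first exact: continuous_measurable_fun.
apply: continuous_compact_integrable; first exact: segment_compact.
by apply: continuous_subspaceT => x; exact: cg.
Qed.

Lemma ID a b f g : intg a b f -> intg a b g -> I a b (fun t => f t + g t) = I a b f + I a b g.
Proof. by move=> [_ hf] [_ hg]; exact: RintegralD. Qed.

Lemma IB a b f g : intg a b f -> intg a b g -> I a b (fun t => f t - g t) = I a b f - I a b g.
Proof. by move=> [_ hf] [_ hg]; exact: RintegralB. Qed.

Lemma IZ a b k g : intg a b g -> I a b (fun t => k * g t) = k * I a b g.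
Proof. by move=> [_ hg]; exact: RintegralZl. Qed.

Lemma IN a b g : intg a b g -> I a b (fun t => - g t) = - I a b g.
Proof.
by move=> hg; rewrite -mulN1r -IZ//; congr I; apply/funext => t; rewrite mulN1r.
Qed.

Lemma I_cst a b k : a <= b -> I a b (fun=> k) = k * (b - a).
Proof.
move=> ab; rewrite /I Rintegral_cst//= lebesgue_measure_itv/= lte_fin.
by move: ab; rewrite le_eqVlt => /orP[/eqP ->|->//]; rewrite ltxx subrr.
Qed.

Lemma I_ae_eq a b f g : measurable_fun [set: RM] f -> measurable_fun [set: RM] g ->
  aeab a b (fun t => f t = g t) -> I a b f = I a b g.
Proof.
move=> mf mg fg; congr fine; apply: ae_eq_integral => //.
- by apply/measurable_EFinP; exact: measurable_funTS.
- by apply/measurable_EFinP; exact: measurable_funTS.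
- by apply: (@filterS _ _ aeF) fg => t h; rewrite /= in_itv/= => /h ->.
Qed.

Lemma I_eq a b f g : (forall t, a <= t <= b -> f t = g t) -> I a b f = I a b g.
Proof.
move=> fg; apply: eq_Rintegral => t; rewrite inE /= in_itv/=; exact: fg.
Qed.

Lemma I_le a b f g : intg a b f -> intg a b g ->
  aeab a b (fun t => f t <= g t) -> I a b f <= I a b g.
Proof.
move=> hf hg fg; have mM : measurable_fun [set: RM] (fun t => Num.max (f t) (g t)).
  exact: measurable_maxr hf.1 hg.1.
have hM : intg a b (fun t => Num.max (f t) (g t)).
  apply: (intg_le mM) (intgD (intg_norm hf) (intg_norm hg)) => t _.
  by rewrite /Num.max; case: ifP => _; rewrite ?lerDl ?lerDr.
rewrite (@le_trans _ _ (I a b (fun t => Num.max (f t) (g t))))//.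
  by apply: le_Rintegral => //; [exact: hf.2|exact: hM.2|move=> t _; rewrite le_max lexx].
rewrite (I_ae_eq mM hg.1)//.
by apply: aeab_filter fg => t _ h; rewrite max_r.
Qed.

Lemma I_ge0 a b f : (forall t, a <= t <= b -> 0 <= f t) -> 0 <= I a b f.
Proof. by move=> h; apply: Rintegral_ge0 => t /=; rewrite in_itv/=; exact: h. Qed.

Lemma I_norm a b f : intg a b f -> `|I a b f| <= I a b (fun t => `|f t|).
Proof. by move=> hf; apply: le_normr_Rintegral => //; exact: hf.2. Qed.

Lemma I_abs_le a b f g : measurable_fun [set: RM] f -> intg a b g ->
  (forall t, a <= t <= b -> `|f t| <= g t) -> `|I a b f| <= I a b g.
Proof.
move=> mf hg fg; have hf : intg a b f by exact: intg_le fg hg.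
by rewrite (le_trans (I_norm hf))// I_le//; [exact: intg_norm|exact: aeabW].
Qed.

Lemma I_xx a f : I a a f = 0.
Proof. by rewrite /I set_itv1 Rintegral_set1. Qed.

Lemma I_split a b c g : a <= c -> c <= b -> intg a b g -> I a b g = I a c g + I c b g.
Proof.
move=> ac cb [mg ig]; have := @Rintegral_itvB _ g (BLeft a) (BRight b) c ig.
rewrite !bnd_simp => /(_ ac cb) e.
rewrite /I -[X in _ = _ + X]Rintegral_itv_obnd_cbnd; first by rewrite -e subrKC.
by apply: integrableS ig => // t; rewrite /= !in_itv/= => /andP[ct ->]; rewrite (le_trans ac (ltW ct)).
Qed.

Lemma intg_split a b c g : a <= c -> c <= b -> intg a c g -> intg c b g -> intg a b g.
Proof.
move=> ac cb [mg h1] [_ h2]; split => //.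
have e : [set` `[a, b]] = `[a, c] `|` `]c, b].
  apply/seteqP; split => t /=; rewrite !in_itv/=.
    by move=> /andP[at_ tb]; have [tc|tc] := leP t c; [left|right]; apply/andP; split.
  move=> [|] /andP[h3 h4]; apply/andP; split => //; first exact: le_trans cb.
  by rewrite (le_trans ac)// ltW.
have mg' (D : set RM) : measurable_fun D (fun t => `|(EFin \o g) t|%E).
  by apply: measurableT_comp => //; apply/measurable_EFinP; exact: measurable_funTS.
apply/integrableP; split; first by apply/measurable_EFinP; exact: measurable_funTS.
rewrite e ge0_integral_setU//; last first.
  apply/disj_setPS => t /= []; rewrite !in_itv/= => /andP[_ tc] /andP[].
  by rewrite ltNge tc.
have h3 : mu.-integrable `]c, b] (EFin \o g).
  by apply: integrableS h2 => // t; rewrite /= !in_itv/= => /andP[/ltW -> ->].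
by move/integrableP: h1 => [_ ?]; move/integrableP: h3 => [_ ?]; by rewrite lte_add_pinfty.
Qed.

Lemma I_sub a b c d g : a <= c -> d <= b -> intg a b g -> (forall t, a <= t <= b -> 0 <= g t) ->
  I c d g <= I a b g.
Proof.
move=> ac db hg g0; have [cd|dc] := leP c d; last first.
  rewrite (_ : I c d g = 0) ?I_ge0// /I set_itv_ge ?Rintegral_set0//.
  by rewrite bnd_simp -ltNge.
have ad := le_trans ac cd.
rewrite (I_split ad db hg) (I_split ac cd (intgS (lexx a) db hg)).
rewrite -addrA addrCA lerDl addr_ge0// I_ge0// => t /andP[h1 h2]; apply: g0.
  by rewrite h1 (le_trans h2)// (le_trans cd).
by rewrite (le_trans _ h1).
Qed.


Lemma I_dct a b (f : nat -> R -> R) (h g : R -> R) : (forall n, measurable_fun [set: RM] (f n)) ->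
  measurable_fun [set: RM] h -> intg a b g ->
  aeab a b (fun t => f n t @[n --> \oo] --> h t) ->
  aeab a b (fun t => forall n, `|f n t| <= g t) ->
  intg a b h /\ I a b (f n) @[n --> \oo] --> I a b h.
Proof.
move=> mf mh [mg ig] fh fg.
have mE (k : R -> R) (D : set RM) : measurable_fun [set: RM] k -> measurable_fun D (EFin \o k).
  by move=> mk; apply/measurable_EFinP; exact: measurable_funTS.
have [] := @dominated_convergence _ _ _ mu `[a, b] (mitv a b) (fun n => EFin \o f n) (EFin \o h) (EFin \o g).
- by move=> n; exact: mE.
- exact: mE.
- apply: (@filterS _ _ aeF) fh => t ht; rewrite /= in_itv/= => /ht.
  by move=> c; apply: cvg_EFin => //; exact: nearW.
- exact: ig.
- apply: (@filterS _ _ aeF) fg => t ht n; rewrite /= in_itv/= => /ht/(_ n).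
  by rewrite lee_fin.
move=> ih _ c; split; first by split.
by apply: (fine_cvg _) => //; rewrite fineK//; exact: integrable_fin_num.
Qed.

(** g is the lower limit of f n, made finite on a null set. The last clause is the form in which it
    is applied: at almost every t infinitely many f n t lie below one finite bound, so a bounded
    subsequence exists there. *)
Lemma I_fatou a b (f : nat -> R -> R) (B : R) : (forall n, intg a b (f n)) ->
  (forall n t, 0 <= f n t) -> (forall n, I a b (f n) <= B) ->
  exists g, [/\ intg a b g, forall t, 0 <= g t, I a b g <= B &
    aeab a b (fun t => forall e, 0 < e -> forall N : nat, exists2 n, (N <= n)%N & f n t <= g t + e)].
Proof.
move=> hf f0 fB.
pose G t := limn_einf (fun n => (f n t)%:E).
have mE (k : R -> R) (D : set RM) : measurable_fun [set: RM] k -> measurable_fun D (EFin \o k).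
  by move=> mk; apply/measurable_EFinP; exact: measurable_funTS.
have G0 t : (0 <= G t)%E.
  rewrite /G limn_einf_lim; apply: lime_ge; first exact: is_cvg_einfs.
  by apply: nearW => n; apply: le_ereal_inf_tmp => _ [m _ <-]; rewrite lee_fin.
have mG : measurable_fun [set: RM] G.
  rewrite /G /limn_einf; apply: measurableT_comp => //.
  apply: measurable_fun_limn_esup => n; apply: measurableT_comp => //; exact: mE (hf n).1.
have IG : (\int[mu]_(t in `[a, b]) G t <= B%:E)%E.
  apply: (le_trans (fatou mu (mitv a b) _ _)).
  - by move=> n; exact: mE (hf n).1.
  - by move=> n t _; rewrite lee_fin.
  rewrite limn_einf_lim; apply: lime_le; first exact: is_cvg_einfs.
  apply: nearW => n; apply: ereal_inf_le; exists (\int[mu]_(t in `[a, b]) (f n t)%:E)%E; first by exists n => /=.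
  have : (\int[mu]_(t in `[a, b]) (f n t)%:E)%E \is a fin_num.
    exact: integrable_fin_num (hf n).2.
  by move=> /fineK <-; rewrite lee_fin; exact: fB.
have iG : mu.-integrable `[a, b] G.
  apply/integrableP; split; first exact: measurable_funTS.
  by under eq_integral do rewrite gee0_abs//; rewrite (le_lt_trans IG)// ltry.
have fG := integrable_ae (mitv a b) iG.
exists (fun t => fine (G t)); split.
- split; first by apply: measurableT_comp.
  apply/integrableP; split.
    by apply/measurable_EFinP; apply: measurable_funTS; exact: measurableT_comp.
  rewrite (le_lt_trans _ (ltry B))// (le_trans _ IG)//; apply: ge0_le_integral => //.
  + by apply: measurableT_comp => //; apply/measurable_EFinP; apply: measurable_funTS; exact: measurableT_comp.
  + exact: measurable_funTS.
  + by move=> t _ /=; have := G0 t; case: (G t) => [r| |]//=; [rewrite lee_fin => r0; rewrite ger0_norm|rewrite normr0 leey].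
- by move=> t; rewrite fine_ge0.
- rewrite -lee_fin (le_trans _ IG)// /I /Rintegral.
  rewrite (_ : (\int[mu]_(t in `[a, b]) (fine (G t))%:E)%E = (\int[mu]_(t in `[a, b]) G t)%E).
    by rewrite fineK// integrable_fin_num.
  apply: ae_eq_integral => //.
  + by apply/measurable_EFinP; apply: measurable_funTS; exact: measurableT_comp.
  + exact: measurable_funTS.
  + by apply: (@filterS _ _ aeF) fG => t ht tab; rewrite fineK// ht.
- apply: (@filterS _ _ aeF) fG => t ht tab e e0 N; apply: contrapT => nex.
  have : ((fine (G t) + e)%:E <= G t)%E.
    rewrite [leRHS]/G limn_einf_lim; apply: lime_ge; first exact: is_cvg_einfs.
    near=> n; apply: le_ereal_inf_tmp => _ [m /= nm <-]; rewrite lee_fin leNgt.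
    apply/negP => h; apply: nex; exists m; last exact: (ltW h).
    by rewrite (leq_trans _ nm)//; near: n; exists N.
  have fin : G t \is a fin_num by apply: ht; rewrite /= in_itv.
  by rewrite -[X in (_ <= X)%E](fineK fin) lee_fin gerDl leNgt e0.
Unshelve. all: by end_near. Qed.

Lemma translation_measurable s : measurable_fun [set: RM] (fun t : RM => t + s : RM).
Proof. by apply: (@measurable_funD _ RM R) => //; exact: measurable_cst. Qed.

Let trm s : {measure set RM -> \bar R} :=
  measure_function_pushforward__canonical__measure_function_Measure mu (translation_measurable s).

Lemma lebesgue_translation s (X : set RM) : measurable X -> trm s X = mu X.
Proof.
move=> mX; rewrite (@lebesgue_measure_unique R (trm s))// => _ [[x y] _ <-] /=.
rewrite /trm/= /pushforward.
rewrite (_ : (fun t : RM => t + s : RM) @^-1` `]x, y] = [set` `]x - s, y - s]]).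
  rewrite !lebesgue_measure_itv/= !lte_fin ltrD2r; case: ifP => // _.
  by rewrite -!EFinB; congr (_%:E); ring.
by apply/seteqP; split => t /=; rewrite !in_itv/= ltrBlDr lerBrDr.
Qed.

Let preitv s a b : (fun t : RM => t + s : RM) @^-1` `[a + s, b + s] = [set` `[a, b]].
Proof. by apply/seteqP; split => t /=; rewrite !in_itv/= !lerD2r. Qed.

Lemma intg_translate s a b g : intg (a + s) (b + s) g -> intg a b (fun t => g (t + s)).
Proof.
move=> [mg /integrableP[_ ig]].
have mgs : measurable_fun [set: RM] (fun t => g (t + s)).
  exact: (measurableT_comp mg (translation_measurable s)).
split => //; apply/integrableP; split.
  by apply/measurable_EFinP; exact: measurable_funTS.
apply: le_lt_trans ig.
have -> : (\int[mu]_(t in `[(a + s)%R, (b + s)%R]) `|(EFin \o g) t| =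
    \int[trm s]_(t in `[(a + s)%R, (b + s)%R]) `|(EFin \o g) t|)%E.
  by apply: eq_measure_integral => X mX _; rewrite lebesgue_translation.
rewrite /trm (ge0_integral_pushforward (translation_measurable s))//; last first.
  by apply: measurableT_comp => //; apply/measurable_EFinP; exact: measurable_funTS.
by rewrite preitv.
Qed.

Lemma I_translate s a b g : intg (a + s) (b + s) g -> I a b (fun t => g (t + s)) = I (a + s) (b + s) g.
Proof.
move=> hg; have [mg ig] := hg; rewrite /I /Rintegral; congr fine.
have -> : (\int[mu]_(t in `[(a + s)%R, (b + s)%R]) (g t)%:E =
    \int[trm s]_(t in `[(a + s)%R, (b + s)%R]) (g t)%:E)%E.
  by apply: eq_measure_integral => X mX _; rewrite lebesgue_translation.
rewrite /trm (integral_pushforward (translation_measurable s))//.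
- by rewrite preitv.
- exact/measurable_EFinP.
- by rewrite preitv; exact: (intg_translate hg).2.
Qed.

Lemma primitive_derive a (h : R -> R) x : continuous h -> a < x ->
  is_derive x 1 (fun y => I a y h) (h x).
Proof.
move=> ch ax.
have [d e] := @continuous_FTC1_closed R h a x (x + 1) (ltr_pwDr ltr01 (lexx x)) (intg_cont a (x + 1) ch).2 ax (ch x).
by apply: DeriveDef; [exact: d|rewrite -derive1E; exact: e].
Qed.

(** The function exp (- L (x - a)) (c + L int_a^x f) takes the value c at a, and by hypothesis its
    derivative is nonpositive. *)
Lemma gronwall a b (f : R -> R) (c L : R) : continuous f -> 0 <= L ->
  (forall t, a <= t <= b -> f t <= c + L * I a t f) ->
  forall t, a <= t <= b -> f t <= c * expR (L * (t - a)).
Proof.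
move=> cf L0 hf t /andP[at_ tb].
(* The primitive starts at a - 1, so that it is differentiable at a as well. *)
pose P y := I (a - 1) y f.
have Pd x : a - 1 < x -> is_derive x 1 P (f x) by exact: primitive_derive.
have PE x : a <= x -> I a x f = P x - P a.
  move=> ax; rewrite /P (@I_split (a - 1) x a)// ?gerBl//; first by rewrite addrAC subrr add0r.
  exact: intg_cont.
pose k x := expR (- (L * (x - a))) * (c + L * (P x - P a)).
have kd x : a - 1 < x -> is_derive x 1 k
    (expR (- (L * (x - a))) * (L * f x) + (c + L * (P x - P a)) * (expR (- (L * (x - a))) * (- L))).
  move=> ax; have Pdx := Pd x ax.
  have d1 : is_derive x (1 : R) (fun x => - (L * (x - a))) (- L).
    by apply: is_derive_eq; rewrite /GRing.scale/=; ring.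
  have d2 : is_derive x (1 : R) (fun x => expR (- (L * (x - a)))) (expR (- (L * (x - a))) * - L).
    exact: (@is_derive1_comp R expR (fun x => - (L * (x - a))) x _ _ (is_derive_expR _) d1).
  have d3 : is_derive x (1 : R) (fun x => c + L * (P x - P a)) (L * f x).
    by apply: is_derive_eq; rewrite /GRing.scale/=; ring.
  have d4 := is_deriveM d2 d3.
  apply: (is_derive_eq d4); rewrite /GRing.scale/=; ring.
have knincr : k t <= k a.
  move: at_; rewrite le_eqVlt => /orP[/eqP ->//|at_].
  have sub1 x : a <= x -> a - 1 < x by move=> ax; rewrite (lt_le_trans _ ax)// gtrBl.
  have dk x : x \in `]a, t[ -> is_derive x 1 k
      (expR (- (L * (x - a))) * (L * f x) + (c + L * (P x - P a)) * (expR (- (L * (x - a))) * (- L))).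
    by rewrite in_itv/= => /andP[/ltW/sub1/kd].
  have [|x] := MVT at_ dk.
    apply: derivable_within_continuous => x; rewrite in_itv/= => /andP[/sub1/kd[]//].
  rewrite in_itv/= => /andP[ax xt] e; rewrite -subr_le0 e pmulr_lle0 ?subr_gt0//.
  have := hf x; rewrite (ltW ax)/= (le_trans (ltW xt) tb) => /(_ isT).
  rewrite (PE x (ltW ax)) => h.
  have h2 := mulr_ge0 (ltW (expR_gt0 (- (L * (x - a))))) (mulr_ge0 L0 (eq_ind_r (fun b : bool => b) h (subr_ge0 _ _))).
  by move: h2; rewrite -subr_ge0; congr (_ <= _); ring.
have ka : k a = c by rewrite /k !subrr !mulr0 oppr0 expR0 mul1r addr0.
have tab : a <= t <= b by rewrite at_.
apply: (le_trans (hf t tab)); rewrite (PE t at_) -[L * (t - a)]opprK expRN ler_pdivlMr ?expR_gt0//.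
by rewrite mulrC; move: knincr; rewrite ka.
Qed.

End Intervals.

(** * Measurability in Banach spaces *)

Section BorelFunctions.
Context (d : measure_display) (X : measurableType d).

Definition bmeas (T : topologicalType) (f : X -> T) :=
  forall U : set T, open U -> measurable (f @^-1` U).

Lemma bmeas_borel (T : topologicalType) (f : X -> T) : bmeas f ->
  forall B, borel B -> measurable (f @^-1` B).
Proof.
move=> bf B; apply: (smallest_sub (X := [set B | measurable (f @^-1` B)])); last exact: bf.
split => /=.
- by rewrite preimage_set0.
- by move=> C /= mC; rewrite setTD preimage_setC; exact: measurableC.
- by move=> F mF /=; rewrite preimage_bigcup; exact: bigcupT_measurable.
Qed.

Lemma borel_open (T : topologicalType) (U : set T) : open U -> borel U.
Proof. by move=> oU; exact: sub_gen_smallest. Qed.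

Lemma bmeas_comp (T S : topologicalType) (f : X -> T) (g : T -> S) :
  bmeas f -> continuous g -> bmeas (g \o f).
Proof. by move=> bf /continuousP cg U oU; rewrite comp_preimage; exact: bf (cg U oU). Qed.

Lemma bmeas_cst (T : topologicalType) (c : T) : bmeas (fun=> c).
Proof.
move=> U _; have [Uc|nUc] := pselect (U c).
  by rewrite (_ : _ @^-1` _ = setT)//; apply/seteqP; split.
by rewrite (_ : _ @^-1` _ = set0)//; apply/seteqP; split.
Qed.

Section real.
Context (R : realType).

Lemma bmeasR (f : X -> R) : bmeas f <-> measurable_fun [set: X] f.
Proof.
split => [bf|mf U oU].
  apply: (measurability _ (RGenOpens.measurableE R)).
  move=> _ [_ [a [b ->] <-]]; rewrite setTI; apply: bf; exact: interval_open.
by rewrite -[X in measurable X]setTI; apply: mf => //; exact: open_measurable.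
Qed.

Lemma bmeas_piecewise (T : topologicalType) (k : X -> nat) (F : nat -> X -> T) :
  (forall n, measurable (k @^-1` [set n])) -> (forall n, bmeas (F n)) ->
  bmeas (fun x => F (k x) x).
Proof.
move=> mk bF U oU.
rewrite (_ : _ @^-1` _ = \bigcup_n (k @^-1` [set n] `&` F n @^-1` U)).
  by apply: bigcupT_measurable => n; apply: measurableI => //; exact: bF.
apply/seteqP; split => [x /= Ux|x [n _ [/= <-]]]; last by [].
by exists (k x).
Qed.

(** g x lies in U iff for some m all late f k x stay outside W m, the open neighbourhood of radius 1
    / (m + 1) of the complement of U. *)
Lemma bmeas_lim (T : normedModType R) (f : nat -> X -> T) (g : X -> T) :
  (forall n, bmeas (f n)) -> (forall x, f n x @[n --> \oo] --> g x) -> bmeas g.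
Proof.
move=> bf fg U oU.
pose W m := [set x : T | exists2 y, ~ U y & `|x - y| < m.+1%:R^-1].
have oW m : open (W m).
  rewrite openE => x [y nUy xy]; rewrite /interior.
  apply/nbhs_ballP; exists (m.+1%:R^-1 - `|x - y|); first by rewrite /= subr_gt0.
  move=> z; rewrite -ball_normE /= => xz; exists y => //.
  rewrite -(subrK x z) -addrA (le_lt_trans (ler_normD _ _))//.
  by rewrite distrC -ltrBrDr.
rewrite (_ : _ @^-1` _ = \bigcup_m \bigcup_n \bigcap_(k in [set k | (n <= k)%N]) (f k @^-1` (~` W m))).
  apply: bigcupT_measurable => m; apply: bigcupT_measurable => n.
  apply: bigcap_measurableType => k _; rewrite preimage_setC; apply: measurableC; exact: (bf k _ (oW m)).
apply/seteqP; split => [x /= Ux|x [m _ [n _ h]]] /=.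
  have /nbhs_ballP[e /= e0 he] := open_nbhs_nbhs (conj oU Ux).
  have e2 : 0 < e / 2 by rewrite divr_gt0.
  have [m hm] : exists m, m.+1%:R^-1 < e / 2.
    by have [m _ hm] := near_infty_natSinv_lt (PosNum e2); exists m; exact: (hm m (leqnn m)).
  have /cvgrPdist_lt/(_ _ e2)[n _ hn] := fg x.
  exists m => //; exists n => // k /= nk [y nUy fy]; apply: nUy; apply: he.
  rewrite -ball_normE /= -(subrK (f k x) (g x)) -addrA (le_lt_trans (ler_normD _ _))//.
  by rewrite (splitr e) ltrD//; [exact: hn|exact: lt_trans hm].
apply: contrapT => nU.
have m0 : (0 : R) < m.+1%:R^-1 by rewrite invr_gt0.
have /cvgrPdist_lt/(_ _ m0)[n' _ hn] := fg x.
have [+ _] : (~` W m) (f (maxn n n') x) /\ True by split => //; apply: h; rewrite /= leq_maxl.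
by apply; exists (g x) => //; rewrite distrC; apply: hn; rewrite /= leq_maxr.
Qed.

(** Measurable selection by the least admissible index: the selected index is n where P n holds and
    P j fails for every j < n. *)
Lemma first_index (P : nat -> X -> Prop) : (forall k, measurable [set x | P k x]) ->
  (forall x, exists k, P k x) -> exists k : X -> nat,
  (forall n, measurable (k @^-1` [set n])) /\ forall x, P (k x) x.
Proof.
move=> mP exP.
have exb x : exists k, `[< P k x >] by have [k Pk] := exP x; exists k; exact/asboolP.
pose k x := ex_minn (exb x).
have kP x : P (k x) x /\ forall j, P j x -> (k x <= j)%N.
  by rewrite /k; case: ex_minnP => m /asboolP Pm hm; split => // j /asboolP; exact: hm.
exists k; split => [n|x]; last by have [] := kP x.
rewrite (_ : _ @^-1` _ = [set x | P n x] `\` \bigcup_(j in [set j | (j < n)%N]) [set x | P j x]).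
  by apply: measurableD => //; apply: bigcup_measurable => j _; exact: mP.
apply/seteqP; split => [x /= <-|x [/= Pn nP]].
  split; first by have [] := kP x.
  by move=> [j /= jk Pj]; have [_ /(_ _ Pj)] := kP x; rewrite leqNgt jk.
have [Pk hk] := kP x; apply/eqP; rewrite eqn_leq (hk _ Pn)/= leqNgt; apply/negP => h.
by apply: nP; exists (k x).
Qed.

Lemma bmeas_approx (V : normedModType R) (s : nat -> V) (f : X -> V) (e : R) :
  dense_seq s -> bmeas f -> 0 < e -> exists k : X -> nat,
  (forall n, measurable (k @^-1` [set n])) /\ forall x, `|f x - s (k x)| < e.
Proof.
move=> ds bf e0; apply: (@first_index (fun n x => `|f x - s n| < e)) => [n|x]; last exact: ds.
rewrite (_ : [set _ | _] = f @^-1` ball (s n) e); first by apply: bf; exact: ball_open.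
by apply/seteqP; split => x; rewrite -ball_normE /= distrC.
Qed.

(** In general open sets of a product are not in the sigma-algebra generated by rectangles. The
    dense sequences make each of them a countable union of products of balls around members of the
    sequences. *)
Lemma bmeas_pair (V W : normedModType R) (sV : nat -> V) (sW : nat -> W) (T : topologicalType)
    (f : X -> V) (g : X -> W) (phi : V * W -> T) :
  dense_seq sV -> dense_seq sW -> bmeas f -> bmeas g -> continuous phi ->
  bmeas (fun x => phi (f x, g x)).
Proof.
move=> dV dW bf bg /continuousP cphi U oU.
have oO := cphi U oU; set O := phi @^-1` U in oO.
pose Q (k l m : nat) := ball (sV k) (m.+1%:R^-1 : R) `*` ball (sW l) (m.+1%:R^-1 : R) `<=` O.
rewrite (_ : _ @^-1` _ = \bigcup_k \bigcup_l \bigcup_(m in [set m | Q k l m])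
    (f @^-1` ball (sV k) (m.+1%:R^-1 : R) `&` g @^-1` ball (sW l) (m.+1%:R^-1 : R))).
  apply: bigcupT_measurable => k; apply: bigcupT_measurable => l.
  apply: bigcup_measurable => m _; apply: measurableI; [apply: bf|apply: bg]; exact: ball_open.
apply/seteqP; split => [x Ox|x [k _ [l _ [m Qm [h1 h2]]]]]; last exact: (Qm (f x, g x)).
have : nbhs (f x, g x) O by apply: open_nbhs_nbhs.
move=> [[B1 B2] /= [/nbhs_ballP[e1 /= e10 he1] /nbhs_ballP[e2 /= e20 he2]] hB].
have e0 : 0 < Num.min e1 e2 / 2 by rewrite divr_gt0// lt_min e10.
have [m hm] : exists m, m.+1%:R^-1 < Num.min e1 e2 / 2.
  by have [m _ hm] := near_infty_natSinv_lt (PosNum e0); exists m; exact: (hm m (leqnn m)).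
have m0 : (0 : R) < m.+1%:R^-1 by rewrite invr_gt0.
have [k hk] := dV (f x) _ m0; have [l hl] := dW (g x) _ m0.
exists k => //; exists l => //; exists m; last first.
  by split; rewrite /= -ball_normE /= distrC.
have tri (E : normedModType R) (a b c : E) : `|a - b| < m.+1%:R^-1 -> `|b - c| < m.+1%:R^-1 ->
    `|a - c| < Num.min e1 e2.
  move=> ab bc; rewrite -(subrK b a) -addrA (le_lt_trans (ler_normD _ _))// (splitr (Num.min _ _)) ltrD//.
  - exact: lt_trans ab hm.
  - exact: lt_trans bc hm.
move=> [a b] [] /=; rewrite -!ball_normE /= => ha hb; apply: hB; split => /=.
- apply: he1; rewrite -ball_normE /=; have := tri _ _ _ _ hk ha.
  by rewrite lt_min => /andP[].
- apply: he2; rewrite -ball_normE /=; have := tri _ _ _ _ hl hb.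
  by rewrite lt_min => /andP[].
Qed.

Lemma bmeasD (V : normedModType R) (s : nat -> V) (f g : X -> V) : dense_seq s ->
  bmeas f -> bmeas g -> bmeas (fun x => f x + g x).
Proof.
move=> ds bf bg; apply: (bmeas_pair (phi := fun z => z.1 + z.2) ds ds bf bg).
by move=> z; exact: add_continuous.
Qed.

Lemma bmeasN (V : normedModType R) (f : X -> V) : bmeas f -> bmeas (fun x => - f x).
Proof. by move=> bf; apply: (bmeas_comp bf) => x; exact: opp_continuous. Qed.

Lemma bmeasB (V : normedModType R) (s : nat -> V) (f g : X -> V) : dense_seq s ->
  bmeas f -> bmeas g -> bmeas (fun x => f x - g x).
Proof. by move=> ds bf bg; apply: (bmeasD ds) => //; exact: bmeasN. Qed.

Lemma bmeas_normr (V : normedModType R) (f : X -> V) : bmeas f -> measurable_fun [set: X] (fun x => `|f x|).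
Proof.
move=> bf; apply/bmeasR; apply: (bmeas_comp (g := fun v : V => `|v|) bf).
by move=> x; exact: norm_continuous.
Qed.

(** F is measurable at each fixed vector and continuous in the vector. Y is therefore replaced by
    functions with countably many values in the dense sequence, for which measurability is
    piecewise, and the limit is taken. *)
Lemma measurable_dual (V : normedModType R) (s : nat -> V) (F : X -> V -> R) (Y : X -> V) :
  dense_seq s -> (forall x, is_dual (F x)) -> (forall w, measurable_fun [set: X] (F ^~ w)) ->
  bmeas Y -> measurable_fun [set: X] (fun x => F x (Y x)).
Proof.
move=> ds dF mF bY; apply/bmeasR.
have p n : (0 : R) < n.+1%:R^-1 by rewrite invr_gt0.
have h n := bmeas_approx ds bY (p n).
have [k hk] := choice h.
apply: (@bmeas_lim R (fun n x => F x (s (k n x)))) => [n|x].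
  by apply: (bmeas_piecewise (F := fun j x => F x (s j))) => [j|j]; [exact: (hk n).1|exact/bmeasR].
have : s (k n x) @[n --> \oo] --> Y x.
  apply/cvgrPdist_lt => e e0; near=> n; rewrite (lt_trans ((hk n).2 x))//.
  by near: n; have := near_infty_natSinv_lt (PosNum e0).
by move=> c; apply: (cvg_comp _ _ c); exact: (dF x).2.
Unshelve. all: by end_near. Qed.

End real.
End BorelFunctions.

Section GelfandMeasurable.
Context (d : measure_display) (X : measurableType d).
Variables (R : realType) (V H : completeNormedModType R) (ip : H -> H -> R) (i : V -> H).
Hypothesis hG : gelfand_triple ip i.

Lemma closed_i_cball (c : V) (r : R) : closed (i @` [set v | `|v - c| <= r]).
Proof.
have -> : i @` [set v | `|v - c| <= r] =
    (fun h => h - i c) @^-1` [set h | exists2 v, i v = h & `|v| <= r].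
  apply/seteqP; split => [_ [v vr <-]|h [v vE vr]] /=.
    by exists (v - c) => //; rewrite (iB hG).
  by exists (v + c); rewrite /= ?addrK// (iD hG) vE subrK.
apply: closed_comp; last exact: closed_i_ball hG r.
by move=> h _; apply: cvgB; [exact: cvg_id|exact: cvg_cst].
Qed.

Lemma bmeas_closed (T : topologicalType) (f : X -> T) (F : set T) : bmeas f -> closed F ->
  measurable (f @^-1` F).
Proof.
move=> bf cF; rewrite -(setCK F) preimage_setC; apply: measurableC.
exact: bf (closed_openC cF).
Qed.

Lemma bmeas_i_open (Z : X -> H) (U : set V) : bmeas Z -> open U -> measurable (Z @^-1` (i @` U)).
Proof.
move=> bZ oU; have [s ds] := V_dense_seq hG.
have -> : Z @^-1` (i @` U) = \bigcup_k \bigcup_(m in [set m | [set v | `|v - s k| <= m.+1%:R^-1] `<=` U])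
    Z @^-1` (i @` [set v | `|v - s k| <= m.+1%:R^-1]).
  apply/seteqP; split => [x [v Uv vE]|x [k _ [m km [v hv vE]]]]; last by exists v => //; exact: km.
  have /nbhs_ballP[e /= e0 he] := open_nbhs_nbhs (conj oU Uv).
  have e2 : 0 < e / 2 by rewrite divr_gt0.
  have [m hm] : exists m, m.+1%:R^-1 < e / 2.
    by have [m _ hm] := near_infty_natSinv_lt (PosNum e2); exists m; exact: (hm m (leqnn m)).
  have m0 : (0 : R) < m.+1%:R^-1 by rewrite invr_gt0.
  have [k hk] := ds v _ m0.
  exists k => //; exists m; last by exists v => //=; exact: ltW.
  move=> w /= wk; apply: he; rewrite -ball_normE /= -(subrK (s k) v) -addrA.
  rewrite (le_lt_trans (ler_normD _ _))// (splitr e) ltrD//; first exact: lt_trans hm.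
  by rewrite distrC (le_lt_trans wk).
apply: bigcupT_measurable => k; apply: bigcup_measurable => m _.
by apply: bmeas_closed bZ _; exact: closed_i_cball.
Qed.

Lemma bmeas_range_i (Z : X -> H) : bmeas Z -> measurable (Z @^-1` range i).
Proof. by move=> bZ; apply: bmeas_i_open => //; exact: openT. Qed.

Lemma iinv_out h : ~ range i h -> iinv i h = 0.
Proof. by move=> nh; rewrite /iinv; case: xgetP => // v _ /= vE; exfalso; apply: nh; exists v. Qed.

Lemma bmeas_iinv (Z : X -> H) : bmeas Z -> bmeas (fun x => iinv i (Z x)).
Proof.
move=> bZ U oU; have mU := bmeas_i_open bZ oU; have mr := bmeas_range_i bZ.
have e : (fun x => iinv i (Z x)) @^-1` U =
    Z @^-1` (i @` U) `|` (~` (Z @^-1` range i) `&` [set x | U 0]).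
  apply/seteqP; split => [x /= Ux|x [[v Uv vE]|[/= nr U0]]] /=.
  - have [r|nr] := pselect (range i (Z x)); last by right; split => //; rewrite -(iinv_out nr).
    by left; exists (iinv i (Z x)) => //; rewrite (i_iinv hG).
  - by rewrite -vE (iinvK hG).
  - by rewrite iinv_out.
rewrite e; apply: measurableU => //; apply: measurableI; first exact: measurableC.
have [U0|nU0] := pselect (U 0).
  by rewrite (_ : [set _ | _] = setT)//; apply/seteqP; split.
by rewrite (_ : [set _ | _] = set0)//; apply/seteqP; split.
Qed.

Lemma bmeas_i (u : X -> V) : bmeas u -> bmeas (fun x => i (u x)).
Proof. by move=> bu; exact: (bmeas_comp bu (i_cont hG)). Qed.

Lemma measurable_ip (s : nat -> H) (f g : X -> H) : dense_seq s -> bmeas f -> bmeas g ->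
  measurable_fun [set: X] (fun x => ip (f x) (g x)).
Proof.
move=> ds bf bg; apply/bmeasR.
apply: (bmeas_pair (phi := fun z => ip z.1 z.2) ds ds bf bg) => z.
by apply: (cvg_ip hG); [exact: cvg_fst|exact: cvg_snd].
Qed.

End GelfandMeasurable.

Section OperatorMeasurable.
Context (d : measure_display) (X : measurableType d).
Variables (R : realType) (V H : completeNormedModType R) (ip : H -> H -> R) (i : V -> H).
Variables (A : V -> V -> R) (alpha delta K C : R).
Hypothesis mo : monotone_op ip i A alpha delta K C.

(** Evaluation at w is continuous for the operator norm, so the functionals f with f w in U form an
    open subset of the dual, to which Borel measurability of A applies. *)
Lemma measurable_op (u : X -> V) w : bmeas u -> measurable_fun [set: X] (fun x => A (u x) w).
Proof.
move=> bu; apply/bmeasR => U oU.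
pose B : set (V -> R) := [set f | is_dual f /\ U (f w)].
have bB : borel_dual B.
  apply: sub_gen_smallest; split => [f []//|f [df Uf]].
  have /nbhs_ballP[e /= e0 he] := open_nbhs_nbhs (conj oU Uf).
  have w1 : 0 < `|w| + 1 by rewrite ltr_wpDl.
  exists (e / (`|w| + 1)); first by rewrite divr_gt0.
  move=> g dg hg; split => //; apply: he; rewrite -ball_normE /= distrC.
  have dgf : is_dual (fun w => g w - f w).
    have := is_dual_lin (-1) df dg.
    by congr is_dual; apply/funext => v; rewrite mulN1r addrC.
  rewrite (le_lt_trans (le_opnorm dgf w))//.
  rewrite (@le_lt_trans _ _ (opnorm (fun w => g w - f w) * (`|w| + 1)))//.
    by rewrite ler_wpM2l ?opnorm_ge0// lerDl.
  by rewrite -ltr_pdivlMr.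
have := bmeas_borel bu (mo_meas mo bB).
congr measurable; apply/seteqP; split => x /=; first by case.
by split => //; exact: mo_dual mo _.
Qed.

End OperatorMeasurable.

(** * Step functions *)

Section BoolStep.
Variable R : realType.
Notation mu := (@lebesgue_measure R).
Notation RM := (measurableTypeR R).

(** Breakpoints are rational so that these functions can be merged into [stepT], which has a
    countable index type. *)
Inductive bstep : (R -> bool) -> Prop :=
| bstep_cst b : bstep (fun=> b)
| bstep_glue (c : rat) f g : bstep f -> bstep g -> bstep (fun t => if t < ratr c then f t else g t).

Lemma bstep_neg f : bstep f -> bstep (fun t => ~~ f t).
Proof.
elim=> [b|c {}f g _ hf _ hg]; first exact: bstep_cst.
by have := bstep_glue c hf hg; congr bstep; apply/funext => t; case: ifP.
Qed.

Lemma bstep_or f g : bstep f -> bstep g -> bstep (fun t => f t || g t).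
Proof.
elim=> [[]|c f1 f2 _ h1 _ h2] hg.
- exact: bstep_cst.
- exact: hg.
- have := bstep_glue c (h1 hg) (h2 hg); congr bstep; apply/funext => t; by case: ifP.
Qed.

Lemma measurable_lt_set (c : R) : @measurable _ RM [set t | t < c].
Proof. by have := @measurable_itv R `]-oo, c[; congr measurable; apply/seteqP; split => t; rewrite /= in_itv. Qed.

Lemma measurable_ltset (f g : RM -> R) : measurable_fun [set: RM] f -> measurable_fun [set: RM] g ->
  measurable [set t : RM | f t < g t].
Proof.
move=> mf mg; have /(_ measurableT `]0, +oo[%classic) := measurable_funB mg mf.
rewrite setTI => /(_ (measurable_itv _)); congr measurable.
by apply/seteqP; split => t /=; rewrite in_itv/= andbT subr_gt0.
Qed.

Lemma measurable_glue (d : measure_display) (T : measurableType d) (c : R) (f g : RM -> T) :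
  measurable_fun [set: RM] f -> measurable_fun [set: RM] g ->
  measurable_fun [set: RM] (fun t => if t < c then f t else g t).
Proof.
move=> mf mg; apply: measurable_fun_ifT => //.
apply: (measurable_fun_bool true); rewrite setTI.
by have := measurable_lt_set c; congr measurable.
Qed.

Lemma bstep_measurable f : bstep f -> measurable_fun [set: RM] f.
Proof. by elim=> [b|c {}f g _ hf _ hg]; [exact: measurable_cst|exact: measurable_glue]. Qed.

(** The indicator of the symmetric difference of E and the set coded by J; its integral measures the
    error of approximating E by J. *)
Definition sd (E : set R) (J : R -> bool) (t : R) : R := (`[< E t >] != J t)%:R.

Lemma sd_ge0 E J t : 0 <= sd E J t. Proof. by rewrite /sd ler0n. Qed.
Lemma sd_le1 E J t : sd E J t <= 1. Proof. by rewrite /sd lern1 leq_b1. Qed.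

Lemma measurable_asbool (E : set R) : @measurable _ RM E -> measurable_fun [set: RM] (fun t => `[< E t >]).
Proof.
move=> mE; apply: (measurable_fun_bool true); rewrite setTI.
by move: mE; congr measurable; apply/seteqP; split => t /=; [move=> Et; exact/asboolP|move=> /asboolP].
Qed.

Lemma measurable_b2R (f : RM -> bool) : measurable_fun [set: RM] f -> measurable_fun [set: RM] (fun t => (f t)%:R : R).
Proof.
move=> mf; have -> : (fun t => (f t)%:R : R) = (fun t => if f t then 1 else 0).
  by apply/funext => t; case: (f t).
by apply: measurable_fun_ifT => //; exact: measurable_cst.
Qed.

Lemma intg_bounded01 a b (f : R -> R) : measurable_fun [set: RM] f -> (forall t, 0 <= f t <= 1) -> intg a b f.
Proof.
move=> mf f01; apply: (intg_le mf _ (intg_cst a b 1)) => t _.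
by have /andP[h1 h2] := f01 t; rewrite ger0_norm.
Qed.

Lemma intg_sd a b (E : set R) J : @measurable _ RM E -> bstep J -> intg a b (sd E J).
Proof.
move=> mE bJ; apply: intg_bounded01 => [|t]; last by rewrite sd_ge0 sd_le1.
apply: (@measurable_b2R (fun t => `[< E t >] != J t)).
have -> : (fun t => `[< E t >] != J t) = (fun t => if `[< E t >] then ~~ J t else J t).
  by apply/funext => t; case: asboolP => _; case: (J t).
apply: measurable_fun_ifT; [exact: measurable_asbool|apply: bstep_measurable; exact: bstep_neg|exact: bstep_measurable].
Qed.

Definition approxset a b (E : set R) := @measurable _ RM E /\
  forall e : R, 0 < e -> exists J, bstep J /\ I a b (sd E J) < e.

(** The approximable sets form a sigma-algebra: negation of J treats complements, disjunction treats
    finite unions, and dominated convergence exhausts a countable union by finite ones. The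
    generating half-lines [x, +oo[ are approximated by moving x to a rational slightly above it. *)
Lemma approxset_all a b (E : set RM) : a <= b -> measurable E -> approxset a b E.
Proof.
move=> ab mE.
have alg : sigma_algebra setT (approxset a b).
  split.
  - split => // e e0; exists (fun=> false); split; first exact: bstep_cst.
    rewrite (_ : sd _ _ = fun=> 0) ?I_cst ?mul0r//.
    by apply/funext => t; rewrite /sd; case: asboolP.
  - move=> F [mF hF]; split; first by rewrite setTD; exact: measurableC.
    move=> e /hF[J [bJ hJ]]; exists (fun t => ~~ J t); split; first exact: bstep_neg.
    rewrite (_ : sd _ _ = sd F J)//; apply/funext => t; rewrite /sd setTD.
    congr (nat_of_bool _)%:R; case: asboolP; case: asboolP; case: (J t) => //; tauto.
  - move=> F hF; have mF k : @measurable _ RM (F k) by case: (hF k).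
    split; first exact: bigcupT_measurable.
    pose G n := \bigcup_(k in [set k | (k < n)%N]) F k.
    have mG n : @measurable _ RM (G n) by apply: bigcup_measurable.
    have hG n e : 0 < e -> exists J, bstep J /\ I a b (sd (G n) J) < e.
      elim: n e => [|n IH] e e0.
        exists (fun=> false); split; first exact: bstep_cst.
        rewrite (_ : sd _ _ = fun=> 0) ?I_cst ?mul0r//.
        by apply/funext => t; rewrite /sd; case: asboolP => // -[].
      have e2 : 0 < e / 2 by rewrite divr_gt0.
      have [J1 [b1 h1]] := IH _ e2; have [_ /(_ _ e2)[J2 [b2 h2]]] := hF n.
      exists (fun t => J1 t || J2 t); split; first exact: bstep_or.
      have i1 := intg_sd a b (mG n) b1; have i2 := intg_sd a b (mF n) b2.
      rewrite (@le_lt_trans _ _ (I a b (fun t => sd (G n) J1 t + sd (F n) J2 t)))//; last first.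
        by rewrite ID// (splitr e) ltrD.
      apply: I_le; [exact: intg_sd (bstep_or b1 b2)|exact: intgD|apply: aeabW => t _].
      have -> : G n.+1 = G n `|` F n.
        apply/seteqP; split => [x [k /= + Fk]|x [[k /= kn Fk]|Fn]].
        - by rewrite ltnS leq_eqVlt => /orP[/eqP <-|kn]; [right|left; exists k].
        - by exists k => //=; exact: ltnW.
        - by exists n => /=.
      rewrite /sd -natrD ler_nat.
      have -> : `[< (G n `|` F n) t >] = `[< G n t >] || `[< F n t >].
        by apply/asboolP/orP => -[h|h]; [left|right|left|right]; apply/asboolP.
      by case: `[< G n t >]; case: `[< F n t >]; case: (J1 t); case: (J2 t).
    move=> e e0; have e2 : 0 < e / 2 by rewrite divr_gt0.
    pose f n t := (`[< (\bigcup_k F k) t >] != `[< G n t >])%:R : R.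
    have mf n : measurable_fun [set: RM] (f n).
      apply: (@measurable_b2R (fun t => `[< (\bigcup_k F k) t >] != `[< G n t >])).
      have -> : (fun t => `[< (\bigcup_k F k) t >] != `[< G n t >]) =
          (fun t => if `[< (\bigcup_k F k) t >] then `[< (~` G n) t >] else `[< G n t >]).
        apply/funext => t; case: (pselect (G n t)) => g; case: asboolP => // _.
        - by rewrite asboolT// asboolF//; apply.
        - by rewrite asboolT.
        - by rewrite asboolF// asboolT.
        - by rewrite asboolF.
      apply: measurable_fun_ifT; apply: measurable_asbool => //; last exact: measurableC.
      exact: bigcupT_measurable.
    have [_ c] : intg a b (fun=> 0) /\ I a b (f n) @[n --> \oo] --> I a b (fun=> 0).
      apply: (@I_dct _ a b f _ (fun=> 1) mf (measurable_cst _) (intg_cst a b 1)).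
      - apply: aeabW => t _; have [[k _ Fk]|nF] := pselect ((\bigcup_k F k) t).
          apply: cvg_near_cst; exists k.+1 => // n /= kn; rewrite /f asboolT; last by exists k.
          by rewrite asboolT ?eqxx//; exists k.
        apply: cvg_near_cst; apply: nearW => n; rewrite /f asboolF// asboolF// => -[k /= _ Fk].
        by apply: nF; exists k.
      - by apply: aeabW => t _ n; rewrite /f ger0_norm ?ler0n// lern1 leq_b1.
    rewrite I_cst// mul0r in c.
    have /cvgr0_norm_lt/(_ _ e2)[n _ /(_ n (leqnn n)) hn] := c.
    have [J [bJ hJ]] := hG n _ e2.
    exists J; split => //.
    have i1 : intg a b (f n).
      by apply: intg_bounded01 => // t; rewrite /f ler0n lern1 leq_b1.
    have i2 := intg_sd a b (mG n) bJ.
    rewrite (@le_lt_trans _ _ (I a b (fun t => f n t + sd (G n) J t)))//; last first.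
      by rewrite ID// (splitr e) ltrD// (le_lt_trans (ler_norm _)).
    apply: I_le; [apply: intg_sd => //; exact: bigcupT_measurable|exact: intgD|apply: aeabW => t _].
    rewrite /sd /f -natrD ler_nat.
    by case: `[< (\bigcup_k F k) t >]; case: `[< G n t >]; case: (J t).
suff sub : <<s (@RGenCInfty.G R) >> `<=` approxset a b.
  apply: sub.
  by have E1 : @measurable _ RM = <<s (@RGenCInfty.G R) >> := RGenCInfty.measurableE R; rewrite -E1.
apply: smallest_sub => // _ [x ->]; split; first exact: measurable_itv.
move=> e e0.
have [q] : exists q : rat, x < ratr q < x + e.
  by have [q /itvP hq] := rat_in_itvoo (ltr_pwDr e0 (lexx x)); exists q; rewrite !hq.
move=> /andP[xq qe].
pose J := fun t : R => if t < ratr q then false else true.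
have bJ : bstep J by apply: bstep_glue; exact: bstep_cst.
exists J; split => //.
have -> : sd `[x, +oo[ J = \1_(`[x, ratr q[%classic : set RM).
  apply/funext => t; rewrite /sd indicE; congr (nat_of_bool _)%:R.
  have -> : (t \in (`[x, ratr q[%classic : set RM)) = (x <= t < ratr q).
    by apply/idP/idP; rewrite inE/= in_itv.
  have -> : `[< `[x, +oo[%classic t >] = (x <= t).
    by apply/asboolP/idP; rewrite /= in_itv/= andbT.
  rewrite /J; case: (ltP t (ratr q)) => tq; first by rewrite andbT; case: (x <= t).
  by rewrite andbF (ltW (lt_le_trans xq tq)).
rewrite /I /Rintegral integral_indic//= -lte_fin.
have le1 : (mu (`[x, ratr q[%classic `&` `[a, b]) <= (ratr q - x)%:E)%E.
  rewrite (@le_trans _ _ (mu `[x, ratr q[%classic))//.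
    by apply: le_measure => //; rewrite ?inE//; exact: measurableI.
  by rewrite lebesgue_measure_itv/= lte_fin xq.
have fin : mu (`[x, ratr q[%classic `&` `[a, b]) \is a fin_num.
  by rewrite ge0_fin_numE// (le_lt_trans le1)// ltry.
by rewrite fineK// (le_lt_trans le1)// lte_fin ltrBlDl.
Qed.

End BoolStep.

Section Steps.
Variables (R : realType) (V : normedModType R).

(** Breakpoints and values are arbitrary here, which suits inductions over the pieces; countability
    is provided separately by [stepT]. *)
Inductive isstep : (R -> V) -> Prop :=
| isstep_cst v : isstep (fun=> v)
| isstep_glue (c : R) f g : isstep f -> isstep g -> isstep (fun t => if t < c then f t else g t).

(* Step functions with values in the sequence s and rational breakpoints, indexed
   by a countable type. *)
Fixpoint stepT (s : nat -> V) (T : GenTree.tree nat) : R -> V :=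
  match T with
  | GenTree.Leaf n => fun=> s n
  | GenTree.Node k [:: T1; T2] => fun t =>
      if t < ratr (odflt 0%Q (unpickle k : option rat)) then stepT s T1 t else stepT s T2 t
  | _ => fun=> s 0%N
  end.

Lemma stepT_isstep s : forall T, isstep (stepT s T).
Proof.
fix IH 1 => -[n|k [|T1 [|T2 [|T3 l]]]] /=; try exact: isstep_cst.
by apply: isstep_glue; apply: IH.
Qed.

Lemma stepT_if s J k T : bstep J -> exists T', stepT s T' = fun t => if J t then s k else stepT s T t.
Proof.
elim=> [[]|c f g _ [T1 h1] _ [T2 h2]].
- by exists (GenTree.Leaf k).
- by exists T.
exists (GenTree.Node (pickle c) [:: T1; T2]) => /=.
by rewrite pickleK /= h1 h2; apply/funext => t; case: ifP.
Qed.

Lemma isstep_bounded f (h : V -> R) : isstep f -> exists M, forall t, h (f t) <= M.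
Proof.
elim=> [v|c {}f g _ [M1 h1] _ [M2 h2]]; first by exists (h v).
by exists (Num.max M1 M2) => t; rewrite le_max; case: ifP => _; rewrite ?h1 ?h2 ?orbT.
Qed.

Lemma isstep_bmeas f : isstep f -> bmeas (f : measurableTypeR R -> V).
Proof.
elim=> [v|c {}f g _ hf _ hg]; first exact: bmeas_cst.
move=> U oU; have m1 := hf U oU; have m2 := hg U oU; have mc := measurable_lt_set c.
rewrite (_ : _ @^-1` U = ([set t | t < c] `&` f @^-1` U) `|` (~` [set t | t < c] `&` g @^-1` U)).
  by apply: measurableU; apply: measurableI => //; exact: measurableC.
apply/seteqP; split => t /=; first by case: ifP => h fU; [left|right; split => //; rewrite h].
by move=> [[-> //]|[/negP/negbTE -> //]].
Qed.

End Steps.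

(* The cost c will be |v|^al or |v|^al + |i v|^2. *)
Section Density.
Variables (R : realType) (V : normedModType R) (s : nat -> V) (c : V -> R) (kap : R).
Notation RM := (measurableTypeR R).
Hypothesis ds : dense_seq s.
Hypothesis s0 : s 0%N = 0.
Hypothesis c0 : forall v, 0 <= c v.
Hypothesis c00 : c 0 = 0.
Hypothesis cD : forall v w, c (v + w) <= kap * (c v + c w).
Hypothesis cs : forall e : R, 0 < e -> exists2 eta : R, 0 < eta & forall v, `|v| < eta -> c v < e.
Hypothesis cm : forall f : RM -> V, bmeas f -> measurable_fun [set: RM] (fun t => c (f t)).

Let kap0 : 0 <= kap \/ forall v, c v = 0.
Proof.
have [k|k] := leP 0 kap; first by left.
right => v; apply/eqP; rewrite eq_le c0 andbT.
by have := cD v 0; rewrite addr0 c00 addr0; have := c0 v; nra.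
Qed.

Definition stepapprox a b (f : R -> V) := forall e, 0 < e -> exists T,
  intg a b (fun t => c (f t - stepT s T t)) /\ I a b (fun t => c (f t - stepT s T t)) < e.

(** E is replaced by a finite union of intervals coded by J. Where E and J agree, the error is the
    one for f or 0; where they differ, the cost is at most a constant M, and the measure of that set
    is small. *)
Lemma stepapprox_if a b (E : set RM) k (f : R -> V) : a <= b -> measurable E ->
  bmeas (f : RM -> V) -> (forall h : V -> R, exists M, forall t, h (f t) <= M) ->
  stepapprox a b f -> stepapprox a b (fun t => if `[< E t >] then s k else f t).
Proof.
move=> ab mE bf fb hf e e0; have e2 : 0 < e / 2 by rewrite divr_gt0.
have [T [iT hT]] := hf _ e2.
have [M1 hM1] := fb (fun v => c (v - s k)).
have [M2 hM2] := isstep_bounded (fun v => c (s k - v)) (stepT_isstep s T).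
pose M := Num.max 0 (Num.max M1 M2) + 1.
have M0 : 0 < M by rewrite ltr_wpDl// le_max lexx.
have M1M : M1 <= M by rewrite ler_wpDr// !le_max lexx orbT.
have M2M : M2 <= M by rewrite ler_wpDr// !le_max lexx !orbT.
have [_ /(_ (e / 2 / M))[|J [bJ hJ]]] := approxset_all ab mE; first by rewrite divr_gt0.
have [T' hT'] := stepT_if s k T bJ; exists T'; rewrite hT'.
have iJ := intg_sd a b mE bJ.
pose g t := c (f t - stepT s T t) + M * sd E J t.
have ig : intg a b g by apply: intgD => //; exact: intgZ.
have bT := isstep_bmeas (stepT_isstep s T).
set F := fun t => c _.
have Fg t : F t <= g t.
  rewrite /F /g /sd; case: asboolP => Et; case: (J t) => /=.
  - by rewrite subrr c00 mulr0 addr0.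
  - by rewrite mulr1 ler_wpDl// (le_trans (hM2 t)).
  - by rewrite mulr1 ler_wpDl// (le_trans (hM1 t)).
  - by rewrite mulr0 addr0.
have mF : measurable_fun [set: RM] F.
  have bE : bmeas (fun t : RM => if `[< E t >] then s k else f t).
    move=> U oU; rewrite (_ : _ @^-1` U = (E `&` [set t | U (s k)]) `|` (~` E `&` f @^-1` U)).
      apply: measurableU; apply: measurableI => //; first exact: (@bmeas_cst _ RM V (s k) U oU).
        exact: measurableC.
      exact: bf.
    apply/seteqP; split => t /=; case: asboolP => Et.
    - by left.
    - by right.
    - by move=> [[]//|[]].
    - by move=> [[]//|[]].
  have b' := isstep_bmeas (stepT_isstep s T'); rewrite hT' in b'.
  by apply: cm; exact: (bmeasB ds bE b').
have iF : intg a b F by apply: intg_le ig => // t _; rewrite ger0_norm ?Fg// /F c0.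
split => //; rewrite (le_lt_trans (I_le iF ig (aeabW (fun t _ => Fg t))))//.
rewrite /g ID//; last exact: intgZ.
by rewrite IZ// (splitr e) ltrD// mulrC -ltr_pdivlMr.
Qed.

(* The index k <= n for which s k is closest to f t. *)
Fixpoint best (f : RM -> V) (n : nat) (t : RM) : nat :=
  if n is m.+1 then (if `[< c (f t - s m.+1) < c (f t - s (best f m t)) >] then m.+1 else best f m t)
  else 0%N.

Lemma best_meas f n : bmeas f -> forall k, measurable (best f n @^-1` [set k]).
Proof.
move=> bf; elim: n => [|n IH] k /=.
  by have := @measurable_cst _ _ RM nat setT 0%N measurableT [set k]; rewrite setTI; apply.
have m1 : measurable_fun [set: RM] (fun t => c (f t - s n.+1)).
  by apply: cm; apply: (bmeasB ds bf); exact: bmeas_cst.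
have m2 : measurable_fun [set: RM] (fun t => c (f t - s (best f n t))).
  apply: cm; apply: (bmeasB ds bf).
  by apply: (bmeas_piecewise (F := fun k _ => s k)) => // j; exact: bmeas_cst.
have mS : measurable [set t : RM | c (f t - s n.+1) < c (f t - s (best f n t))].
  exact: measurable_ltset.
rewrite (_ : _ @^-1` _ = ([set t : RM | c (f t - s n.+1) < c (f t - s (best f n t))] `&` [set t | n.+1 = k])
  `|` (~` [set t : RM | c (f t - s n.+1) < c (f t - s (best f n t))] `&` best f n @^-1` [set k])).
  apply: measurableU; apply: measurableI => //; last exact: measurableC.
  have [->|nk] := eqVneq n.+1 k; first by rewrite (_ : [set _ | _] = setT)//; apply/seteqP; split.
  by rewrite (_ : [set _ | _] = set0)//; apply/seteqP; split => // t /= /eqP; rewrite (negbTE nk).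
apply/seteqP; split => t /=; case: asboolP => h.
- by left.
- by right.
- by move=> [[]//|[]].
- by move=> [[]//|[]].
Qed.

Lemma stepapprox_best a b f n : a <= b -> bmeas f -> stepapprox a b (fun t => s (best f n t)).
Proof.
move=> ab bf; elim: n => [|n IH].
  move=> e e0; exists (GenTree.Leaf 0%N) => /=; rewrite subrr c00.
  by split; [exact: intg_cst|rewrite I_cst// mul0r].
have m1 : measurable_fun [set: RM] (fun t => c (f t - s n.+1)).
  by apply: cm; apply: (bmeasB ds bf); exact: bmeas_cst.
have bb : bmeas (fun t => s (best f n t)).
  by apply: (bmeas_piecewise (F := fun k _ => s k)) => [k|j]; [exact: best_meas|exact: bmeas_cst].
have m2 : measurable_fun [set: RM] (fun t => c (f t - s (best f n t))).
  by apply: cm; exact: (bmeasB ds bf).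
have mS : measurable [set t : RM | c (f t - s n.+1) < c (f t - s (best f n t))].
  exact: measurable_ltset.
have := stepapprox_if n.+1 ab mS bb _ IH.
have fb (h : V -> R) : exists M, forall t, h (s (best f n t)) <= M.
  elim: {IH bb m2 mS m1} n => [|n [M hM]]; first by exists (h (s 0%N)).
  by exists (Num.max M (h (s n.+1))) => t /=; rewrite le_max; case: asboolP => _; rewrite ?hM ?lexx ?orbT.
move=> /(_ fb); congr stepapprox; apply/funext => t /=.
by case: asboolP.
Qed.

(** The best choice among s 0, ..., s n converges to f in cost at every time, and c (f t) dominates
    because s 0 = 0 is always a candidate. The relaxed triangle inequality with factor kap adds the
    error of replacing this choice by a [stepT]. *)
Lemma step_dense a b (f : RM -> V) : a <= b -> bmeas f -> intg a b (fun t => c (f t)) ->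
  stepapprox a b f.
Proof.
move=> ab bf cf e e0.
have [k0|c_0] := kap0; last first.
  exists (GenTree.Leaf 0%N); under eq_fun do rewrite c_0.
  by split; [exact: intg_cst|rewrite I_cst// mul0r].
have bb n : bmeas (fun t => s (best f n t)).
  by apply: (bmeas_piecewise (F := fun k _ => s k)) => [k|j]; [exact: best_meas|exact: bmeas_cst].
have m2 n : measurable_fun [set: RM] (fun t => c (f t - s (best f n t))).
  by apply: cm; exact: (bmeasB ds bf).
have best_le n k t : (k <= n)%N -> c (f t - s (best f n t)) <= c (f t - s k).
  elim: n => [|n IH] /=; first by rewrite leqn0 => /eqP ->.
  rewrite leq_eqVlt => /orP[/eqP ->|kn]; first by case: asboolP => // /negP; rewrite -leNgt.
  by case: asboolP => [h|_]; [rewrite (le_trans (ltW h))// IH|exact: IH].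
have [_ cv] : intg a b (fun=> 0) /\ I a b (fun t => c (f t - s (best f n t))) @[n --> \oo] --> I a b (fun=> 0).
  apply: (@I_dct _ a b (fun n t => c (f t - s (best f n t))) (fun=> 0) _ m2 (measurable_cst _) cf).
  - apply: aeabW => t _; apply/cvgrPdist_lt => eps eps0.
    have [eta eta0 he] := cs eps0; have [k hk] := ds (f t) eta0.
    exists k => // n /= kn; rewrite sub0r normrN ger0_norm//.
    exact: le_lt_trans (best_le n k t kn) (he _ hk).
  - by apply: aeabW => t _ n; rewrite ger0_norm// (le_trans (best_le n 0%N t (leq0n n)))// s0 subr0.
rewrite I_cst// mul0r in cv.
have k1 : 0 < kap + 1 by rewrite ltr_wpDl.
pose e' := e / 2 / (kap + 1).
have e'0 : 0 < e' by rewrite !divr_gt0.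
have /cvgr0_norm_lt/(_ _ e'0)[n _ /(_ n (leqnn n)) hn] := cv.
have [T [iT hT]] := stepapprox_best n ab bf e'0.
have bT := isstep_bmeas (stepT_isstep s T).
exists T; set F := fun t => c (f t - _).
have i1 : intg a b (fun t => c (f t - s (best f n t))).
  by apply: intg_le cf => // t _; rewrite ger0_norm// (le_trans (best_le n 0%N t (leq0n n)))// s0 subr0.
pose g t := kap * (c (f t - s (best f n t)) + c (s (best f n t) - stepT s T t)).
have Fg t : F t <= g t by rewrite /F -(subrK (s (best f n t)) (f t)) -addrA cD.
have ig : intg a b g by apply: intgZ; exact: intgD.
have iF : intg a b F.
  by apply: intg_le ig => [|t _]; [apply: cm; exact: (bmeasB ds bf)|rewrite ger0_norm ?Fg// /F c0].
split => //; rewrite (le_lt_trans (I_le iF ig (aeabW (fun t _ => Fg t))))//.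
rewrite /g IZ; last exact: intgD.
rewrite ID//.
have h1 : I a b (fun t => c (f t - s (best f n t))) < e' by exact: le_lt_trans (ler_norm _) hn.
set x := I a b _ in h1 *; set y := I a b _ in hT *.
rewrite (@le_lt_trans _ _ (kap * (e' + e')))//; first by rewrite ler_wpM2l// ltW// ltrD.
rewrite (_ : e = (kap + 1) * (e' + e')); last by rewrite /e'; field; rewrite gt_eqF.
by rewrite ltr_pM2r ?addr_gt0// ltrDl.
Qed.

End Density.

(** * Difference quotients in time and the energy identity *)

Section Clamp.
Variable R : realType.
Notation RM := (measurableTypeR R).
Implicit Types (a b s t e : R).

Definition cl a b t := Num.max a (Num.min b t).

Lemma cl_itv a b t : a <= b -> a <= cl a b t <= b.
Proof. by move=> ab; rewrite /cl le_max lexx/= ge_max ab ge_min lexx. Qed.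

Lemma cl_id a b t : a <= t <= b -> cl a b t = t.
Proof. by move=> /andP[h1 h2]; rewrite /cl min_r// max_r. Qed.

Lemma cl_mono a b s t : s <= t -> cl a b s <= cl a b t.
Proof.
move=> st; rewrite /cl ge_max le_max lexx/= le_max; apply/orP; right.
by rewrite le_min !ge_min lexx/= st orbT.
Qed.

Lemma cl_lip a b s t : s <= t -> cl a b t - cl a b s <= t - s.
Proof. by move=> st; rewrite /cl /Num.max /Num.min; repeat case: ifPn; rewrite -?leNgt; lra. Qed.

Lemma cl_continuous a b : continuous (cl a b).
Proof.
move=> t; apply: continuous_max; first exact: cvg_cst.
by apply: continuous_min; [exact: cvg_cst|exact: cvg_id].
Qed.

Lemma I_shift_diff a b e (h : R -> R) : a <= b -> 0 <= e -> intg a (b + e) h ->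
  I (a + e) (b + e) h - I a b h = I b (b + e) h - I a (a + e) h.
Proof.
move=> ab e0 hh; have be : b <= b + e by rewrite lerDl.
have ae : a <= a + e by rewrite lerDl.
have h1 := I_split ab be hh; have h2 := I_split ae (_ : a + e <= b + e) hh.
by rewrite lerD2r in h2; have {}h2 := h2 ab; lra.
Qed.

(** After a translation of the first integral this is the difference quotient of a primitive of h at
    b minus the one at a. *)
Lemma diff_quotient_cvg a b (h : R -> R) : a <= b -> continuous h ->
  e^-1 * (I a b (fun t => h (t + e)) - I a b h) @[e --> 0^'] --> h b - h a.
Proof.
move=> ab ch; pose P x := I (a - 1) x h.
have a1 : a - 1 < a by rewrite gtrBl.
have Pq x : a <= x -> e^-1 * (P (x + e) - P x) @[e --> 0^'] --> h x.
  move=> ax; have [/cvg_ex[l hl] e] := primitive_derive ch (lt_le_trans a1 ax).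
  have <- : l = h x by rewrite -e; apply/esym/cvg_lim.
  apply: cvg_trans hl; apply: near_eq_cvg; apply: nearW => e' /=.
  by rewrite /P /GRing.scale/= mulr1 [x + e']addrC.
have key : e^-1 * (P (b + e) - P b) - e^-1 * (P (a + e) - P a) @[e --> 0^'] --> h b - h a.
  by apply: cvgB; apply: Pq.
apply: cvg_trans key; apply: near_eq_cvg; near=> e.
rewrite -mulrBr; congr (_ * _).
have e1 : `|e| <= 1 by near: e; apply: dnbhs0_le.
have {e1} e1 : - 1 <= e <= 1 by rewrite -ler_norml.
have hi x y : intg x y h by exact: intg_cont.
have PE x y : a - 1 <= x -> x <= y -> P y - P x = I x y h.
  by move=> ax xy; rewrite /P (I_split ax xy (hi _ _)) addrAC subrr add0r.
rewrite I_translate// -(PE (a + e) (b + e)) ?lerD2r//; last by lra.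
rewrite -(PE a b)//; [ring|lra].
Unshelve. all: by end_near. Qed.

End Clamp.

Section Duality.
Variables (R : realType) (V H : completeNormedModType R) (ip : H -> H -> R) (i : V -> H).
Variable (al : R).
Hypothesis hG : gelfand_triple ip i.
Hypothesis al1 : 1 < al.
Notation RM := (measurableTypeR R).
Implicit Types (a b s t e z B : R) (Z : R -> H) (F : R -> V -> R) (G : R -> R) (Y : R -> V).

(* dZ/dt = F in the dual of V. *)
Definition evol a b Z F := forall s t w, a <= s -> s <= t -> t <= b ->
  ip (Z t - Z s) (i w) = I s t (fun r => F r w).

(* F is bounded in L^(al / (al - 1)) with values in the dual of V; writing the
   density as G^(al - 1) with G in L^al avoids the conjugate exponent. *)
Record dgrowth a b F G B : Prop := DGrowth {
  dg_dual : forall r, is_dual (F r);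
  dg_meas : forall w, measurable_fun [set: RM] (F ^~ w);
  dg_ge0 : forall r, 0 <= G r;
  dg_le : forall r w, a <= r <= b -> `|F r w| <= G r `^ (al - 1) * `|w|;
  dg_intg : intg a b (fun r => G r `^ al);
  dg_int : I a b (fun r => G r `^ al) <= B }.

Definition lpV a b Y := bmeas (Y : RM -> V) /\ intg a b (fun t => `|Y t| `^ al).

Let al0 : 0 < al. Proof. exact: lt_trans al1. Qed.

Lemma lpV_meas Y : bmeas (Y : RM -> V) -> measurable_fun [set: RM] (fun t => `|Y t| `^ al).
Proof. by move=> bY; apply: (measurableT_comp (measurable_powR al)); exact: (bmeas_normr bY). Qed.

Lemma lpV_norm a b Y : lpV a b Y -> intg a b (fun t => `|Y t|).
Proof.
move=> [bY iY]; apply: (intg_le (bmeas_normr bY) _ (intgD (intg_cst a b 1) iY)) => t _.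
by rewrite normr_id le_powR1// ltW.
Qed.

Lemma lpVD a b Y Y' : lpV a b Y -> lpV a b Y' -> lpV a b (fun t => Y t + Y' t).
Proof.
move=> [bY iY] [bY' iY']; have [s ds] := V_dense_seq hG.
have b'' := bmeasD ds bY bY'; split => //.
apply: (intg_le (lpV_meas b'') _ (intgZ (2 `^ al) (intgD iY iY'))) => t _.
rewrite ger0_norm ?powR_ge0// (le_trans _ (powRD_le (ltW al0) (normr_ge0 _) (normr_ge0 _)))//.
by rewrite ge0_ler_powR ?nnegrE// ?ler_normD// ?addr_ge0// ltW.
Qed.

Lemma lpVN a b Y : lpV a b Y -> lpV a b (fun t => - Y t).
Proof. by move=> [bY iY]; split; [exact: bmeasN|under eq_fun do rewrite normrN]. Qed.

Lemma lpVB a b Y Y' : lpV a b Y -> lpV a b Y' -> lpV a b (fun t => Y t - Y' t).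
Proof. by move=> hY hY'; apply: lpVD => //; exact: lpVN. Qed.

Lemma lpVS a b c d Y : a <= c -> d <= b -> lpV a b Y -> lpV c d Y.
Proof. by move=> ac db [bY iY]; split => //; exact: intgS iY. Qed.

Lemma lpV_step a b f : isstep f -> lpV a b f.
Proof.
move=> sf; have bf := isstep_bmeas sf; split => //.
have [M hM] := isstep_bounded (fun v => `|v| `^ al) sf.
apply: (intg_le (lpV_meas bf) _ (intg_cst a b M)) => t _.
by rewrite ger0_norm ?powR_ge0.
Qed.

Lemma dgrowthS a b c d F G B : a <= c -> d <= b -> dgrowth a b F G B -> dgrowth c d F G B.
Proof.
move=> ac db [h1 h2 h3 h4 h5 h6]; split => //.
- by move=> r w /andP[cr rd]; apply: h4; rewrite (le_trans ac)//= (le_trans rd).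
- exact: intgS h5.
- by apply: le_trans h6; apply: I_sub => // t _; exact: powR_ge0.
Qed.

Section oneF.
Variables (a b : R) (F : R -> V -> R) (G : R -> R) (B : R).
Hypothesis dg : dgrowth a b F G B.

Lemma dg_meas_comp Y : bmeas (Y : RM -> V) -> measurable_fun [set: RM] (fun t => F t (Y t)).
Proof.
move=> bY; have [s ds] := V_dense_seq hG.
exact: (measurable_dual ds (dg_dual dg) (dg_meas dg) bY).
Qed.

Lemma dg_young z r w : 0 < z -> a <= r <= b ->
  `|F r w| <= z * G r `^ al + z `^ (1 - al) * `|w| `^ al.
Proof.
move=> z0 rab; rewrite (le_trans (dg_le dg w rab))// powR_youngl//; exact: dg_ge0 dg r.
Qed.

Lemma dg_intF Y : lpV a b Y -> intg a b (fun t => F t (Y t)).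
Proof.
move=> [bY iY].
apply: (intg_le (dg_meas_comp bY) _ (intgD (intgZ 1 (dg_intg dg)) (intgZ (1 `^ (1 - al)) iY))) => t tab.
exact: dg_young.
Qed.

Lemma dg_bound z Y : 0 < z -> lpV a b Y ->
  `|I a b (fun t => F t (Y t))| <= z * B + z `^ (1 - al) * I a b (fun t => `|Y t| `^ al).
Proof.
move=> z0 hY; have [bY iY] := hY.
have i1 := intgZ z (dg_intg dg); have i2 := intgZ (z `^ (1 - al)) iY.
have h := I_abs_le (dg_meas_comp bY) (intgD i1 i2) (fun t tab => dg_young (Y t) z0 tab).
rewrite (le_trans h)// ID// !IZ//; last exact: dg_intg dg.
by rewrite lerD2r ler_wpM2l ?(ltW z0)//; exact: dg_int dg.
Qed.

Hypothesis ab : a <= b.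

(** The mass of G^al up to time t, frozen outside [a, b]. Increments of Z will be bounded by
    increments of gam; as gam is monotone and bounded by B, its shift by e costs at most |e| B in
    the mean. *)
Let gam t := I a (cl a b t) (fun r => G r `^ al).

Let B0 : 0 <= B.
Proof. by apply: le_trans (dg_int dg); apply: I_ge0 => t _; exact: powR_ge0. Qed.

Let gam_mono s t : s <= t -> gam s <= gam t.
Proof.
move=> st; have /andP[h1 h2] := cl_itv t ab.
apply: I_sub => //; [exact: cl_mono|exact: intgS h2 (dg_intg dg)|by move=> r _; exact: powR_ge0].
Qed.

Let gam0 t : 0 <= gam t.
Proof. by apply: I_ge0 => r _; exact: powR_ge0. Qed.

Let gamB t : gam t <= B.
Proof.
apply: le_trans (dg_int dg); have /andP[h1 h2] := cl_itv t ab.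
by apply: I_sub => //; [exact: dg_intg dg|move=> r _; exact: powR_ge0].
Qed.

Let gam_intg x y : intg x y gam.
Proof.
apply: (@intg_le _ _ _ _ (fun=> B) _ _ (intg_cst x y B)) => [|t _]; last by rewrite ger0_norm.
by apply: nondecreasing_measurable => // s t; exact: gam_mono.
Qed.

Let gam_diff z Z s t w : 0 < z -> evol a b Z F -> s <= t ->
  `|ip (Z (cl a b t) - Z (cl a b s)) (i w)| <=
  z * (gam t - gam s) + z `^ (1 - al) * `|w| `^ al * (t - s).
Proof.
move=> z0 eZ st; have /andP[s1 s2] := cl_itv s ab; have /andP[t1 t2] := cl_itv t ab.
have cst := cl_mono a b st.
rewrite eZ//.
have dgs := dg_intg dg.
have i1 := intgZ z (intgS s1 t2 dgs).
have i2 := intg_cst (cl a b s) (cl a b t) (z `^ (1 - al) * `|w| `^ al).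
have mFw := dg_meas dg w.
have h := @I_abs_le _ (cl a b s) (cl a b t) (fun r => F r w) _ mFw (intgD i1 i2).
rewrite (le_trans (h _))// => [r /andP[r1 r2]|].
  by apply: dg_young => //; rewrite (le_trans s1)//= (le_trans r2).
rewrite ID// IZ ?I_cst//; last exact: intgS s1 t2 dgs.
rewrite lerD// ?ler_wpM2l ?mulr_ge0 ?powR_ge0 ?cl_lip// ?(ltW z0)//.
rewrite /gam (I_split s1 cst (intgS (lexx a) t2 dgs)).
by rewrite addrAC subrr add0r.
Qed.

Let gam_shift e : I a b (fun t => `|gam (t + e) - gam t|) <= `|e| * B.
Proof.
have gs x y u : intg x y (fun t => gam (t + u)) by apply: intg_translate; exact: gam_intg.
have le_B x y : x <= y -> I x y gam <= B * (y - x).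
  move=> xy; rewrite -I_cst//; apply: I_le => //; first exact: intg_cst.
  by apply: aeabW => t _.
have ge_0 x y : 0 <= I x y gam by apply: I_ge0.
have [e0|e0] := leP 0 e.
  rewrite (_ : (fun t => _) = (fun t => gam (t + e) - gam t)); last first.
    by apply/funext => t; rewrite ger0_norm// subr_ge0 gam_mono// lerDl.
  rewrite IB// I_translate// I_shift_diff//.
  have := le_B b (b + e) (_ : b <= b + e); rewrite lerDl => /(_ e0).
  have := ge_0 a (a + e); rewrite ger0_norm//; lra.
pose u := - e; have u0 : 0 <= u by rewrite oppr_ge0 ltW.
have -> : (fun t => `|gam (t + e) - gam t|) = (fun t => gam t - gam (t + e)).
  by apply/funext => t; rewrite ler0_norm ?opprB// subr_le0 gam_mono// gerDl ltW.
rewrite IB// I_translate//.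
have := @I_shift_diff R (a + e) (b + e) u gam _ u0 (gam_intg _ _).
rewrite lerD2r => /(_ ab); rewrite /u !addrK => ->.
have := le_B (b + e) b (_ : b + e <= b); rewrite gerDl => /(_ (ltW e0)).
have := ge_0 (a + e) a; rewrite ler0_norm; [lra|exact: ltW].
Qed.

(* The difference quotient of Z tested against Y; Z is frozen outside [a, b], and
   e takes both signs. *)
Definition quot Z a' b' e Y := e^-1 * I a' b' (fun t => ip (Z (cl a b (t + e)) - Z (cl a b t)) (i (Y t))).

Lemma bmeas_cl Z e : continuous Z -> bmeas ((fun t => Z (cl a b (t + e))) : RM -> H).
Proof.
move=> cZ U oU.
have cc : continuous (fun t => Z (cl a b (t + e))).
  move=> t; apply: (@continuous_comp _ _ _ (fun t => cl a b (t + e)) Z); last exact: cZ.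
  apply: (@continuous_comp _ _ _ (fun t : R => t + e) (cl a b)); last exact: cl_continuous.
  by apply: cvgD; [exact: cvg_id|exact: cvg_cst].
by apply: open_measurable; move/continuousP : cc; exact.
Qed.

Lemma quot_meas Z e Y : continuous Z -> bmeas (Y : RM -> V) ->
  measurable_fun [set: RM] (fun t => ip (Z (cl a b (t + e)) - Z (cl a b t)) (i (Y t))).
Proof.
move=> cZ bY; have [sH dsH] := H_dense_seq hG.
apply: (measurable_ip hG dsH); last exact: (bmeas_i hG).
apply: (bmeasB dsH); first exact: bmeas_cl.
by have := bmeas_cl 0 cZ; under eq_fun do rewrite addr0.
Qed.

Lemma cl_bounded Z : continuous Z -> exists2 M, 0 <= M & forall t, `|Z (cl a b t)| <= M.
Proof.
move=> cZ; have cN : {within `[a, b], continuous (fun t => `|Z t|)}.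
  by apply: continuous_subspaceT => t; apply: cvg_norm; exact: cZ.
have [c _ hc] := EVT_max ab cN.
exists `|Z c| => // t; apply: hc; rewrite in_itv/=; exact: cl_itv.
Qed.

Lemma quot_intg Z a' b' e Y : continuous Z -> a <= a' -> b' <= b -> lpV a b Y ->
  intg a' b' (fun t => ip (Z (cl a b (t + e)) - Z (cl a b t)) (i (Y t))).
Proof.
move=> cZ aa bb hY; have [M M0 hM] := cl_bounded cZ.
have [k k0 hk] := i_bounded hG.
apply: (intg_le (quot_meas e cZ hY.1) _ (intgZ ((M + M) * k) (lpV_norm (lpVS aa bb hY)))) => t _.
rewrite (le_trans (cauchy_schwarz hG _ _))// -mulrA ler_pM//.
by rewrite (le_trans (ler_normB _ _))// lerD.
Qed.

(** The bound is uniform in e: Young's inequality bounds the increment of Z by an increment of gam,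
    of integral at most |e| B, plus |e| times a multiple of |Y|^al, and the division by e cancels
    |e|. This uniformity is what allows Y to be replaced by a step function. *)
Lemma quot_bound Z e z Y : continuous Z -> evol a b Z F -> 0 < z -> e != 0 -> lpV a b Y ->
  `|quot Z a b e Y| <= z * B + z `^ (1 - al) * I a b (fun t => `|Y t| `^ al).
Proof.
move=> cZ eZ z0 e0 hY; have ep : 0 < `|e| by rewrite normr_gt0.
rewrite /quot normrM normfV ler_pdivrMl//.
have gs x y u : intg x y (fun t => gam (t + u)) by apply: intg_translate; exact: gam_intg.
have i1 : intg a b (fun t => `|gam (t + e) - gam t|) by apply/intg_norm/intgB.
have i2 := intgZ (z `^ (1 - al) * `|e|) hY.2.
have := @I_abs_le _ a b _ (fun t => z * `|gam (t + e) - gam t| + z `^ (1 - al) * `|e| * `|Y t| `^ al)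
  (quot_meas e cZ hY.1) (intgD (intgZ z i1) i2).
move=> /(_ _)/le_trans; apply => [t _|].
  have [h|/ltW h] := leP 0 e.
    have := @gam_diff z Z t (t + e) (Y t) z0 eZ; rewrite lerDl => /(_ h)/le_trans; apply.
    rewrite ger0_norm ?subr_ge0 ?gam_mono// ?lerDl//.
    by rewrite lerD2l ger0_norm// addrAC subrr add0r mulrAC.
  have := @gam_diff z Z (t + e) t (Y t) z0 eZ; rewrite gerDl => /(_ h).
  rewrite -(opprB (Z (cl a b t))) (ipNl hG) normrN => /le_trans; apply.
  rewrite ler0_norm ?subr_le0 ?gam_mono ?gerDl// opprB.
  by rewrite lerD2l ler0_norm// opprD addrA subrr add0r mulrAC.
rewrite ID//; last exact: intgZ.
rewrite !IZ//; last exact: hY.2.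
rewrite mulrDr lerD//; last by rewrite mulrA [`|e| * _]mulrC.
by rewrite mulrCA ler_pM2l// gam_shift.
Qed.

End oneF.

(** Where f has a constant value w, both expressions are governed by increments tested with w: the
    integral equals the increment of Zj, and the quotient tends to the increment of Z. Pieces add
    up, single breakpoints being null sets. Z itself is not assumed to satisfy [evol], so l has no
    expression as an integral. *)
Lemma isstep_quot_cvg a b (Zj : nat -> R -> H) Z (Fj : nat -> R -> V -> R) (Gj : nat -> R -> R) B f :
  a <= b -> (forall j, evol a b (Zj j) (Fj j)) -> (forall j, dgrowth a b (Fj j) (Gj j) B) ->
  continuous Z -> (forall t, a <= t <= b -> Zj j t @[j --> \oo] --> Z t) -> isstep f ->
  forall a' b', a <= a' -> a' <= b' -> b' <= b -> exists l : R,
    I a' b' (fun t => Fj j t (f t)) @[j --> \oo] --> l /\ quot a b Z a' b' e f @[e --> 0^'] --> l.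
Proof.
move=> ab eZ dg cZ ZZ; elim=> [w|c {}f g sf IHf sg IHg] a' b' aa abb bb.
  exists (ip (Z b' - Z a') (i w)); split.
    rewrite (_ : (fun j => _) = (fun j => ip (Zj j b' - Zj j a') (i w))); last first.
      by apply/funext => j; rewrite eZ.
    apply: (cvg_ip hG); last exact: cvg_cst.
    by apply: cvgB; apply: ZZ; [rewrite (le_trans aa)//|rewrite aa (le_trans abb)].
  pose h t := ip (Z (cl a b t)) (i w).
  have ch : continuous h.
    move=> t; apply: (cvg_ip hG); last exact: cvg_cst.
    apply: (@continuous_comp _ _ _ (cl a b) Z); [exact: cl_continuous|exact: cZ].
  have -> : ip (Z b' - Z a') (i w) = h b' - h a'.
    by rewrite /h !cl_id ?aa ?(le_trans abb)//= ?(le_trans aa)// (ipBl hG).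
  have := diff_quotient_cvg abb ch.
  apply: cvg_trans; apply: near_eq_cvg; apply: nearW => e; rewrite /quot; congr (_ * _).
  have hi x y u : intg x y (fun t => h (t + u)) by apply: intg_translate; exact: intg_cont.
  rewrite -IB//; last exact: intg_cont.
  by congr I; apply/funext => t; rewrite /h (ipBl hG).
have if_ j x y : a <= x -> y <= b -> intg x y (fun t => Fj j t (f t)).
  by move=> ax yb; apply: (dg_intF (dgrowthS ax yb (dg j))); exact: lpV_step.
have ig_ j x y : a <= x -> y <= b -> intg x y (fun t => Fj j t (g t)).
  by move=> ax yb; apply: (dg_intF (dgrowthS ax yb (dg j))); exact: lpV_step.
have ifg_ j x y : a <= x -> y <= b -> intg x y (fun t => Fj j t (if t < c then f t else g t)).
  by move=> ax yb; apply: (dg_intF (dgrowthS ax yb (dg j))); apply: lpV_step; exact: isstep_glue.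
have [ca|ac] := leP c a'.
  have [l [l1 l2]] := IHg a' b' aa abb bb; exists l; split.
    apply: cvg_trans l1; apply: near_eq_cvg; apply: nearW => j; apply: I_eq => t /andP[at_ _].
    by rewrite ltNge (le_trans ca at_).
  apply: cvg_trans l2; apply: near_eq_cvg; apply: nearW => e; congr (_ * _); apply: I_eq => t /andP[at_ _].
  by rewrite ltNge (le_trans ca at_).
have [bc|cb] := leP b' c.
  have [l [l1 l2]] := IHf a' b' aa abb bb; exists l.
  have aeq : aeab a' b' (fun t => t < c).
    have h0 : (lebesgue_measure ([set b'] : set RM) = 0)%E by rewrite lebesgue_measure_set1.
    exists [set b']; split => // t /= /not_implyP[/andP[_ tb] /negP].
    by rewrite -leNgt => ct; apply/eqP; rewrite eq_le tb (le_trans bc ct).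
  split.
    apply: cvg_trans l1; apply: near_eq_cvg; apply: nearW => j; apply: I_ae_eq.
    - exact: (if_ j a b (lexx _) (lexx _)).1.
    - exact: (ifg_ j a b (lexx _) (lexx _)).1.
    - by apply: aeab_filter aeq => t _ ->.
  apply: cvg_trans l2; apply: near_eq_cvg; apply: nearW => e; congr (_ * _); apply: I_ae_eq.
  - exact: (quot_meas a b e cZ (isstep_bmeas sf)).
  - exact: (quot_meas a b e cZ (isstep_bmeas (isstep_glue c sf sg))).
  - by apply: aeab_filter aeq => t _ ->.
have [l [l1 l2]] := IHf a' c aa (ltW ac) (le_trans (ltW cb) bb).
have [m [m1 m2]] := IHg c b' (le_trans aa (ltW ac)) (ltW cb) bb.
have aeq : aeab a' c (fun t => t < c).
  have h0 : (lebesgue_measure ([set c] : set RM) = 0)%E by rewrite lebesgue_measure_set1.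
  exists [set c]; split => // t /= /not_implyP[/andP[_ tb] /negP].
  by rewrite -leNgt => ct; apply/eqP; rewrite eq_le tb ct.
have acb := le_trans (ltW cb) bb; have aac := le_trans aa (ltW ac).
exists (l + m); split.
  apply: cvg_trans (cvgD l1 m1); apply: near_eq_cvg; apply: nearW => j /=.
  rewrite (I_split (ltW ac) (ltW cb)); last exact: ifg_.
  congr (_ + _); last by apply: I_eq => t /andP[ct _]; rewrite ltNge ct.
  apply: I_ae_eq; [exact: (if_ j a b (lexx _) (lexx _)).1|exact: (ifg_ j a b (lexx _) (lexx _)).1|].
  by apply: aeab_filter aeq => t _ ->.
apply: cvg_trans (cvgD l2 m2); apply: near_eq_cvg; apply: nearW => e /=.
rewrite /quot -mulrDr; congr (_ * _).
rewrite [RHS](I_split (ltW ac) (ltW cb)); last first.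
  by apply: (quot_intg ab e cZ aa bb); apply: lpV_step; exact: isstep_glue.
congr (_ + _); last by apply: I_eq => t /andP[ct _]; rewrite ltNge ct.
apply: I_ae_eq.
- exact: (quot_meas a b e cZ (isstep_bmeas sf)).
- exact: (quot_meas a b e cZ (isstep_bmeas (isstep_glue c sf sg))).
- by apply: aeab_filter aeq => t _ ->.
Qed.

Lemma lpV_dense a b Y e : a <= b -> lpV a b Y -> 0 < e -> exists f,
  isstep f /\ I a b (fun t => `|Y t - f t| `^ al) < e.
Proof.
move=> ab [bY iY] e0; have [s ds] := V_dense_seq hG.
pose s' n := if n is m.+1 then s m else 0.
have ds' : dense_seq s' by move=> v eps /ds-/(_ v)[n hn]; exists n.+1.
have [] := @step_dense R V s' (fun v => `|v| `^ al) (2 `^ al) ds' _ _ _ _ _ _ a b Y ab bY iY e e0.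
- by [].
- by move=> v; exact: powR_ge0.
- by rewrite normr0 powR0// gt_eqF.
- move=> v w; apply: le_trans (powRD_le (ltW al0) (normr_ge0 _) (normr_ge0 _)).
  by rewrite ge0_ler_powR ?nnegrE// ?ler_normD// ?addr_ge0// ltW.
- move=> eps eps0; exists (Num.min 1 eps); first by rewrite lt_min ltr01.
  move=> v; rewrite lt_min => /andP[v1 ve]; have [->|v0] := eqVneq v 0.
    by rewrite normr0 powR0// gt_eqF.
  by rewrite (le_lt_trans _ ve)// ge1r_powR ?ltW// ?normr_gt0 ?v0 ?ltW.
- by move=> f bf; exact: lpV_meas.
- by move=> T [_ hT]; exists (stepT s' T); split => //; exact: stepT_isstep.
Qed.

(** Difference quotients stand for the unknown derivative of the uniform limit Z. For step functions
    both terms have the same limit; replacing Y by a step function costs little, uniformly in j and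
    u, by [dg_bound] and [quot_bound]. *)
Lemma duality_limit a b (Zj : nat -> R -> H) Z (Fj : nat -> R -> V -> R) (Gj : nat -> R -> R) B Y :
  a <= b -> (forall j, evol a b (Zj j) (Fj j)) -> (forall j, dgrowth a b (Fj j) (Gj j) B) ->
  (forall j, continuous (Zj j)) -> continuous Z ->
  (forall e, 0 < e -> exists N, forall j, (N <= j)%N -> forall t, a <= t <= b -> `|Zj j t - Z t| <= e) ->
  lpV a b Y -> forall e, 0 < e -> \forall u \near 0^', exists N, forall j, (N <= j)%N ->
    `|I a b (fun t => Fj j t (Y t)) - quot a b Z a b u Y| < e.
Proof.
move=> ab eZ dg cZj cZ ZZ hY e e0.
have B0 : 0 <= B by apply: le_trans (dg_int (dg 0%N)); apply: I_ge0 => t _; exact: powR_ge0.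
(* z is fixed first, against B; the step function f is then chosen with a tolerance that compensates
   the factor z^(1 - al). *)
pose z := e / 16 / (B + 1); have B1 : 0 < B + 1 by rewrite ltr_wpDl.
have z0 : 0 < z by rewrite !divr_gt0.
have zB : z * B <= e / 16.
  by rewrite /z -mulrA ler_piMr ?divr_ge0// ?ltW// ltr_pdivrMl// mulr1 ltrDl.
have zp : 0 < z `^ (1 - al) by exact: powR_gt0.
have [f [sf hf]] := lpV_dense ab hY (divr_gt0 (divr_gt0 e0 (ltr0n _ 16)) zp).
have hYf := lpVB hY (lpV_step a b sf).
set Yf := fun t => _ in hYf.
have bnd : z * B + z `^ (1 - al) * I a b (fun t => `|Yf t| `^ al) <= e / 8.
  have : z `^ (1 - al) * I a b (fun t => `|Yf t| `^ al) <= e / 16.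
    by rewrite -ler_pdivlMl// mulrC ltW.
  lra.
have Zptw t : a <= t <= b -> Zj j t @[j --> \oo] --> Z t.
  move=> tab; apply/cvgrPdist_le => eps eps0; have [N hN] := ZZ _ eps0.
  by exists N => // j /= Nj; rewrite distrC hN.
have [l [l1 l2]] := isstep_quot_cvg ab eZ dg cZ Zptw sf (lexx a) ab (lexx b).
have FB j : `|I a b (fun t => Fj j t (Yf t))| <= e / 8.
  exact: le_trans (dg_bound (dg j) z0 hYf) bnd.
have [k k0 hk] := i_bounded hG.
have QB u : u != 0 -> `|quot a b Z a b u Yf| <= e / 8.
  move=> u0; apply/ler_addgt0Pr => eps eps0.
  pose J := I a b (fun t => `|Yf t|).
  have J0 : 0 <= J by apply: I_ge0.
  have up : 0 < `|u| by rewrite normr_gt0.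
  (* [quot_bound] requires an evolution, so it is applied to some Zj close to Z; the tolerance
     carries the factor |u| because a quotient divides by u. *)
  pose e' := eps * `|u| / (2 * k * J + 1).
  have d0 : 0 < 2 * k * J + 1 by rewrite ltr_wpDl// !mulr_ge0.
  have e'0 : 0 < e' by rewrite divr_gt0// mulr_gt0.
  have [N /(_ N (leqnn N)) hN] := ZZ _ e'0.
  rewrite -(subrK (quot a b (Zj N) a b u Yf) (quot a b Z a b u Yf)) (le_trans (ler_normD _ _))// addrC.
  rewrite lerD//; first exact: le_trans (quot_bound (dg N) ab (cZj N) (eZ N) z0 u0 hYf) bnd.
  rewrite /quot -mulrBr normrM normfV ler_pdivrMl// -IB; try exact: quot_intg.
  have i1 := intgZ (2 * k * e') (lpV_norm hYf).
  have := @I_abs_le _ a b (fun t => ip (Z (cl a b (t + u)) - Z (cl a b t)) (i (Yf t)) -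
    ip (Zj N (cl a b (t + u)) - Zj N (cl a b t)) (i (Yf t))) _ _ i1.
  move=> h; rewrite (le_trans (h _ _))//.
  - by apply: measurable_funB; apply: quot_meas => //; exact: hYf.1.
  - move=> t _; rewrite -(ipBl hG) (le_trans (cauchy_schwarz hG _ _))//.
    have z1 : `|Z (cl a b (t + u)) - Zj N (cl a b (t + u))| <= e' by rewrite distrC hN// cl_itv.
    have z2 : `|Zj N (cl a b t) - Z (cl a b t)| <= e' by rewrite hN// cl_itv.
    rewrite (_ : 2 * k * e' * `|Yf t| = (e' + e') * (k * `|Yf t|)); last by ring.
    rewrite ler_pM//.
    rewrite (_ : _ - _ = (Z (cl a b (t + u)) - Zj N (cl a b (t + u))) + (Zj N (cl a b t) - Z (cl a b t))).
      by rewrite (le_trans (ler_normD _ _))// lerD.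
    by rewrite opprB addrACA [RHS]addrACA; congr (_ + _); exact: addrC.
  - rewrite IZ; last exact: lpV_norm hYf.
    rewrite -/J (_ : 2 * k * e' * J = e' * (2 * k * J)); last by ring.
    rewrite (@le_trans _ _ (e' * (2 * k * J + 1)))//; first by rewrite ler_pM2l// lerDl.
    by rewrite /e' mulfVK ?gt_eqF// mulrC.
have e4 : 0 < e / 4 by rewrite divr_gt0.
have /cvgrPdist_lt/(_ _ e4)[N _ hN] := l1.
near=> u; exists N => j Nj.
have u0 : u != 0 by near: u; exact: nbhs_dnbhs_neq.
have h2 : `|l - quot a b Z a b u f| < e / 4.
  by near: u; move/cvgrPdist_lt : l2; apply.
have h1 := hN j Nj; have h3 := FB j; have h4 := QB u u0.
have e5 : I a b (fun t => Fj j t (Y t)) = I a b (fun t => Fj j t (Yf t)) + I a b (fun t => Fj j t (f t)).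
  rewrite -ID; [|exact: (dg_intF (dg j))|by apply: (dg_intF (dg j)); exact: lpV_step].
  by congr I; apply/funext => t; rewrite -(dualD (dg_dual (dg j) t)) subrK.
have e6 : quot a b Z a b u Y = quot a b Z a b u Yf + quot a b Z a b u f.
  rewrite /quot -mulrDr -ID; try by apply: quot_intg => //; exact: lpV_step.
  by congr (_ * I _ _ _); apply/funext => t; rewrite -(ipDr hG) -(iD hG) subrK.
rewrite e5 e6; move: h1 h2 h3 h4 => /=.
rewrite !ltr_norml !ler_norml => /andP[? ?] /andP[? ?] /andP[? ?] /andP[? ?].
by apply/andP; split; lra.
Unshelve. all: by end_near. Qed.

Lemma quot_square a b Z Y u : a <= b -> continuous Z -> bmeas (Y : RM -> V) ->
  aeab a b (fun t => i (Y t) = Z t) ->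
  u^-1 * (I a b (fun t => `|Z (cl a b (t + u))| ^+ 2) - I a b (fun t => `|Z (cl a b t)| ^+ 2)) =
  2 * quot a b Z a b u Y + u^-1 * I a b (fun t => `|Z (cl a b (t + u)) - Z (cl a b t)| ^+ 2).
Proof.
move=> ab cZ bY YZ.
have cc v : continuous (fun t => Z (cl a b (t + v))).
  move=> t; apply: (@continuous_comp _ _ _ (fun t => cl a b (t + v)) Z); last exact: cZ.
  apply: (@continuous_comp _ _ _ (fun t : R => t + v) (cl a b)); last exact: cl_continuous.
  by apply: cvgD; [exact: cvg_id|exact: cvg_cst].
have c0 : continuous (fun t => Z (cl a b t)) by have := cc 0; under eq_fun do rewrite addr0.
have sq (z : R -> H) : continuous z -> continuous (fun t => `|z t| ^+ 2).
  by move=> cz t; under eq_fun do rewrite expr2; apply: cvgM; apply: cvg_norm; exact: cz.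
have i1 : intg a b (fun t => `|Z (cl a b (t + u))| ^+ 2) by apply: intg_cont; exact: sq (cc u).
have i2 : intg a b (fun t => `|Z (cl a b t)| ^+ 2) by apply: intg_cont; exact: sq c0.
have cd : continuous (fun t => Z (cl a b (t + u)) - Z (cl a b t)).
  by move=> t; apply: cvgB; [exact: cc|exact: c0].
have i3 : intg a b (fun t => `|Z (cl a b (t + u)) - Z (cl a b t)| ^+ 2).
  by apply: intg_cont; exact: (sq _ cd).
have i4 : intg a b (fun t => ip (Z (cl a b (t + u)) - Z (cl a b t)) (Z (cl a b t))).
  by apply: intg_cont => t; apply: (cvg_ip hG); [exact: cd|exact: c0].
have -> : quot a b Z a b u Y = u^-1 * I a b (fun t => ip (Z (cl a b (t + u)) - Z (cl a b t)) (Z (cl a b t))).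
  congr (_ * _); apply: I_ae_eq; [exact: quot_meas|exact: i4.1|].
  by apply: aeab_filter YZ => t tab ->; rewrite (cl_id tab).
rewrite mulrCA -mulrDr; congr (_ * _); rewrite -IB// -IZ// -ID//; last exact: intgZ.
congr I; apply/funext => t; rewrite (normB2 hG) (ipBl hG) (ipxx hG); ring.
Qed.

Lemma dnbhs_pos (P : R -> Prop) : (\forall u \near 0^', P u) -> exists2 u, 0 < u & P u.
Proof.
move=> /nbhs_ballP[e /= e0 h]; exists (e / 2); first by rewrite divr_gt0.
apply: h; last by rewrite gt_eqF// divr_gt0.
by rewrite -ball_normE /= sub0r normrN ger0_norm ?divr_ge0// ?ltW// ltr_pdivrMr// ltr_pMr// ltr1n.
Qed.

Lemma dnbhs_neg (P : R -> Prop) : (\forall u \near 0^', P u) -> exists2 u, u < 0 & P u.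
Proof.
move=> /nbhs_ballP[e /= e0 h]; exists (- (e / 2)); first by rewrite oppr_lt0 divr_gt0.
apply: h; last by rewrite lt_eqF// oppr_lt0 divr_gt0.
rewrite -ball_normE /= sub0r opprK ger0_norm ?divr_ge0//; last exact: ltW.
by rewrite ltr_pdivrMr// ltr_pMr// ltr1n.
Qed.

Lemma quot_square_cvg a b Z : a <= b -> continuous Z ->
  u^-1 * (I a b (fun t => `|Z (cl a b (t + u))| ^+ 2) - I a b (fun t => `|Z (cl a b t)| ^+ 2))
    @[u --> 0^'] --> `|Z b| ^+ 2 - `|Z a| ^+ 2.
Proof.
move=> ab cZ.
have cl2 : continuous (fun t => `|Z (cl a b t)| ^+ 2).
  have cc : continuous (fun t => Z (cl a b t)).
    by move=> t; apply: (@continuous_comp _ _ _ (cl a b) Z); [exact: cl_continuous|exact: cZ].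
  by move=> t; under eq_fun do rewrite expr2; apply: cvgM; apply: cvg_norm; exact: cc.
by have := diff_quotient_cvg ab cl2; rewrite !cl_id ?lexx ?ab.
Qed.

(** The approximate derivatives Fj are tested with the limit Y. For u > 0 the squared increment of Z
    in [quot_square] has a favourable sign and is dropped. The result is the upper bound that
    Minty's trick requires. *)
Lemma energy_le a b (Zj : nat -> R -> H) Z (Fj : nat -> R -> V -> R) (Gj : nat -> R -> R) B Y :
  a <= b -> (forall j, evol a b (Zj j) (Fj j)) -> (forall j, dgrowth a b (Fj j) (Gj j) B) ->
  (forall j, continuous (Zj j)) -> continuous Z ->
  (forall e, 0 < e -> exists N, forall j, (N <= j)%N -> forall t, a <= t <= b -> `|Zj j t - Z t| <= e) ->
  lpV a b Y -> aeab a b (fun t => i (Y t) = Z t) -> forall e, 0 < e -> exists N, forall j, (N <= j)%N ->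
  2 * I a b (fun t => Fj j t (Y t)) <= `|Z b| ^+ 2 - `|Z a| ^+ 2 + e.
Proof.
move=> ab eZ dg cZj cZ ZZ hY YZ e e0; have e4 : 0 < e / 4 by rewrite divr_gt0.
have e2 : 0 < e / 2 by rewrite divr_gt0.
have D := duality_limit ab eZ dg cZj cZ ZZ hY e4.
have /cvgrPdist_lt/(_ _ e2) Q := quot_square_cvg ab cZ.
have [u u0 [[N hN] hQ]] := dnbhs_pos (filterI D Q).
exists N => j /hN; rewrite (quot_square u ab cZ hY.1 YZ) in hQ.
have h0 : 0 <= u^-1 * I a b (fun t => `|Z (cl a b (t + u)) - Z (cl a b t)| ^+ 2).
  by rewrite mulr_ge0 ?invr_ge0 ?(ltW u0)// I_ge0// => t _; exact: sqr_ge0.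
by move: hQ; rewrite !ltr_norml => /andP[? ?] /andP[? ?]; lra.
Qed.

(* In quot_square the square of the increment is multiplied by u^-1: u > 0 gives
   one inequality (energy_le) and u < 0 the other. *)
Lemma energy_eq a b Z F G B Y : a <= b -> evol a b Z F -> dgrowth a b F G B -> continuous Z ->
  lpV a b Y -> aeab a b (fun t => i (Y t) = Z t) ->
  `|Z b| ^+ 2 - `|Z a| ^+ 2 = 2 * I a b (fun t => F t (Y t)).
Proof.
move=> ab eZ dg cZ hY YZ.
have ZZ e : 0 < e -> exists N : nat, forall j, (N <= j)%N -> forall t, a <= t <= b -> `|Z t - Z t| <= e.
  by move=> e0; exists 0%N => j _ t _; rewrite subrr normr0 ltW.
apply/eqP; rewrite eq_le; apply/andP; split; apply/ler_addgt0Pr => e e0; last first.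
  have [N /(_ N (leqnn N))//] := energy_le ab (fun=> eZ) (fun=> dg) (fun=> cZ) cZ ZZ hY YZ e0.
have e4 : 0 < e / 4 by rewrite divr_gt0.
have e2 : 0 < e / 2 by rewrite divr_gt0.
have D := duality_limit ab (fun=> eZ) (fun=> dg) (fun=> cZ) cZ ZZ hY e4.
have /cvgrPdist_lt/(_ _ e2) Q := quot_square_cvg ab cZ.
have [u u0 [[N hN] hQ]] := dnbhs_neg (filterI D Q).
have {}hN := hN N (leqnn N); rewrite (quot_square u ab cZ hY.1 YZ) in hQ.
have h0 : u^-1 * I a b (fun t => `|Z (cl a b (t + u)) - Z (cl a b t)| ^+ 2) <= 0.
  by rewrite mulr_le0_ge0 ?invr_le0 ?(ltW u0)// I_ge0// => t _; exact: sqr_ge0.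
by move: hQ hN; rewrite !ltr_norml => /andP[? ?] /andP[? ?]; lra.
Qed.

End Duality.

Section MoreIntervals.
Variable R : realType.
Notation RM := (measurableTypeR R).

Lemma intg_le_ae a b (f g : R -> R) : measurable_fun [set: RM] f -> intg a b g ->
  aeab a b (fun t => `|f t| <= g t) -> intg a b f.
Proof.
move=> mf hg fg; split => //; have mE (k : R -> R) (D : set RM) : measurable_fun [set: RM] k -> measurable_fun D (EFin \o k).
  by move=> mk; apply/measurable_EFinP; exact: measurable_funTS.
apply/integrableP; split; first exact: mE.
have [_ /integrableP[_]] := hg; apply: le_lt_trans.
apply: ae_ge0_le_integral => //.
- by apply: measurableT_comp => //; exact: mE.
- by apply: measurableT_comp => //; exact: mE hg.1.
- apply: (@filterS _ _ (aeF R)) fg => t h; rewrite /= in_itv/= => /h h'.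
  by rewrite lee_fin (le_trans h')// ler_norm.
Qed.

Lemma bmeas_if (d : measure_display) (X : measurableType d) (T : topologicalType) (P : X -> Prop) (f g : X -> T) :
  measurable [set x | P x] -> bmeas f -> bmeas g -> bmeas (fun x => if `[< P x >] then f x else g x).
Proof.
move=> mP bf bg U oU.
rewrite (_ : _ @^-1` U = ([set x | P x] `&` f @^-1` U) `|` (~` [set x | P x] `&` g @^-1` U)).
  by apply: measurableU; apply: measurableI; [|exact: bf|exact: measurableC|exact: bg].
apply/seteqP; split => t /=; case: asboolP => Et.
- by left.
- by right.
- by move=> [[]//|[]].
- by move=> [[]//|[]].
Qed.

Lemma measurable_leset (d : measure_display) (X : measurableType d) (f g : X -> R) :
  measurable_fun [set: X] f -> measurable_fun [set: X] g -> measurable [set t | f t <= g t].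
Proof.
move=> mf mg; have /(_ measurableT `[0, +oo[%classic) := measurable_funB mg mf.
rewrite setTI => /(_ (measurable_itv _)); congr measurable.
by apply/seteqP; split => t /=; rewrite in_itv/= andbT subr_ge0.
Qed.

End MoreIntervals.

(** * The operator along functions of time, and Minty's trick *)

Section Core.
Variables (R : realType) (V H : completeNormedModType R) (ip : H -> H -> R) (i : V -> H).
Variables (A : V -> V -> R) (al delta K C : R).
Hypothesis mo : monotone_op ip i A al delta K C.
Notation RM := (measurableTypeR R).
Let hG := mo_gel mo.
Let Ad := mo_dual mo.
Let al1 := mo_alpha mo.
Let al0 := mo_alpha0 mo.
Let C0 := mo_C0 mo.
Implicit Types (a b s t e M : R) (Z : R -> H) (u Y N : R -> V).

Lemma bmeas_continuous (T : topologicalType) (Z : R -> T) : continuous Z -> bmeas (Z : RM -> T).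
Proof. by move=> cZ U oU; apply: open_measurable; move/continuousP : cZ; exact. Qed.

(** Chosen so that c (1 + g^(al - 1)) <= (dgc c (1 + g))^(al - 1): its power with exponent al - 1 is
    2 c, the factor 2 coming from [le_1powR]. *)
Definition dgc (c : R) := (2 * c) `^ ((al - 1)^-1).

Lemma powR_invl (y x : R) : 0 < x -> (x^-1) `^ y = x `^ (- y).
Proof. by move=> x0; rewrite -powR_inv1 ?ltW// -powRrM mulN1r. Qed.

Lemma le_1powR (x : R) : 0 <= x -> 1 + x `^ (al - 1) <= 2 * (1 + x) `^ (al - 1).
Proof.
move=> x0; have a10 : 0 <= al - 1 by rewrite subr_ge0 ltW.
have h1 : 1 <= (1 + x) `^ (al - 1).
  by rewrite -[X in X <= _](powRr0 (1 + x)) ler_powR// lerDl.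
have h2 : x `^ (al - 1) <= (1 + x) `^ (al - 1).
  by apply: (@ge0_ler_powR R _ a10); rewrite ?nnegrE ?lerDr ?addr_ge0.
lra.
Qed.

Lemma mk_dgrowth a b (F : R -> V -> R) (c M : R) (g : R -> R) : a <= b -> 0 <= c ->
  (forall r, is_dual (F r)) -> (forall w, measurable_fun [set: RM] (F ^~ w)) ->
  (forall r, 0 <= g r) -> measurable_fun [set: RM] g -> intg a b (fun r => g r `^ al) ->
  I a b (fun r => g r `^ al) <= M ->
  (forall r w, `|F r w| <= c * (1 + g r `^ (al - 1)) * `|w|) ->
  dgrowth al a b F (fun r => dgc c * (1 + g r)) (dgc c `^ al * (2 `^ al * ((b - a) + M))).
Proof.
move=> ab c0 dF mF g0 mg ig gM Fg.
have a10 : al - 1 != 0 by rewrite subr_eq0 gt_eqF.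
have k0 : 0 <= dgc c by exact: powR_ge0.
have G0 r : 0 <= dgc c * (1 + g r) by rewrite mulr_ge0// addr_ge0.
have GE r : (dgc c * (1 + g r)) `^ al = dgc c `^ al * (1 + g r) `^ al by rewrite powRM// addr_ge0.
have i1 : intg a b (fun r => 2 `^ al * (1 + g r `^ al)) by apply: intgZ; apply: intgD => //; exact: intg_cst.
have G_le r : (1 + g r) `^ al <= 2 `^ al * (1 + g r `^ al).
  by have := powRD_le (ltW al0) ler01 (g0 r); rewrite powR1.
have i2 : intg a b (fun r => (1 + g r) `^ al).
  apply: intg_le i1 => [|r _]; last by rewrite ger0_norm ?powR_ge0.
  by apply: (measurableT_comp (measurable_powR al)); exact: measurable_funD.
split => //.
- move=> r w _; rewrite (le_trans (Fg r w))// ler_wpM2r//.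
  rewrite powRM ?addr_ge0// /dgc -powRrM mulVf// powRr1 ?mulr_ge0//.
  by rewrite [2 * c]mulrC -mulrA ler_wpM2l// le_1powR.
- by under eq_fun do rewrite GE; exact: intgZ.
- under eq_fun do rewrite GE; rewrite IZ// ler_wpM2l ?powR_ge0//.
  rewrite (le_trans (I_le i2 i1 (aeabW (fun r _ => G_le r))))//.
  rewrite IZ ?ler_wpM2l ?powR_ge0//; last by apply: intgD => //; exact: intg_cst.
  by rewrite ID ?I_cst// ?mul1r ?lerD2l//; exact: intg_cst.
Qed.

Definition opB a b M := dgc C `^ al * (2 `^ al * ((b - a) + M)).

Lemma op_dgrowth a b u M : a <= b -> lpV al a b u -> I a b (fun t => `|u t| `^ al) <= M ->
  dgrowth al a b (fun r => A (u r)) (fun r => dgc C * (1 + `|u r|)) (opB a b M).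
Proof.
move=> ab [bu iu] uM; apply: mk_dgrowth => //.
- by move=> w; exact: (measurable_op mo w bu).
- exact: (bmeas_normr bu).
- by move=> r w; exact: (mo_growth mo).
Qed.

Lemma op_intg a b u Y : a <= b -> lpV al a b u -> lpV al a b Y -> intg a b (fun t => A (u t) (Y t)).
Proof. by move=> ab hu hY; exact: (dg_intF hG al1 (op_dgrowth ab hu (lexx _)) hY). Qed.

Lemma lpV_cst a b (w : V) : lpV al a b (fun=> w).
Proof. by apply: lpV_step; exact: isstep_cst. Qed.

(** v j is cut at |v j t| <= L (1 + |p t|). Below the cut, v j t is bounded in V for each t and
    tends to 0 in H, hence weakly in V, and the integrand is dominated. Above it, 1 + |p t| < |v j
    t| / L, so the growth bound yields a multiple of L^(1 - al) |v j t|^al; L is chosen so that L^(1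
    - al) is the tolerance e'. *)
Lemma weak_int_cvg a b (p : R -> V) (v : nat -> R -> V) M : a <= b -> lpV al a b p ->
  (forall j, lpV al a b (v j)) -> (forall j, I a b (fun t => `|v j t| `^ al) <= M) ->
  aeab a b (fun t => i (v j t) @[j --> \oo] --> (0 : H)) ->
  I a b (fun t => A (p t) (v j t)) @[j --> \oo] --> (0 : R).
Proof.
move=> ab hp hv vM v0; have a10 : 0 < al - 1 by rewrite subr_gt0.
have M0 : 0 <= M by apply: le_trans (vM 0%N); apply: I_ge0 => t _; exact: powR_ge0.
apply/cvgrPdist_lt => e e0.
pose e' := e / 2 / (2 * C * M + 1).
have d0 : 0 < 2 * C * M + 1 by rewrite ltr_wpDl// !mulr_ge0.
have e'0 : 0 < e' by rewrite !divr_gt0.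
pose L := e' `^ ((1 - al)^-1).
have L0 : 0 < L by exact: powR_gt0.
have LE : L `^ (1 - al) = e'.
  rewrite /L -powRrM mulVf ?powRr1 ?(ltW e'0)//.
  by rewrite subr_eq0 lt_eqF.
pose good j t := `|v j t| <= L * (1 + `|p t|).
pose v' j t := if `[< good j t >] then v j t else 0.
have mgood j : @measurable _ RM [set t | good j t].
  apply: measurable_leset; first exact: (bmeas_normr (hv j).1).
  apply: measurable_funM; first exact: measurable_cst.
  by apply: measurable_funD; [exact: measurable_cst|exact: (bmeas_normr hp.1)].
have bv' j : bmeas (v' j : RM -> V).
  by apply: (bmeas_if (mgood j)); [exact: (hv j).1|exact: bmeas_cst].
have v'le j t : `|v' j t| <= `|v j t| by rewrite /v'; case: asboolP; rewrite ?normr0.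
have hv' j : lpV al a b (v' j).
  split=> //; apply: intg_le (hv j).2 => [|t _]; first exact: lpV_meas.
  by rewrite ger0_norm ?powR_ge0// ge0_ler_powR ?nnegrE// ltW.
have v'L j t : `|v' j t| <= L * (1 + `|p t|).
  by rewrite /v'; case: asboolP => // _; rewrite normr0 mulr_ge0 ?addr_ge0// ltW.
have [_ c] : intg a b (fun=> 0) /\ I a b (fun t => A (p t) (v' j t)) @[j --> \oo] --> I a b (fun=> 0).
  pose g t := C * 2 * L * (2 `^ al * (1 + `|p t| `^ al)).
  have ig : intg a b g.
    by apply: intgZ; apply: intgZ; apply: intgD; [exact: intg_cst|exact: hp.2].
  apply: (@I_dct _ a b (fun j t => A (p t) (v' j t)) (fun=> 0) g) => //.
  - by move=> j; exact: (op_intg ab hp (hv' j)).1.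
  - apply: aeab_filter v0 => t _ vt.
    have v't : i (v' j t) @[j --> \oo] --> (0 : H).
      apply/cvgr0Pnorm_lt => eps eps0.
      move/cvgr0Pnorm_lt : vt => /(_ eps eps0); apply: filterS => j; rewrite /v'.
      by case: asboolP => // _ _; rewrite (i0 hG) normr0.
    have [w [iw _ /(_ _ (Ad (p t)))]] := weak_cvg hG _ (nearW _ (fun j => v'L j t)) v't.
    have w0 : w = 0 by apply: (i_inj hG); rewrite iw (i0 hG).
    by rewrite w0 (dual0 (Ad _)).
  - apply: aeabW => t _ j; rewrite (le_trans (mo_growth mo _ _))//.
    rewrite (@le_trans _ _ (C * (2 * (1 + `|p t|) `^ (al - 1)) * (L * (1 + `|p t|))))//.
      by rewrite ler_pM ?mulr_ge0 ?addr_ge0 ?powR_ge0// ler_wpM2l// le_1powR.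
    have := powRD_le (ltW al0) ler01 (normr_ge0 (p t)); rewrite powR1 => h.
    have h1 := mulr_powRB1 (addr_ge0 ler01 (normr_ge0 (p t))) al0.
    rewrite /g (_ : C * (2 * (1 + `|p t|) `^ (al - 1)) * (L * (1 + `|p t|)) =
      C * 2 * L * ((1 + `|p t|) * (1 + `|p t|) `^ (al - 1))); last by ring.
    by rewrite h1 ler_wpM2l ?mulr_ge0// ltW.
rewrite I_cst// mul0r in c.
have bad j : `|I a b (fun t => A (p t) (v j t - v' j t))| <= 2 * C * M * e'.
  have i1 := intgZ (2 * C * e') (hv j).2.
  have h := @I_abs_le _ a b _ _ (op_intg ab hp (lpVB hG al1 (hv j) (hv' j))).1 i1.
  rewrite (le_trans (h _))//; last first.
    rewrite IZ; last exact: (hv j).2.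
    have := vM j; have : 0 <= 2 * C * e' by apply: mulr_ge0; [exact: mulr_ge0|exact: ltW].
    by move=> h1 h2; have := ler_wpM2l h1 h2; rewrite [X in _ <= X -> _]mulrAC.
  move=> t _; rewrite /v'; case: asboolP => gd.
    rewrite subrr (dual0 (Ad _)) normr0; apply: mulr_ge0; last exact: powR_ge0.
    by apply: mulr_ge0; [exact: mulr_ge0|exact: ltW].
  rewrite subr0 (le_trans (mo_growth mo _ _))//.
  have p1 : 1 + `|p t| <= `|v j t| / L.
    by rewrite ler_pdivlMr// mulrC ltW// ltNge; apply/negP.
  have h2 : (1 + `|p t|) `^ (al - 1) <= (`|v j t| / L) `^ (al - 1).
    apply: (ge0_ler_powR (ltW a10)) => //; rewrite nnegrE ?addr_ge0//.
    by apply: divr_ge0 => //; exact: ltW.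
  have h3 : (`|v j t| / L) `^ (al - 1) = `|v j t| `^ (al - 1) * e'.
    rewrite powRM ?invr_ge0 ?(ltW L0)// -LE; congr (_ * _).
    by rewrite (powR_invl _ L0) opprB.
  have h4 := mulr_powRB1 (normr_ge0 (v j t)) al0.
  have h5 := le_1powR (normr_ge0 (p t)).
  have h6 : 1 + `|p t| `^ (al - 1) <= 2 * (`|v j t| `^ (al - 1) * e').
    by rewrite -h3 (le_trans h5)// ler_wpM2l.
  rewrite (@le_trans _ _ (C * (2 * (`|v j t| `^ (al - 1) * e')) * `|v j t|))//.
    by rewrite ler_wpM2r// ler_wpM2l.
  by rewrite -h4 le_eqVlt; apply/orP; left; apply/eqP; ring.
have e2 : 0 < e / 2 by rewrite divr_gt0.
move/cvgr0Pnorm_lt : c => /(_ _ e2); apply: filterS => j hj.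
rewrite sub0r normrN.
have -> : I a b (fun t => A (p t) (v j t)) =
    I a b (fun t => A (p t) (v j t - v' j t)) + I a b (fun t => A (p t) (v' j t)).
  rewrite -ID; [|exact: op_intg ab hp (lpVB hG al1 (hv j) (hv' j))|exact: op_intg ab hp (hv' j)].
  by congr I; apply/funext => t; rewrite -(dualD (Ad _)) subrK.
rewrite (le_lt_trans (ler_normD _ _))// (splitr e) ler_ltD// (le_trans (bad j))//.
rewrite (@le_trans _ _ ((2 * C * M + 1) * e'))//; first by rewrite ler_pM2r// lerDl.
by rewrite /e' mulrC mulfVK// gt_eqF.
Qed.

(** By [I_fatou] almost every t admits a subsequence along which u j t is bounded in V. By
    [weak_cvg] its limit in H comes from a vector of V, and the power al of the norm of that vector
    is controlled by an integrable function. *)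
Lemma fatou_range a b (u : nat -> R -> V) (h : R -> H) M : continuous h ->
  (forall j, lpV al a b (u j)) -> (forall j, I a b (fun t => `|u j t| `^ al) <= M) ->
  forall N, lpV al a b N ->
  aeab a b (fun t => i (u j t) @[j --> \oo] --> h t + i (N t)) ->
  aeab a b (fun t => range i (h t)) /\ lpV al a b (fun t => iinv i (h t)).
Proof.
move=> ch hu uM N hN uh.
have [g [ig g0 _ gae]] := @I_fatou _ a b (fun j t => `|u j t| `^ al) M (fun j => (hu j).2)
  (fun j t => powR_ge0 _ _) uM.
have key : aeab a b (fun t => exists v, i v = h t /\ `|v| `^ al <= 2 `^ al * (g t + 1 + `|N t| `^ al)).
  apply: aeab2 gae uh => t _ gt ut.
  have [n hn] := choice (fun k : nat => (let: ex_intro2 n h1 h2 := gt 1 ltr01 k in ex_intro (fun n => (k <= n)%N /\ `|u n t| `^ al <= g t + 1) n (conj h1 h2))).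
  pose M' := (g t + 1) `^ al^-1.
  have g1 : 0 <= g t + 1 by rewrite addr_ge0.
  have bd k : `|u (n k) t| <= M'.
    rewrite -(@powRr1 _ `|u (n k) t|)// -(divff (lt0r_neq0 al0)) powRrM.
    by rewrite ge0_ler_powR ?nnegrE ?powR_ge0 ?invr_ge0 ?(ltW al0)//; exact: (hn k).2.
  have ct : i (u (n k) t) @[k --> \oo] --> h t + i (N t).
    apply/cvgrPdist_lt => eps eps0; move/cvgrPdist_lt : ut => /(_ _ eps0)[m _ hm].
    by exists m => // k /= mk; apply: hm => /=; rewrite (leq_trans mk)//; exact: (hn k).1.
  have [v [iv vM _]] := weak_cvg hG _ (nearW _ bd) ct.
  exists (v - N t); split; first by rewrite (iB hG) iv addrK.
  rewrite (@le_trans _ _ ((`|v| + `|N t|) `^ al))//.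
    by rewrite ge0_ler_powR ?nnegrE ?addr_ge0 ?(ltW al0)// ler_normB.
  rewrite (le_trans (powRD_le (ltW al0) _ _))// ler_wpM2l ?powR_ge0// lerD2r.
  rewrite (@le_trans _ _ (M' `^ al))//; first by rewrite ge0_ler_powR ?nnegrE ?powR_ge0 ?(ltW al0).
  by rewrite /M' -powRrM mulVf ?gt_eqF// powRr1.
split; first by apply: aeab_filter key => t _ [v [<- _]]; exists v.
have bh : bmeas ((fun t => iinv i (h t)) : RM -> V) by apply: (bmeas_iinv hG); exact: bmeas_continuous.
split => //; apply: (intg_le_ae (lpV_meas _ bh)
  (intgZ (2 `^ al) (intgD (intgD ig (intg_cst a b 1)) hN.2))).
apply: aeab_filter key => t _ [v [<- hv]].
by rewrite (iinvK hG) ger0_norm ?powR_ge0.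
Qed.


(* Minty's trick: test monotonicity of A against the limit u = iinv i Z + N shifted
   by th *: w, pass to the limit in j, divide by th and let th tend to 0. *)
Lemma minty_limit a b (Zj : nat -> R -> H) (uj : nat -> R -> V) Z N M : a <= b ->
  (forall j, evol ip i a b (Zj j) (fun r => A (uj j r))) -> (forall j, lpV al a b (uj j)) ->
  (forall j, I a b (fun t => `|uj j t| `^ al) <= M) ->
  (forall j, continuous (Zj j)) -> continuous Z ->
  (forall e, 0 < e -> exists J, forall j, (J <= j)%N -> forall t, a <= t <= b -> `|Zj j t - Z t| <= e) ->
  lpV al a b N -> intg a b (fun t => `|i (N t)| ^+ 2) ->
  aeab a b (fun t => i (uj j t) @[j --> \oo] --> Z t + i (N t)) ->
  (forall j, intg a b (fun t => `|i (uj j t) - (Z t + i (N t))| ^+ 2)) ->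
  I a b (fun t => `|i (uj j t) - (Z t + i (N t))| ^+ 2) @[j --> \oo] --> (0 : R) ->
  (forall e, 0 < e -> exists J, forall j, (J <= j)%N ->
    `|Z b| ^+ 2 - `|Z a| ^+ 2 - e <= 2 * I a b (fun t => A (uj j t) (uj j t - N t))) ->
  forall w, ip (Z b - Z a) (i w) = I a b (fun t => A (iinv i (Z t) + N t) w).
Proof.
move=> ab eZ hu uM cZj cZ ZZ hN iN2 ua iu2 u2 en.
have [rZ hZv] := fatou_range cZ hu uM hN ua.
pose u t := iinv i (Z t) + N t; have hlu : lpV al a b u by exact: (lpVD hG al1 hZv hN).
have uE : aeab a b (fun t => i (u t) = Z t + i (N t)).
  by apply: aeab_filter rZ => t _ r; rewrite /u (iD hG) (i_iinv hG).
have dg j := op_dgrowth ab (hu j) (uM j).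
have YZ : aeab a b (fun t => i (iinv i (Z t)) = Z t).
  by apply: aeab_filter rZ => t _ r; rewrite (i_iinv hG).
have Zba w : ip (Zj j b - Zj j a) (i w) @[j --> \oo] --> ip (Z b - Z a) (i w).
  have c t : a <= t <= b -> Zj j t @[j --> \oo] --> Z t.
    move=> tab; apply/cvgrPdist_le => eps eps0; have [J hJ] := ZZ _ eps0.
    by exists J => // j /= Jj; rewrite distrC hJ.
  apply: (cvg_ip hG); last exact: cvg_cst.
  by apply: cvgB; apply: c; rewrite lexx ab.
(* The limit in j, already divided by th: [en] bounds A u_j tested with u_j - N from below,
   [energy_le] bounds A u_j tested with iinv i Z from above, and [weak_int_cvg] removes A p tested
   with u_j - u. A factor th remains on the right because the shift enters there squared. *)
have half w (th : R) : 0 < th ->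
  ip (Z b - Z a) (i w) - I a b (fun t => A (u t - th *: w) w) <= C * th * `|i w| ^+ 2 * (b - a).
  move=> th0; pose p t := u t - th *: w.
  have hp : lpV al a b p by apply: (lpVB hG al1 hlu); exact: lpV_cst.
  pose M' := 2 `^ al * (M + I a b (fun t => `|u t| `^ al)).
  have hv j := lpVB hG al1 (hu j) hlu.
  have vM j : I a b (fun t => `|uj j t - u t| `^ al) <= M'.
    have i1 := intgZ (2 `^ al) (intgD (hu j).2 hlu.2).
    rewrite (le_trans (I_le (hv j).2 i1 _))//.
      apply: aeabW => t _; rewrite (le_trans _ (powRD_le (ltW al0) (normr_ge0 _) (normr_ge0 _)))//.
      by rewrite ge0_ler_powR ?nnegrE ?addr_ge0 ?(ltW al0)// ler_normB.
    rewrite IZ ?ler_wpM2l ?powR_ge0//; last exact: intgD (hu j).2 hlu.2.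
    by rewrite ID ?lerD2r//; [exact: (hu j).2|exact: hlu.2].
  have v0 : aeab a b (fun t => i (uj j t - u t) @[j --> \oo] --> (0 : H)).
    apply: aeab2 ua uE => t _ h1 h2; rewrite -(subrr (Z t + i (N t))).
    under eq_fun do rewrite (iB hG) h2.
    by apply: cvgB => //; exact: cvg_cst.
  have wk := weak_int_cvg ab hp hv vM v0.
  have hiw := intg_cst a b (2 * (th ^+ 2 * `|i w| ^+ 2)).
  have mono j : 2 * I a b (fun t => A (uj j t) (uj j t - N t)) - 2 * I a b (fun t => A (uj j t) (iinv i (Z t)))
      + 2 * (th * ip (Zj j b - Zj j a) (i w)) - 2 * I a b (fun t => A (p t) (uj j t - u t))
      - 2 * (th * I a b (fun t => A (p t) w)) <=
      C * (2 * I a b (fun t => `|i (uj j t) - (Z t + i (N t))| ^+ 2) + 2 * (th ^+ 2 * `|i w| ^+ 2) * (b - a)).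
    have i1 := op_intg ab (hu j) (lpVB hG al1 (hu j) hN).
    have i2 := op_intg ab (hu j) hZv.
    have i3 := op_intg ab (hu j) (lpV_cst a b w).
    have i4 := op_intg ab hp (hv j).
    have i5 := op_intg ab hp (lpV_cst a b w).
    rewrite eZ// -(IZ th i3) -(IZ th i5) -mulrBr -mulrDr -!mulrBr.
    have j3 := intgZ th i3; have j5 := intgZ th i5.
    rewrite -(IB i1 i2) -(ID (intgB i1 i2) j3) -(IB (intgD (intgB i1 i2) j3) i4).
    rewrite -(IB (intgB (intgD (intgB i1 i2) j3) i4) j5).
    have i6 := intgZ 2 (iu2 j).
    rewrite -(I_cst _ ab) -(IZ 2 (iu2 j)) -(ID i6 hiw) -(IZ C (intgD i6 hiw)).
    have i7 := intgB (intgB (intgD (intgB i1 i2) j3) i4) j5.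
    rewrite -(IZ 2 i7); apply: I_le; [exact: intgZ|by apply: intgZ; exact: intgD|].
    apply: aeab_filter uE => t _ ut.
    have h := mo_mono mo (uj j t) (p t).
    have e1 : A (uj j t) (uj j t - p t) = A (uj j t) (uj j t - N t) - A (uj j t) (iinv i (Z t)) + th * A (uj j t) w.
      by rewrite /p /u !(dualB (Ad _)) !(dualD (Ad _)) (dualZ (Ad _)); ring.
    have e2 : A (p t) (uj j t - p t) = A (p t) (uj j t - u t) + th * A (p t) w.
      by rewrite {2}/p !(dualB (Ad _)) (dualZ (Ad _)); ring.
    rewrite e1 e2 in h.
    have h2 : `|i (uj j t - p t)| ^+ 2 <= 2 * `|i (uj j t) - (Z t + i (N t))| ^+ 2 + 2 * (th ^+ 2 * `|i w| ^+ 2).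
      have -> : i (uj j t - p t) = (i (uj j t) - (Z t + i (N t))) + th *: i w.
        by rewrite /p !(iB hG) (iZ hG) ut opprB addrA addrAC.
      by rewrite (le_trans (normD2_le hG _ _))// lerD2l normrZ exprMn (ger0_norm (ltW th0)).
    have h3 := ler_wpM2l C0 h2.
    by rewrite (le_trans _ h3)// (le_trans _ h)//; lra.
  set x := ip (Z b - Z a) (i w); set y := I a b _; set q := `|i w| ^+ 2 in mono *.
  suff lim : 2 * (th * x) - 2 * (th * y) <= C * (2 * (th ^+ 2 * q) * (b - a)).
    rewrite -(ler_pM2l th0) -(ler_pM2l (ltr0n R 2)); move: lim; congr (_ <= _); ring.
  apply/ler_addgt0Pr => e e0.
  pose c := 16 + 16 * C + 16 * th.
  have c0 : 0 < c by rewrite /c; have := mulr_ge0 (ler0n R 16) C0; lra.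
  pose e' := e / c; have e'0 : 0 < e' by rewrite divr_gt0.
  have ec : e' * c = e by rewrite mulfVK// gt_eqF.
  have [J1 hJ1] := en _ e'0.
  have [J2 hJ2] := energy_le hG al1 ab eZ dg cZj cZ ZZ hZv YZ e'0.
  move/cvgrPdist_lt : (Zba w) => /(_ _ e'0)[J3 _ hJ3].
  move/cvgr0Pnorm_lt : wk => /(_ _ e'0)[J4 _ hJ4].
  move/cvgr0Pnorm_lt : u2 => /(_ _ e'0)[J5 _ hJ5].
  pose j := maxn J1 (maxn J2 (maxn J3 (maxn J4 J5))).
  have k1 := hJ1 j (leq_maxl _ _).
  have k2 := hJ2 j (leq_trans (leq_maxl _ _) (leq_maxr _ _)).
  have k3 := hJ3 j (leq_trans (leq_maxl _ _) (leq_trans (leq_maxr _ _) (leq_maxr _ _))).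
  have k4 := hJ4 j (leq_trans (leq_maxl _ _) (leq_trans (leq_maxr _ _) (leq_trans (leq_maxr _ _) (leq_maxr _ _)))).
  have k5 := hJ5 j (leq_trans (leq_maxr _ _) (leq_trans (leq_maxr _ _) (leq_trans (leq_maxr _ _) (leq_maxr _ _)))).
  have m := mono j.
  move: k3 k4 k5; rewrite /= !ltr_norml -/x => /andP[k31 k32] /andP[k41 k42] /andP[k51 k52].
  have g1 := ler_wpM2l (ltW th0) (ltW k32).
  have g2 := ler_wpM2l C0 (ltW k52).
  rewrite -/y in m.
  have g3 : e = 16 * e' + 16 * (C * e') + 16 * (th * e') by rewrite -ec /c; ring.
  have g4 : 0 <= C * e' by rewrite mulr_ge0// ltW.
  have g5 : 0 <= th * e' by rewrite mulr_ge0// ltW.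
  lra.
have le w : ip (Z b - Z a) (i w) <= I a b (fun t => A (u t) w).
  pose th (n : nat) : R := n.+1%:R^-1.
  have th0 n : 0 < th n by rewrite invr_gt0.
  have th1 n : th n <= 1 by rewrite invf_le1// ler1n.
  have thc : th n @[n --> \oo] --> (0 : R) by exact: cvg_harmonic.
  have [_ c] : intg a b (fun t => A (u t) w) /\ I a b (fun t => A (u t - th n *: w) w) @[n --> \oo] --> I a b (fun t => A (u t) w).
    pose g t := C * (1 + (2 `^ al * (`|u t| `^ al + `|w| `^ al) + 1)) * `|w|.
    have ig : intg a b g.
      rewrite (_ : g = fun t => (C * `|w|) * (1 + (2 `^ al * (`|u t| `^ al + `|w| `^ al) + 1))).
        apply: intgZ; apply: intgD; first exact: intg_cst.
        apply: intgD; last exact: intg_cst.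
        by apply: intgZ; apply: intgD; [exact: hlu.2|exact: intg_cst].
      by apply/funext => t; rewrite /g mulrAC.
    have hw := lpV_cst a b w.
    have hpn n : lpV al a b (fun t => u t - th n *: w) by apply: (lpVB hG al1 hlu); exact: lpV_cst.
    apply: (@I_dct _ a b (fun n t => A (u t - th n *: w) w) (fun t => A (u t) w) g) => //.
    - by move=> n; exact: (op_intg ab (hpn n) hw).1.
    - exact: (op_intg ab hlu hw).1.
    - apply: aeabW => t _.
      have hc : continuous (fun s : R => A (u t + s *: (- w)) w).
        exact: (mo_hemi mo).
      have := hc 0; rewrite /continuous_at scale0r addr0 => hc0.
      have := cvg_comp _ _ thc hc0.
      apply: cvg_trans; apply: near_eq_cvg; apply: nearW => n /=.
      by rewrite scalerN.
    - apply: aeabW => t _ n; rewrite (le_trans (mo_growth mo _ _))// ler_wpM2r// ler_wpM2l// lerD2l.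
      have h1 : `|u t - th n *: w| <= `|u t| + `|w|.
        rewrite (le_trans (ler_normB _ _))// lerD2l normrZ (ger0_norm (ltW (th0 n))).
        by rewrite ler_piMl.
      have h2 : `|u t - th n *: w| `^ al <= 2 `^ al * (`|u t| `^ al + `|w| `^ al).
        rewrite (le_trans _ (powRD_le (ltW al0) (normr_ge0 _) (normr_ge0 _)))//.
        by rewrite ge0_ler_powR ?nnegrE ?addr_ge0 ?(ltW al0).
      apply: le_trans (_ : `|u t - th n *: w| `^ al + 1 <= _); last by rewrite lerD2r.
      have [x1|/ltW x1] := leP `|u t - th n *: w| 1.
        rewrite ler_wpDl ?powR_ge0//.
        have : `|u t - th n *: w| `^ (al - 1) <= 1 `^ (al - 1).
          by rewrite ge0_ler_powR ?nnegrE ?subr_ge0 ?(ltW al1).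
        by rewrite powR1.
      by rewrite ler_wpDr// ler_powR// gerBl.
  have hn n : ip (Z b - Z a) (i w) - C * th n * `|i w| ^+ 2 * (b - a) <= I a b (fun t => A (u t - th n *: w) w).
    by have := half w (th n) (th0 n); lra.
  have c2 : ip (Z b - Z a) (i w) - C * th n * `|i w| ^+ 2 * (b - a) @[n --> \oo] --> ip (Z b - Z a) (i w) - C * 0 * `|i w| ^+ 2 * (b - a).
    apply: cvgB; first exact: cvg_cst.
    apply: cvgM; last exact: cvg_cst.
    apply: cvgM; last exact: cvg_cst.
    by apply: cvgM; [exact: cvg_cst|exact: thc].
  rewrite mulr0 !mul0r subr0 in c2.
  by rewrite -(cvg_lim _ c2)// -(cvg_lim _ c)//; apply: ler_lim; [apply/cvg_ex; eexists; exact: c2|apply/cvg_ex; eexists; exact: c|exact: nearW].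
(* The reverse inequality is the same one for - w. *)
move=> w; apply/eqP; rewrite eq_le le/=.
have := le (- w); rewrite (iN hG) (ipNr hG).
have -> : (fun t => A (u t) (- w)) = (fun t => - A (u t) w) by apply/funext => t; rewrite (dualN (Ad _)).
by rewrite IN ?lerN2//; exact: op_intg ab hlu (lpV_cst a b w).
Qed.

End Core.

(* lra is prohibitively slow with integrals, norms and powers as atoms. *)
Ltac gen_atoms :=
  repeat match goal with |- context [@I ?R ?a ?b ?f] =>
    let x := fresh "x" in set x := (@I R a b f); clearbody x end;
  repeat match goal with |- context [@Num.norm ?R ?V ?v] =>
    let x := fresh "x" in set x := (@Num.norm R V v); clearbody x end;
  repeat match goal with |- context [@powR ?R ?a ?b] =>
    let x := fresh "x" in set x := (@powR R a b); clearbody x end.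

(** * A priori estimates *)

Section UniformLimit.
Variables (R : realType) (H : completeNormedModType R).

(** Times are clamped to [a, b] before the limit is taken, so that a Cauchy condition on [a, b]
    yields a function continuous on the whole line, as [soln] demands. *)
Lemma unif_limit (a b : R) (z : nat -> R -> H) : a <= b -> (forall j, continuous (z j)) ->
  (forall e : R, 0 < e -> exists J, forall j k, (J <= j)%N -> (J <= k)%N ->
     forall t, a <= t <= b -> `|z j t - z k t| <= e) ->
  exists Z : R -> H, continuous Z /\ forall e : R, 0 < e -> exists J, forall j, (J <= j)%N ->
    forall t, a <= t <= b -> `|z j t - Z t| <= e.
Proof.
move=> ab cz cau.
have ex t : exists l : H, z j (cl a b t) @[j --> \oo] --> l.
  have : cvg (z j (cl a b t) @[j --> \oo]).
    apply/cauchy_cvgP/cauchy_ballP => e e0.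
    have e2 : 0 < e / 2 by rewrite divr_gt0.
    have [J hJ] := cau _ e2.
    exists ([set z j (cl a b t) | j in [set j | (J <= j)%N]], [set z j (cl a b t) | j in [set j | (J <= j)%N]]).
      by split; exists J => // j /= Jj; exists j.
    move=> [x y] [/= [j Jj <-] [k Jk <-]]; rewrite -ball_normE /=.
    by rewrite (le_lt_trans (hJ j k Jj Jk _ (cl_itv t ab)))// ltr_pdivrMr// ltr_pMr// ltr1n.
  by move=> /cvg_ex.
have [Z hZ] := choice ex.
have unif e : 0 < e -> exists J, forall j, (J <= j)%N -> forall t, `|z j (cl a b t) - Z t| <= e.
  move=> e0; have [J hJ] := cau _ e0; exists J => j Jj t.
  have c : `|z j (cl a b t) - z k (cl a b t)| @[k --> \oo] --> `|z j (cl a b t) - Z t|.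
    by apply: cvg_norm; apply: cvgB; [exact: cvg_cst|exact: hZ].
  rewrite -(cvg_lim _ c)//; apply: limr_le; first by apply/cvg_ex; eexists; exact: c.
  by exists J => // k /= Jk; apply: hJ => //; exact: cl_itv.
exists Z; split; last first.
  by move=> e /unif[J hJ]; exists J => j Jj t tab; have := hJ j Jj t; rewrite (cl_id tab).
move=> t; apply/cvgrPdist_le => e e0; have e3 : 0 < e / 3 by rewrite divr_gt0.
have [J hJ] := unif _ e3.
have cJ : continuous (fun s => z J (cl a b s)).
  by move=> s; apply: (@continuous_comp _ _ _ (cl a b) (z J)); [exact: cl_continuous|exact: cz].
have /cvgrPdist_le/(_ _ e3) := cJ t; apply: filterS => s hs.
have h1 := hJ J (leqnn J) t; have h2 := hJ J (leqnn J) s.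
rewrite -(subrK (z J (cl a b t)) (Z t)) -addrA (le_trans (ler_normD _ _))//.
have h3 : `|z J (cl a b t) - Z s| <= `|z J (cl a b t) - z J (cl a b s)| + `|z J (cl a b s) - Z s|.
  by rewrite -{1}(subrK (z J (cl a b s)) (z J (cl a b t))) -addrA ler_normD.
rewrite distrC in h1; lra.
Qed.

End UniformLimit.

Section Estimates.
Variables (R : realType) (V H : completeNormedModType R) (ip : H -> H -> R) (i : V -> H).
Variables (A : V -> V -> R) (al delta K C : R).
Hypothesis mo : monotone_op ip i A al delta K C.
Notation RM := (measurableTypeR R).
Let hG := mo_gel mo.
Let Ad := mo_dual mo.
Let al1 := mo_alpha mo.
Let al0 := mo_alpha0 mo.
Let C0 := mo_C0 mo.
Implicit Types (a b s t e M : R) (Z : R -> H) (N : R -> V) (z : H).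

Record noise a b N : Prop := Noise {
  no_lp : lpV al a b N;
  no_sq : intg a b (fun t => `|i (N t)| ^+ 2) }.

(* The V-valued version of Z is always taken to be the function iinv i (Z t). *)
Record soln a b N z Z : Prop := Soln {
  so_cont : continuous Z;
  so_init : Z a = z;
  so_range : aeab a b (fun t => range i (Z t));
  so_lp : intg a b (fun t => `|iinv i (Z t)| `^ al);
  so_evol : evol ip i a b Z (fun r => A (iinv i (Z r) + N r)) }.

Lemma noiseS a b c d N : a <= c -> d <= b -> noise a b N -> noise c d N.
Proof. by move=> ac db [h1 h2]; split; [exact: lpVS h1|exact: intgS h2]. Qed.

Lemma bmeas_norm2 N : bmeas (N : RM -> V) -> measurable_fun [set: RM] (fun t => `|i (N t)| ^+ 2).
Proof.
move=> bN; have h := bmeas_normr (bmeas_i hG bN).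
by under eq_fun do rewrite expr2; exact: measurable_funM.
Qed.

Lemma noiseD a b N N' : noise a b N -> noise a b N' -> noise a b (fun t => N t + N' t).
Proof.
move=> [h1 h2] [h3 h4]; have h5 := lpVD hG al1 h1 h3; split=> //.
apply: (intg_le (bmeas_norm2 h5.1) _ (intgD (intgZ 2 h2) (intgZ 2 h4))) => t _.
by rewrite ger0_norm ?sqr_ge0// (iD hG) (normD2_le hG).
Qed.

Lemma noiseN a b N : noise a b N -> noise a b (fun t => - N t).
Proof.
move=> [h1 h2]; split; first exact: lpVN.
by under eq_fun do rewrite (iN hG) normrN.
Qed.

Lemma noiseB a b N N' : noise a b N -> noise a b N' -> noise a b (fun t => N t - N' t).
Proof. by move=> h1 h2; apply: noiseD => //; exact: noiseN. Qed.

Lemma noise_step a b f : isstep f -> noise a b f.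
Proof.
move=> sf; split; first exact: lpV_step.
have [M hM] := isstep_bounded (fun v => `|i v| ^+ 2) sf.
apply: (intg_le (bmeas_norm2 (isstep_bmeas sf)) _ (intg_cst a b M)) => t _.
by rewrite ger0_norm ?sqr_ge0.
Qed.

Lemma so_bmeas a b N z Z : soln a b N z Z -> bmeas ((fun t => iinv i (Z t)) : RM -> V).
Proof. by move=> hs; apply: (bmeas_iinv hG); apply: bmeas_continuous; exact: so_cont hs. Qed.

Lemma so_lpV a b N z Z : soln a b N z Z -> lpV al a b (fun t => iinv i (Z t)).
Proof. by move=> hs; split; [exact: so_bmeas hs|exact: so_lp hs]. Qed.

Lemma so_u a b N z Z : noise a b N -> soln a b N z Z -> lpV al a b (fun t => iinv i (Z t) + N t).
Proof. by move=> hN hs; apply: (lpVD hG al1 (so_lpV hs)); exact: no_lp hN. Qed.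

Lemma so_iinv a b N z Z : soln a b N z Z -> aeab a b (fun t => i (iinv i (Z t)) = Z t).
Proof. by move=> hs; apply: aeab_filter (so_range hs) => t _ r; rewrite (i_iinv hG). Qed.

Lemma sqr_cont Z : continuous Z -> continuous (fun t => `|Z t| ^+ 2).
Proof. by move=> cZ t; under eq_fun do rewrite expr2; apply: cvgM; apply: cvg_norm; exact: cZ. Qed.

(** With u = Z + N, A u is tested with Z = u - N. Coercivity supplies delta |u|^al, and ze is chosen
    so that the noise term consumes only half of it. Gronwall's inequality bounds |Z|^2, after which
    the other half of delta bounds the integral of |u|^al. *)
Lemma est1 a b M0 : a <= b -> 0 <= M0 -> exists Bd, forall N z Z, noise a b N -> soln a b N z Z ->
  `|z| ^+ 2 <= M0 -> I a b (fun t => `|N t| `^ al) <= M0 -> I a b (fun t => `|i (N t)| ^+ 2) <= M0 ->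
  I a b (fun t => `|iinv i (Z t) + N t| `^ al) <= Bd.
Proof.
move=> ab M00; have d0 := mo_delta mo.
pose ze := delta / 4 / (C + 1).
have C1 : 0 < C + 1 by rewrite ltr_wpDl.
have ze0 : 0 < ze by rewrite !divr_gt0.
have Cze : C * ze <= delta / 4.
  by rewrite /ze mulrCA ler_piMr ?divr_ge0 ?(ltW d0)// ler_pdivrMr// mul1r lerDl.
pose k := 2 * C + 2 * C * ze `^ (1 - al); pose c1 := C + 2 * C.
have p0 : 0 <= ze `^ (1 - al) by exact: powR_ge0.
have k0 : 0 <= k by rewrite /k; have := mulr_ge0 C0 p0; have := C0; lra.
have c10 : 0 <= c1 by rewrite /c1; have := C0; lra.
pose Q := M0 + c1 * (b - a) + 2 * `|K| * M0 + k * M0.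
pose X := Q * expR (2 * `|K| * (b - a)).
exists ((Q + 2 * `|K| * (X * (b - a))) / (delta / 2)) => N z Z hN hs zM NM iNM.
have ba : 0 <= b - a by rewrite subr_ge0.
have KK : 0 <= 2 * `|K| by rewrite mulr_ge0.
have Q0 : 0 <= Q by rewrite /Q !addr_ge0 ?mulr_ge0.
pose u t := iinv i (Z t) + N t.
have hu : lpV al a b u by exact: so_u hN hs.
have main t : a <= t <= b -> `|Z t| ^+ 2 + delta / 2 * I a t (fun r => `|u r| `^ al) <=
    Q + 2 * `|K| * I a t (fun r => `|Z r| ^+ 2).
  move=> /andP[at_ tb].
  have hut := lpVS (lexx a) tb hu.
  have hZt := lpVS (lexx a) tb (so_lpV hs).
  have [hNt hNt2] := noiseS (lexx a) tb hN.
  have ev : evol ip i a t Z (fun r => A (u r)).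
    by move=> r s w ar rs st; apply: (so_evol hs) => //; exact: le_trans tb.
  have en := energy_eq hG al1 at_ ev (op_dgrowth mo at_ hut (lexx _)) (so_cont hs) hZt
    (aeabS (lexx a) tb (so_iinv hs)).
  have i1 := op_intg mo at_ hut hZt.
  have iZ2 : intg a t (fun r => `|Z r| ^+ 2) by apply: intg_cont; exact: sqr_cont (so_cont hs).
  have j1 := intg_cst a t c1; have j2 := intgZ (2 * `|K|) iZ2; have j3 := intgZ (2 * `|K|) hNt2.
  have j4 := intgZ k hNt.2; have j5 := intgZ (delta / 2) hut.2.
  have j12 := intgD j1 j2; have j123 := intgD j12 j3; have j1234 := intgD j123 j4.
  have le1 : 2 * I a t (fun r => A (u r) (iinv i (Z r))) <=
      I a t (fun r => c1 + 2 * `|K| * `|Z r| ^+ 2 + 2 * `|K| * `|i (N r)| ^+ 2 + k * `|N r| `^ al - delta / 2 * `|u r| `^ al).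
    rewrite -(IZ 2 i1); apply: I_le; [exact: intgZ|exact: intgB j1234 j5|].
    apply: aeab_filter (aeabS (lexx a) tb (so_iinv hs)) => r _ iZr.
    have e1 : A (u r) (iinv i (Z r)) = A (u r) (u r) - A (u r) (N r).
      by rewrite -(dualB (Ad _)) /u addrK.
    have h1 := mo_coer mo (u r).
    have h2 := le_trans (ler_norm _) (mo_growth mo (u r) (- N r)); rewrite (dualN (Ad _)) normrN in h2.
    have h3 := powR_youngl al1 (normr_ge0 (u r)) (normr_ge0 (N r)) ze0.
    have h4 : `|i (u r)| ^+ 2 <= 2 * `|Z r| ^+ 2 + 2 * `|i (N r)| ^+ 2.
      by rewrite /u (iD hG) iZr (normD2_le hG).
    have h5 : K * `|i (u r)| ^+ 2 <= `|K| * `|i (u r)| ^+ 2 by rewrite ler_wpM2r ?sqr_ge0// ler_norm.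
    have h6 := ler_wpM2l (normr_ge0 K) h4.
    have h7 := ler_wpM2l C0 h3.
    have h8 := ler_wpM2r (powR_ge0 `|u r| al) Cze.
    have h9 := ler_wpM2l C0 (le_powR1 (ltW al1) (normr_ge0 (N r))).
    rewrite e1 /k /c1.
    set W := `|u r| `^ al in h1 h3 h7 h8 *; set P := `|u r| `^ (al - 1) in h2 h3 h7.
    set n := `|N r| `^ al in h3 h7 h9 *; set q := ze `^ (1 - al) in h3 h7 *.
    nra.
  rewrite (IB j1234 j5) (ID j123 j4) (ID j12 j3) (ID j1 j2) (IZ _ iZ2) (IZ _ hNt2) (IZ _ hNt.2) (IZ _ hut.2) I_cst// in le1.
  rewrite (so_init hs) in en.
  have s1 : I a t (fun r => `|i (N r)| ^+ 2) <= M0.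
    apply: le_trans iNM; apply: I_sub; [exact: lexx|exact: tb|exact: no_sq hN|by move=> r _; exact: sqr_ge0].
  have s2 : I a t (fun r => `|N r| `^ al) <= M0.
    apply: le_trans NM; apply: I_sub; [exact: lexx|exact: tb|exact: (no_lp hN).2|by move=> r _; exact: powR_ge0].
  have s3 := ler_wpM2l KK s1; have s4 := ler_wpM2l k0 s2.
  have s5 : c1 * (t - a) <= c1 * (b - a) by rewrite ler_wpM2l// lerD2r.
  rewrite /Q; move: en le1 s3 s4 s5 zM; gen_atoms; clear -mo hG Ad al1 al0 C0; lra.
have u0 t : 0 <= delta / 2 * I a t (fun r => `|u r| `^ al).
  by rewrite mulr_ge0 ?divr_ge0 ?(ltW d0)// I_ge0// => r _; exact: powR_ge0.
have gr1 t : a <= t <= b -> `|Z t| ^+ 2 <= Q + 2 * `|K| * I a t (fun r => `|Z r| ^+ 2).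
  by move=> tab; apply: le_trans (main t tab); rewrite lerDl.
have gr t : a <= t <= b -> `|Z t| ^+ 2 <= X.
  move=> tab; apply: (le_trans (gronwall (sqr_cont (so_cont hs)) KK gr1 tab)).
  rewrite ler_wpM2l// ler_expR ler_wpM2l// lerD2r; by case/andP: tab.
have := main b; rewrite ab lexx => /(_ isT) hb.
have hX : I a b (fun r => `|Z r| ^+ 2) <= X * (b - a).
  rewrite -I_cst//; apply: I_le; [apply: intg_cont; exact: sqr_cont (so_cont hs)|exact: intg_cst|exact: aeabW].
rewrite ler_pdivlMr ?divr_gt0// mulrC.
move: hb (ler_wpM2l KK hX) (sqr_ge0 `|Z b|); clearbody X Q; gen_atoms; clear -mo hG Ad al1 al0 C0; lra.
Qed.

Definition opB2 a b M := dgc al (2 * C) `^ al * (2 `^ al * ((b - a) + 2 `^ al * (M + M))).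

Lemma diff_dgrowth a b u u' Bd : a <= b -> lpV al a b u -> lpV al a b u' ->
  I a b (fun t => `|u t| `^ al) <= Bd -> I a b (fun t => `|u' t| `^ al) <= Bd ->
  dgrowth al a b (fun r w => A (u r) w - A (u' r) w)
    (fun r => dgc al (2 * C) * (1 + (`|u r| + `|u' r|))) (opB2 a b Bd).
Proof.
move=> ab hu hu' uB uB'.
pose F r w := A (u r) w - A (u' r) w.
have dF r : is_dual (F r).
  have := is_dual_lin (-1) (Ad (u' r)) (Ad (u r)).
  by congr is_dual; apply/funext => w; rewrite /F mulN1r addrC.
have mF w : measurable_fun [set: RM] (F ^~ w).
  by apply: measurable_funB; [exact: (measurable_op mo w hu.1)|exact: (measurable_op mo w hu'.1)].
pose g t := `|u t| + `|u' t|.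
have g0 t : 0 <= g t by rewrite addr_ge0.
have mg : measurable_fun [set: RM] g.
  by apply: measurable_funD; [exact: (bmeas_normr hu.1)|exact: (bmeas_normr hu'.1)].
have ig1 := intgZ (2 `^ al) (intgD hu.2 hu'.2).
have gle t : g t `^ al <= 2 `^ al * (`|u t| `^ al + `|u' t| `^ al).
  exact: powRD_le (ltW al0) (normr_ge0 _) (normr_ge0 _).
have ig : intg a b (fun t => g t `^ al).
  apply: intg_le ig1 => [|t _]; last by rewrite ger0_norm ?powR_ge0.
  by apply: (measurableT_comp (measurable_powR al)).
have gB : I a b (fun t => g t `^ al) <= 2 `^ al * (Bd + Bd).
  apply: (le_trans (I_le ig ig1 (aeabW (fun t _ => gle t)))).
  rewrite IZ ?ler_wpM2l ?powR_ge0//; last exact: intgD hu.2 hu'.2.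
  by rewrite ID; [exact: lerD uB uB'|exact: hu.2|exact: hu'.2].
have C20 : 0 <= 2 * C by rewrite mulr_ge0.
have a10 : 0 <= al - 1 by rewrite subr_ge0 ltW.
have Fg r w : `|F r w| <= 2 * C * (1 + g r `^ (al - 1)) * `|w|.
  rewrite (le_trans (ler_normB _ _))// (le_trans (lerD (mo_growth mo _ _) (mo_growth mo _ _)))//.
  rewrite -mulrDl ler_wpM2r// -mulrDr.
  have q1 : `|u r| `^ (al - 1) <= g r `^ (al - 1).
    by apply: (@ge0_ler_powR R _ a10); rewrite ?nnegrE ?lerDl.
  have q2 : `|u' r| `^ (al - 1) <= g r `^ (al - 1).
    by apply: (@ge0_ler_powR R _ a10); rewrite ?nnegrE ?lerDr.
  rewrite [2 * C]mulrC -mulrA; apply: ler_wpM2l => //; move: q1 q2; gen_atoms; clear -mo hG Ad al1 al0 C0; lra.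
exact (mk_dgrowth mo ab C20 dF mF g0 mg ig gB Fg).
Qed.

(** Monotonicity is used with u - u' = (Z - Z') + (N - N'). The contribution of the noises is kept
    as an abstract bound q because it is estimated in two ways: by Young's inequality in [est2], and
    by a bound of A u in H in [soln_domain]. *)
Lemma est2_raw a b N N' z z' Z Z' q : a <= b -> noise a b N -> noise a b N' ->
  soln a b N z Z -> soln a b N' z' Z' ->
  (forall t, a <= t <= b -> 2 * C * I a t (fun r => `|i (N r - N' r)| ^+ 2) +
     2 * I a t (fun r => A (iinv i (Z r) + N r) (- (N r - N' r)) -
                         A (iinv i (Z' r) + N' r) (- (N r - N' r))) <= q) ->
  forall t, a <= t <= b -> `|Z t - Z' t| ^+ 2 <= (`|z - z'| ^+ 2 + q) * expR (2 * C * (b - a)).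
Proof.
move=> ab hN hN' hs hs' hq.
pose u t := iinv i (Z t) + N t; pose u' t := iinv i (Z' t) + N' t.
have hu : lpV al a b u by exact: so_u hN hs.
have hu' : lpV al a b u' by exact: so_u hN' hs'.
have hD := noiseB hN hN'.
pose F r w := A (u r) w - A (u' r) w.
pose Bd := Num.max (I a b (fun t => `|u t| `^ al)) (I a b (fun t => `|u' t| `^ al)).
have C20 : 0 <= 2 * C by rewrite mulr_ge0.
have [uB uB'] : I a b (fun t => `|u t| `^ al) <= Bd /\ I a b (fun t => `|u' t| `^ al) <= Bd.
  by split; rewrite le_max; apply/orP; [left|right].
have dg : dgrowth al a b F _ _ := diff_dgrowth ab hu hu' uB uB'; have dF r : is_dual (F r) := dg_dual dg r.
pose D t := Z t - Z' t.
have cD : continuous D by move=> t; apply: cvgB; [exact: so_cont hs t|exact: so_cont hs' t].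
have evD : evol ip i a b D F.
  move=> s t w as_ st tb.
  have -> : D t - D s = (Z t - Z s) - (Z' t - Z' s) by rewrite /D !opprB addrACA [RHS]addrACA; congr (_ + _); rewrite addrC.
  rewrite (ipBl hG) (so_evol hs)// (so_evol hs')// /F IB//.
  - by apply: (op_intg mo st); [exact: lpVS hu|exact: lpV_cst].
  - by apply: (op_intg mo st); [exact: lpVS hu'|exact: lpV_cst].
pose Y t := iinv i (Z t) - iinv i (Z' t).
have hY : lpV al a b Y by apply: (lpVB hG al1); [exact: so_lpV hs|exact: so_lpV hs'].
have YD : aeab a b (fun t => i (Y t) = D t).
  by apply: aeab2 (so_iinv hs) (so_iinv hs') => t _ h1 h2; rewrite /Y (iB hG) h1 h2.
have main t : a <= t <= b -> `|D t| ^+ 2 <= `|z - z'| ^+ 2 + q + 2 * C * I a t (fun r => `|D r| ^+ 2).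
  move=> /andP[at_ tb].
  have dgt := dgrowthS (lexx a) tb dg.
  have ev : evol ip i a t D F.
    by move=> r s w ar rs st; apply: evD => //; exact: le_trans tb.
  have hYt := lpVS (lexx a) tb hY.
  have en := energy_eq hG al1 at_ ev dgt cD hYt (aeabS (lexx a) tb YD).
  have hDt := noiseS (lexx a) tb hD.
  have b1 := hq t; rewrite at_ tb in b1; have {}b1 := b1 isT.
  have iD2 : intg a t (fun r => `|D r| ^+ 2) by apply: intg_cont; exact: sqr_cont.
  have i1 := dg_intF hG al1 dgt (lpVN (no_lp hDt)).
  have i2 := intgZ (2 * C) iD2; have i3 := intgZ (2 * C) (no_sq hDt).
  have i4 := intgZ 2 i1.
  have le1 : 2 * I a t (fun r => F r (Y r)) <= I a t (fun r => 2 * C * `|D r| ^+ 2 + 2 * C * `|i (N r - N' r)| ^+ 2 + 2 * F r (- (N r - N' r))).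
    have iFY := dg_intF hG al1 dgt hYt.
    rewrite -(IZ 2 iFY); apply: I_le; [exact: intgZ|by apply: intgD => //; exact: intgD|].
    apply: aeab_filter (aeabS (lexx a) tb YD) => r _ Yr.
    have uu : u r - u' r = Y r + (N r - N' r) by rewrite /u /u' /Y opprD addrACA.
    have h := mo_mono mo (u r) (u' r).
    have e1 : A (u r) (u r - u' r) - A (u' r) (u r - u' r) = F r (Y r) - F r (- (N r - N' r)).
      by rewrite (dualN (dF r)) opprK -(dualD (dF r)) -uu.
    have h2 : `|i (u r - u' r)| ^+ 2 <= 2 * `|D r| ^+ 2 + 2 * `|i (N r - N' r)| ^+ 2.
      by rewrite uu (iD hG) Yr (normD2_le hG).
    rewrite e1 in h; have h3 := ler_wpM2l C0 h2; move: h h3.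
    set y1 := F r (Y r); set y2 := F r (- _); clearbody y1 y2; gen_atoms; clear -mo hG Ad al1 al0 C0; lra.
  rewrite (ID (intgD i2 i3) i4) (ID i2 i3) (IZ _ iD2) (IZ _ (no_sq hDt)) (IZ _ i1) in le1.
  have Da : D a = z - z' by rewrite /D (so_init hs) (so_init hs').
  rewrite Da in en.
  move: b1 en le1; rewrite -/u -/u'; under [X in _ + 2 * I _ _ X]eq_fun do rewrite -/(u _) -/(u' _) -/(F _ _).
  gen_atoms; clear -mo hG Ad al1 al0 C0; lra.
move=> t tab; have gr := gronwall (sqr_cont cD) C20 main tab.
apply: (le_trans gr); rewrite ler_wpM2l//; last first.
  rewrite ler_expR ler_wpM2l// lerD2r; by case/andP: tab.
have := main a; rewrite lexx ab I_xx mulr0 addr0 => /(_ isT); apply: le_trans; exact: sqr_ge0.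
Qed.

Lemma est2 a b Bd N N' z z' Z Z' ze : a <= b -> 0 < ze -> noise a b N -> noise a b N' ->
  soln a b N z Z -> soln a b N' z' Z' ->
  I a b (fun t => `|iinv i (Z t) + N t| `^ al) <= Bd ->
  I a b (fun t => `|iinv i (Z' t) + N' t| `^ al) <= Bd ->
  forall t, a <= t <= b -> `|Z t - Z' t| ^+ 2 <=
    (`|z - z'| ^+ 2 + 2 * C * I a b (fun t => `|i (N t - N' t)| ^+ 2) +
     2 * (ze * opB2 a b Bd + ze `^ (1 - al) * I a b (fun t => `|N t - N' t| `^ al))) *
    expR (2 * C * (b - a)).
Proof.
move=> ab ze0 hN hN' hs hs' uB uB'.
have hu := so_u hN hs; have hu' := so_u hN' hs'; have hD := noiseB hN hN'.
have dg := diff_dgrowth ab hu hu' uB uB'.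
have C20 : 0 <= 2 * C by rewrite mulr_ge0.
rewrite -addrA; apply: (est2_raw ab hN hN' hs hs') => t /andP[at_ tb].
have hDt := noiseS (lexx a) tb hD.
have b1 := le_trans (ler_norm _) (dg_bound hG al1 (dgrowthS (lexx a) tb dg) ze0 (lpVN (no_lp hDt))).
have s1 : I a t (fun r => `|i (N r - N' r)| ^+ 2) <= I a b (fun r => `|i (N r - N' r)| ^+ 2).
  apply: I_sub; [exact: lexx|exact: tb|exact: no_sq hD|by move=> r _; exact: sqr_ge0].
have s2 : I a t (fun r => `|- (N r - N' r)| `^ al) <= I a b (fun r => `|N r - N' r| `^ al).
  under eq_fun do rewrite normrN.
  apply: I_sub; [exact: lexx|exact: tb|exact: (no_lp hD).2|by move=> r _; exact: powR_ge0].
apply: lerD; first exact (ler_wpM2l C20 s1).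
have s3 := lerD (lexx (ze * opB2 a b Bd)) (ler_wpM2l (powR_ge0 ze (1 - al)) s2).
exact (ler_wpM2l (ler0n R 2) (le_trans b1 s3)).
Qed.

End Estimates.

(** * Stability and uniqueness *)

Section Closure.
Variables (R : realType) (V H : completeNormedModType R) (ip : H -> H -> R) (i : V -> H).
Variables (A : V -> V -> R) (al delta K C : R).
Hypothesis mo : monotone_op ip i A al delta K C.
Notation RM := (measurableTypeR R).
Let hG := mo_gel mo.
Let Ad := mo_dual mo.
Let al1 := mo_alpha mo.
Let al0 := mo_alpha0 mo.
Let C0 := mo_C0 mo.
Implicit Types (a b s t e M : R) (Z : R -> H) (N : R -> V) (z : H).
Local Notation soln := (soln ip i A al).
Local Notation noise := (noise i al).

(** The summand of [est2] with [opB2] does not vanish as the data approach each other. ze is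
    therefore fixed first to make it small, and eta is then chosen against the factor ze^(1 -
    al). *)
Lemma est2_small a b Bd e : a <= b -> 0 < e -> exists eta, 0 < eta /\ forall N N' z z' Z Z',
  noise a b N -> noise a b N' -> soln a b N z Z -> soln a b N' z' Z' ->
  I a b (fun t => `|iinv i (Z t) + N t| `^ al) <= Bd ->
  I a b (fun t => `|iinv i (Z' t) + N' t| `^ al) <= Bd ->
  `|z - z'| <= eta -> I a b (fun t => `|i (N t - N' t)| ^+ 2) <= eta ->
  I a b (fun t => `|N t - N' t| `^ al) <= eta ->
  forall t, a <= t <= b -> `|Z t - Z' t| <= e.
Proof.
move=> ab e0; pose E := expR (2 * C * (b - a)); have E0 : 0 < E by exact: expR_gt0.
pose B2 := `|opB2 al C a b Bd| + 1; have B20 : 0 < B2 by rewrite ltr_wpDl.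
pose ze := e ^+ 2 / 8 / (E * B2); have e20 : 0 < e ^+ 2 by rewrite exprn_gt0.
have ze0 : 0 < ze by rewrite !divr_gt0// mulr_gt0.
have zeE : ze * (E * B2) = e ^+ 2 / 8 by rewrite mulfVK// gt_eqF// mulr_gt0.
pose q := ze `^ (1 - al); have q0 : 0 <= q by exact: powR_ge0.
pose D := E * (1 + 2 * C + 2 * q).
have D0 : 0 < D by rewrite mulr_gt0//; move: C0 q0; clearbody q; clear -mo hG Ad al1 al0 C0; lra.
pose eta := Num.min 1 (e ^+ 2 / 4 / D).
have eta0 : 0 < eta by rewrite lt_min ltr01 !divr_gt0.
have eta1 : eta <= 1 by rewrite ge_min lexx.
have etaD : eta * D <= e ^+ 2 / 4 by rewrite -ler_pdivlMr// ge_min lexx orbT.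
exists eta; split => // N N' z z' Z Z' hN hN' hs hs' uB uB' zz iNN NN t tab.
have := est2 mo ab ze0 hN hN' hs hs' uB uB' tab.
rewrite -/E -/q; set I1 := I a b _ in iNN *; set I2 := I a b _ in NN *.
set x := `|z - z'| in zz *; set y := `|Z t - Z' t|.
have x0 : 0 <= x by exact: normr_ge0.
have y0 : 0 <= y by exact: normr_ge0.
have oB : opB2 al C a b Bd <= B2 by rewrite ler_wpDr// ler_norm.
set O := opB2 al C a b Bd in oB *.
move=> h; rewrite -(@ler_pXn2r _ 2)// ?nnegrE ?(ltW e0)//.
apply: (le_trans h).
have h1 : ze * O <= ze * B2 by rewrite ler_pM2l.
have h2 : x ^+ 2 <= eta by rewrite expr2 (le_trans (ler_pM x0 x0 zz zz))// ler_piMr// ltW.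
have h3 : 2 * C * I1 <= 2 * C * eta by rewrite ler_wpM2l// mulr_ge0.
have h4 : q * I2 <= q * eta by rewrite ler_wpM2l.
have h5 : x ^+ 2 + 2 * C * I1 + 2 * (ze * O + q * I2) <= eta * (1 + 2 * C + 2 * q) + 2 * (ze * B2).
  move: h1 h2 h3 h4; clearbody q ze O I1 I2 B2 eta x; clear -mo hG Ad al1 al0 C0; lra.
have h6 := ler_wpM2r (ltW E0) h5; apply: (le_trans h6).
have -> : (eta * (1 + 2 * C + 2 * q) + 2 * (ze * B2)) * E = eta * D + 2 * (ze * (E * B2)) by rewrite /D; ring.
by rewrite zeE; move: etaD e20; clearbody eta D; clear -mo hG Ad al1 al0 C0; lra.
Qed.

Lemma solnS a b c d N z Z : a <= c -> d <= b -> soln a b N z Z -> soln c d N (Z c) Z.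
Proof.
move=> ac db [h1 h2 h3 h4 h5]; split => //; [exact: aeabS h3|exact: intgS h4|].
by move=> s t w cs st td; apply: h5 => //; [exact: le_trans ac cs|exact: le_trans td db].
Qed.

Lemma soln_ext a b N N' z Z : noise a b N -> noise a b N' -> aeab a b (fun t => N t = N' t) ->
  soln a b N z Z -> soln a b N' z Z.
Proof.
move=> hN hN' NN hs; have [h1 h2 h3 h4 h5] := hs; split => // s t w as_ st tb; rewrite h5//.
apply: I_ae_eq.
- apply: (measurable_op mo); exact: (so_u mo hN hs).1.
- apply: (measurable_op mo); have := so_lpV mo hs => -[b1 _].
  by have [s' ds'] := V_dense_seq hG; exact: (bmeasD ds' b1 (no_lp hN').1).
- by apply: aeab_filter (aeabS as_ tb NN) => r _ ->.
Qed.

Lemma soln_eq_on a b N z Z Z' : continuous Z' -> (forall t, a <= t <= b -> Z t = Z' t) -> a <= b ->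
  soln a b N z Z -> soln a b N z Z'.
Proof.
move=> cZ' ZZ ab [h1 h2 h3 h4 h5]; split => //.
- by rewrite -ZZ// lexx ab.
- by apply: aeab_filter h3 => t tab; rewrite ZZ.
- apply: (intg_le _ _ h4) => [|t tab]; last by rewrite ger0_norm ?powR_ge0// ZZ.
  by apply: lpV_meas; apply: (bmeas_iinv hG); exact: bmeas_continuous.
- move=> s t w as_ st tb.
  rewrite -!ZZ ?as_ ?(le_trans st) ?(le_trans as_)//= h5//.
  by apply: I_eq => r /andP[sr rt]; rewrite ZZ// (le_trans as_ sr) (le_trans rt tb).
Qed.

Lemma soln_glue a b c N z Z1 Z2 : a <= c -> c <= b -> noise a b N ->
  soln a c N z Z1 -> soln c b N (Z1 c) Z2 -> exists Z, soln a b N z Z.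
Proof.
move=> ac cb hN s1 s2.
(* A single formula instead of a case distinction makes continuity evident; after c the constant Z1
   c cancels against Z2 c, the initial value of Z2. *)
pose Z t := Z1 (Num.min t c) + (Z2 (Num.max t c) - Z2 c).
have cZ : continuous Z.
  move=> t; apply: cvgD; first apply: (@continuous_comp _ _ _ (fun t => Num.min t c) Z1).
  - by apply: continuous_min; [exact: cvg_id|exact: cvg_cst].
  - exact: so_cont s1 _.
  apply: cvgB; last exact: cvg_cst.
  apply: (@continuous_comp _ _ _ (fun t => Num.max t c) Z2).
  - by apply: continuous_max; [exact: cvg_id|exact: cvg_cst].
  - exact: so_cont s2 _.
have Zl t : a <= t <= c -> Z1 t = Z t.
  by move=> /andP[_ tc]; rewrite /Z min_l// max_r// subrr addr0.
have Zr t : c <= t <= b -> Z2 t = Z t.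
  by move=> /andP[ct _]; rewrite /Z min_r// max_l// (so_init s2) addrCA subrr addr0.
have {}s1 := soln_eq_on cZ Zl ac s1; have {}s2 := soln_eq_on cZ Zr cb s2.
have [_ z1 r1 l1 e1] := s1; have [_ _ r2 l2 e2] := s2.
exists Z; split => //.
- apply: (@filterS2 _ _ (aeF R)) r1 r2 => t h1 h2 /andP[at_ tb].
  by have [tc|/ltW ct] := leP t c; [apply: h1; rewrite at_|apply: h2; rewrite ct].
- exact: intg_split l1 l2.
- move=> s t w as_ st tb; have [tc|/ltW ct] := leP t c; first exact: e1.
  have [sc|/ltW cs] := leP s c; last exact: e2.
  have -> : Z t - Z s = (Z c - Z s) + (Z t - Z c) by rewrite [RHS]addrC addrA subrK.
  rewrite (ipDl hG) e1// e2// -I_split//.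
  have i1 : intg s c (fun r => A (iinv i (Z r) + N r) w).
    apply: (op_intg mo sc (lpVS as_ (lexx c) (so_u mo (noiseS (lexx a) cb hN) s1))); exact: lpV_cst.
  have i2 : intg c t (fun r => A (iinv i (Z r) + N r) w).
    apply: (op_intg mo ct (lpVS (lexx c) tb (so_u mo (noiseS ac (lexx b) hN) s2))); exact: lpV_cst.
  exact: intg_split i1 i2.
Qed.

Lemma soln_unique a b N z Z Z' : a <= b -> noise a b N -> soln a b N z Z -> soln a b N z Z' ->
  forall t, a <= t <= b -> Z t = Z' t.
Proof.
move=> ab hN hs hs' t tab; apply/eqP; rewrite -subr_eq0 -normr_eq0 eq_le normr_ge0 andbT.
apply/ler_addgt0Pr => e e0; rewrite add0r.
pose Bd := Num.max (I a b (fun t => `|iinv i (Z t) + N t| `^ al)) (I a b (fun t => `|iinv i (Z' t) + N t| `^ al)).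
have [eta [eta0 h]] := est2_small Bd ab e0.
apply: (h N N z z Z Z') => //.
- by rewrite le_max lexx.
- by rewrite le_max lexx orbT.
- by rewrite subrr normr0 ltW.
- by under eq_fun do rewrite subrr (i0 hG) normr0 expr0n; rewrite I_cst// mul0r ltW.
- by under eq_fun do rewrite subrr normr0 powR0 ?gt_eqF//; rewrite I_cst// mul0r ltW.
Qed.

Lemma noise_bound a b N N' : noise a b N -> noise a b N' ->
  I a b (fun t => `|N' t| `^ al) <= 2 `^ al * (I a b (fun t => `|N' t - N t| `^ al) + I a b (fun t => `|N t| `^ al)) /\
  I a b (fun t => `|i (N' t)| ^+ 2) <= 2 * (I a b (fun t => `|i (N' t - N t)| ^+ 2) + I a b (fun t => `|i (N t)| ^+ 2)).
Proof.
move=> hN hN'; have hD := noiseB mo hN' hN; split.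
  have i1 := intgD (no_lp hD).2 (no_lp hN).2.
  rewrite -(ID (no_lp hD).2 (no_lp hN).2) -(IZ _ i1); apply: I_le; [exact: (no_lp hN').2|exact: intgZ|].
  apply: aeabW => t _; rewrite -{1}(subrK (N t) (N' t)).
  rewrite (le_trans _ (powRD_le (ltW al0) (normr_ge0 _) (normr_ge0 _)))//.
  by rewrite ge0_ler_powR ?nnegrE ?addr_ge0 ?(ltW al0)// ler_normD.
have i1 := intgD (no_sq hD) (no_sq hN).
rewrite -(ID (no_sq hD) (no_sq hN)) -(IZ _ i1); apply: I_le; [exact: no_sq hN'|exact: intgZ|].
apply: aeabW => t _; rewrite -{1}(subrK (N t) (N' t)) (iD hG) mulrDr; exact: normD2_le hG _ _.
Qed.

End Closure.

(** In [closure_soln] three smallness conditions, with factors 1, 2 and p = 2^al, are met by the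
    single tolerance et = eta / (2 p + 4); the arithmetic is isolated in this lemma and the next
    two. *)
Lemma add_le_scaled (R : realFieldType) (x y et p : R) : 0 < et -> 0 < p -> x < et -> y < et ->
  x + y <= et * (2 * p + 4).
Proof. by move=> et0 p0; have := mulr_gt0 et0 p0; lra. Qed.

Lemma double_le_scaled (R : realFieldType) (x y et p : R) : 0 < et -> 0 < p -> x < et -> y < et ->
  2 * (x + y) <= et * (2 * p + 4).
Proof. by move=> et0 p0; have := mulr_gt0 et0 p0; lra. Qed.

Lemma mul_le_scaled (R : realFieldType) (x y et p : R) : 0 < et -> 0 < p -> x < et -> y < et ->
  p * (x + y) <= et * (2 * p + 4).
Proof.
move=> et0 p0 xe ye; have : p * (x + y) <= p * (et + et) by rewrite ler_pM2l// lerD// ltW.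
by clear xe ye; lra.
Qed.

Section ClosureSoln.
Variables (R : realType) (V H : completeNormedModType R) (ip : H -> H -> R) (i : V -> H).
Variables (A : V -> V -> R) (al delta K C : R).
Hypothesis mo : monotone_op ip i A al delta K C.
Notation RM := (measurableTypeR R).
Let hG := mo_gel mo.
Let Ad := mo_dual mo.
Let al1 := mo_alpha mo.
Let al0 := mo_alpha0 mo.
Let C0 := mo_C0 mo.
Implicit Types (a b s t e M : R) (Z : R -> H) (N : R -> V) (z : H).
Local Notation soln := (soln ip i A al).
Local Notation noise := (noise i al).

(** Boundedness of the data gives a bound in L^al(V) by [est1], which makes the limit V-valued by
    [fatou_range]; strong convergence in H comes from [est2_small]. Minty's trick is applied on
    every [s, t], since the equation is required for all increments. *)
Lemma closure_soln a b N z (Nj : nat -> R -> V) (zj : nat -> H) (Zj : nat -> R -> H) : a <= b ->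
  noise a b N -> (forall j, noise a b (Nj j)) -> zj j @[j --> \oo] --> z ->
  I a b (fun t => `|Nj j t - N t| `^ al) @[j --> \oo] --> (0 : R) ->
  I a b (fun t => `|i (Nj j t - N t)| ^+ 2) @[j --> \oo] --> (0 : R) ->
  aeab a b (fun t => Nj j t @[j --> \oo] --> N t) ->
  (forall j, soln a b (Nj j) (zj j) (Zj j)) -> exists Z, soln a b N z Z.
Proof.
move=> ab hN hNj zc c1 c2 Nae hs.
have bs (f : nat -> R) (l : R) : f j @[j --> \oo] --> l -> exists2 M : R, 0 <= M & forall j, f j <= M.
  move=> fl; have /cvg_seq_bounded/pinfty_ex_gt0[M M_gt0 hM] : cvgn f by apply/cvg_ex; exists l.
  by exists M; [exact: ltW|move=> j; apply: le_trans (ler_norm _) (hM j Logic.I)].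
have [m1 m10 h1] : exists2 M : R, 0 <= M & forall j, `|zj j| ^+ 2 <= M.
  apply: (bs _ (`|z| ^+ 2)); rewrite expr2; under eq_fun do rewrite expr2.
  by apply: cvgM; exact: cvg_norm.
have [m2 m20 h2] := bs _ _ c1; have [m3 m30 h3] := bs _ _ c2.
pose n1 := I a b (fun t => `|N t| `^ al); pose n2 := I a b (fun t => `|i (N t)| ^+ 2).
have n10 : 0 <= n1 by apply: I_ge0 => t _; exact: powR_ge0.
have n20 : 0 <= n2 by apply: I_ge0 => t _; exact: sqr_ge0.
pose M0 := m1 + 2 `^ al * (m2 + n1) + 2 * (m3 + n2).
have t1 : 0 <= 2 `^ al * (m2 + n1) by rewrite mulr_ge0 ?powR_ge0 ?addr_ge0.
have t2 : 0 <= 2 * (m3 + n2) by rewrite mulr_ge0 ?addr_ge0.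
have M00 : 0 <= M0 by rewrite !addr_ge0.
have [Bd hBd] := est1 mo ab M00.
have uB j : I a b (fun t => `|iinv i (Zj j t) + Nj j t| `^ al) <= Bd.
  have [k1 k2] := noise_bound mo hN (hNj j).
  apply: (hBd _ _ _ (hNj j) (hs j)).
  - by rewrite (le_trans (h1 j))// /M0 -addrA ler_wpDr// addr_ge0.
  - rewrite (le_trans k1)// (@le_trans _ _ (2 `^ al * (m2 + n1)))//.
      by rewrite ler_wpM2l ?powR_ge0// lerD2r.
    by rewrite /M0 addrAC ler_wpDl// addr_ge0.
  - rewrite (le_trans k2)// (@le_trans _ _ (2 * (m3 + n2)))//; first by rewrite ler_wpM2l// lerD2r.
    by rewrite /M0 ler_wpDl// addr_ge0.
have [|Z [cZ hZ]] := unif_limit ab (fun j => so_cont (hs j)).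
  move=> e e0; have [eta [eta0 he]] := est2_small mo Bd ab e0.
  have p2 : 0 < 2 `^ al :> R by exact: powR_gt0.
  pose et := eta / (2 * 2 `^ al + 4).
  have d0 : 0 < 2 * 2 `^ al + 4 :> R by rewrite addr_gt0// mulr_gt0.
  have et0 : 0 < et by rewrite divr_gt0.
  have etE : et * (2 * 2 `^ al + 4) = eta by rewrite mulfVK// gt_eqF.
  move/cvgrPdist_lt : zc => /(_ _ et0)[J1 _ hJ1].
  move/cvgr0_norm_lt : c1 => /(_ _ et0)[J2 _ hJ2].
  move/cvgr0_norm_lt : c2 => /(_ _ et0)[J3 _ hJ3].
  exists (maxn J1 (maxn J2 J3)) => j k; rewrite !geq_max => /and3P[j1 j2 j3] /and3P[k1 k2 k3].
  have e1 t : Nj j t - Nj k t - (N t - Nj k t) = Nj j t - N t by rewrite opprB addrA subrK.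
  have [q1 q2] := noise_bound mo (noiseB mo hN (hNj k)) (noiseB mo (hNj j) (hNj k)).
  have s1 := le_lt_trans (ler_norm _) (hJ2 j j2); have s2 := le_lt_trans (ler_norm _) (hJ2 k k2).
  have s3 := le_lt_trans (ler_norm _) (hJ3 j j3); have s4 := le_lt_trans (ler_norm _) (hJ3 k k3).
  apply: (he (Nj j) (Nj k) (zj j) (zj k)) => //.
  - rewrite -(subrK z (zj j)) -addrA (le_trans (ler_normD _ _))//.
    by rewrite -etE add_le_scaled// ?hJ1// distrC; apply: hJ1.
  - rewrite (le_trans q2)// -etE; under eq_fun do rewrite e1.
    have e2 : (fun t => `|i (N t - Nj k t)| ^+ 2) = (fun t => `|i (Nj k t - N t)| ^+ 2).
      by apply/funext => t; rewrite -(opprB (Nj k t)) (iN hG) normrN.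
    rewrite e2.
    exact: double_le_scaled.
  - rewrite (le_trans q1)// -etE; under eq_fun do rewrite e1.
    have e3 : (fun t => `|N t - Nj k t| `^ al) = (fun t => `|Nj k t - N t| `^ al).
      by apply/funext => t; rewrite distrC.
    rewrite e3.
    exact (mul_le_scaled et0 p2 s1 s2).
have Zptw t : a <= t <= b -> Zj j t @[j --> \oo] --> Z t.
  move=> tab; apply/cvgrPdist_le => eps eps0; have [J hJ] := hZ _ eps0.
  by exists J => // j /= Jj; rewrite distrC hJ.
pose uj j t := iinv i (Zj j t) + Nj j t.
have hu j : lpV al a b (uj j) by exact (so_u mo (hNj j) (hs j)).
have ZE : aeab a b (fun t => forall j, i (iinv i (Zj j t)) = Zj j t).
  by apply: aeab_seq => j; exact: (so_iinv mo (hs j)).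
have ua : aeab a b (fun t => i (uj j t) @[j --> \oo] --> Z t + i (N t)).
  apply: aeab2 ZE Nae => t tab ZEt Nt; rewrite /uj.
  under eq_fun do rewrite (iD hG) ZEt.
  by apply: cvgD; [exact: Zptw|apply: (cvg_comp _ _ Nt); exact: i_cont hG _].
have [rZ hZv] := fatou_range mo cZ hu uB (no_lp hN) ua.
exists Z; split => //.
- apply: (cvg_unique _ _ zc) => //.
  have := Zptw a; rewrite lexx ab => /(_ isT); apply: cvg_trans; apply: near_eq_cvg.
  by apply: nearW => j; rewrite (so_init (hs j)).
- exact: hZv.2.
move=> s t w as_ st tb.
have at_ := le_trans as_ st; have sb := le_trans st tb.
pose g j r := `|i (uj j r) - (Z r + i (N r))| ^+ 2.
have [sH dsH] := H_dense_seq hG.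
have mg j : measurable_fun [set: RM] (g j).
  have bm : bmeas ((fun r => i (uj j r) - (Z r + i (N r))) : RM -> H).
    apply: (bmeasB dsH); first exact: (bmeas_i hG (hu j).1).
    by apply: (bmeasD dsH); [exact: bmeas_continuous|exact: (bmeas_i hG (no_lp hN).1)].
  have h := bmeas_normr bm; rewrite /g; under eq_fun do rewrite expr2; exact: measurable_funM.
have gle j : aeab a b (fun r => g j r <= 2 * `|Zj j r - Z r| ^+ 2 + 2 * `|i (Nj j r - N r)| ^+ 2).
  apply: aeab_filter ZE => r _ /(_ j) ZEr; rewrite /g /uj (iD hG) ZEr opprD addrACA -(iB hG).
  exact: normD2_le hG _ _.
have icZ j : intg a b (fun r => `|Zj j r - Z r| ^+ 2).
  apply: intg_cont; apply: sqr_cont => r; apply: cvgB; [exact: so_cont (hs j) r|exact: cZ].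
have icN j := no_sq (noiseB mo (hNj j) hN).
have ibd j := intgD (intgZ 2 (icZ j)) (intgZ 2 (icN j)).
have ig j : intg a b (g j).
  apply: (intg_le_ae (mg j) (ibd j)); apply: aeab_filter (gle j) => r _.
  by rewrite ger0_norm// /g sqr_ge0.
have g0 : I s t (g j) @[j --> \oo] --> (0 : R).
  have cZ0 : I a b (fun r => `|Zj j r - Z r| ^+ 2) @[j --> \oo] --> (0 : R).
    have [_ c] : intg a b (fun=> 0) /\ I a b (fun r => `|Zj j r - Z r| ^+ 2) @[j --> \oo] --> I a b (fun=> 0).
      have [J0 hJ0] := hZ 1 ltr01.
      (* The terms before J0 are set to 0, so that the constant 1 dominates all of them. *)
      pose f j r := if (J0 <= j)%N then `|Zj j r - Z r| ^+ 2 else 0.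
      have [_ c] : intg a b (fun=> 0) /\ I a b (f j) @[j --> \oo] --> I a b (fun=> 0).
        apply: (@I_dct _ a b f (fun=> 0) (fun=> 1)) => //.
        - by move=> j; rewrite /f; case: (J0 <= j)%N; [exact: (icZ j).1|exact: measurable_cst].
        - exact: intg_cst.
        - apply: aeabW => r rab; rewrite -[0 in X in _ --> X](mulr0 (0 : R)).
          have zr : `|Zj j r - Z r| @[j --> \oo] --> (0 : R).
            by apply/cvgr0Pnorm_lt => eps eps0; move/cvgrPdist_lt : (Zptw r rab) => /(_ _ eps0); apply: filterS => j; rewrite normr_id distrC.
          apply: cvg_trans (cvgM zr zr); apply: near_eq_cvg; exists J0 => // j /= Jj.
          by rewrite /f Jj expr2.
        - apply: aeabW => r rab j; rewrite /f; case: ifP => Jj; last by rewrite normr0.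
          by rewrite ger0_norm ?sqr_ge0// expr_le1// hJ0.
      split; first exact: intg_cst.
      apply: cvg_trans c; apply: near_eq_cvg; exists J0 => // j /= Jj.
      by congr I; apply/funext => r; rewrite /f Jj.
    by rewrite I_cst// mul0r in c.
  have cB : 2 * I a b (fun r => `|Zj j r - Z r| ^+ 2) + 2 * I a b (fun r => `|i (Nj j r - N r)| ^+ 2) @[j --> \oo] --> (2 * 0 + 2 * 0 : R).
    by apply: cvgD; apply: cvgM => //; exact: cvg_cst.
  rewrite !mulr0 addr0 in cB.
  apply: (@squeeze_cvgr _ _ _ _ (fun=> 0) _ _ _ _ _ cB); last exact: cvg_cst.
  apply: nearW => j; apply/andP; split; first by apply: I_ge0 => r _; exact: sqr_ge0.
  rewrite -(IZ _ (icZ j)) -(IZ _ (icN j)) -(ID (intgZ 2 (icZ j)) (intgZ 2 (icN j))).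
  rewrite (@le_trans _ _ (I a b (g j)))//; last exact: I_le.
  by apply: I_sub => // r _; exact: sqr_ge0.
apply: (@minty_limit _ _ _ _ _ _ _ _ _ _ mo s t Zj uj Z N Bd) => //.
- by move=> j r q v sr rq qt; apply: (so_evol (hs j)) => //; [exact: le_trans sr|exact: le_trans tb].
- by move=> j; exact (lpVS as_ tb (hu j)).
- move=> j; apply: le_trans (uB j); apply: I_sub; [exact: as_|exact: tb|exact: (hu j).2|by move=> r _; exact: powR_ge0].
- by move=> j; exact: so_cont (hs j).
- move=> e /hZ[J hJ]; exists J => j Jj r /andP[sr rt]; apply: hJ => //.
  by rewrite (le_trans as_ sr) (le_trans rt tb).
- exact (lpVS as_ tb (no_lp hN)).
- exact (intgS as_ tb (no_sq hN)).
- exact (aeabS as_ tb ua).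
- by move=> j; exact (intgS as_ tb (ig j)).
(* The lower energy bound: u_j - N is the sum of iinv i Z_j and N_j - N. The first summand is
   handled by the energy identity of Z_j; the second is small by Young's inequality, with ze fixed
   before j. *)
move=> e e0; pose O := `|opB al C s t Bd| + 1.
have O0 : 0 < O by rewrite ltr_wpDl.
pose ze := e / 8 / O; have ze0 : 0 < ze by rewrite !divr_gt0.
have zeO : ze * O = e / 8 by rewrite mulfVK// gt_eqF.
have q0 : 0 < ze `^ (1 - al) by exact: powR_gt0.
have e8 : 0 < e / 8 / ze `^ (1 - al) by rewrite !divr_gt0.
have e4 : 0 < e / 4 by rewrite divr_gt0.
have sq r : a <= r <= b -> `|Zj j r| ^+ 2 @[j --> \oo] --> `|Z r| ^+ 2.
  move=> rab; rewrite expr2; under eq_fun do rewrite expr2.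
  by apply: cvgM; apply: cvg_norm; exact: Zptw.
have /cvgrPdist_lt/(_ _ e4)[J1 _ hJ1] := sq t (introT andP (conj at_ tb)).
have /cvgrPdist_lt/(_ _ e4)[J2 _ hJ2] := sq s (introT andP (conj as_ sb)).
move/cvgr0_norm_lt : c1 => /(_ _ e8)[J3 _ hJ3].
exists (maxn J1 (maxn J2 J3)) => j; rewrite !geq_max => /and3P[j1 j2 j3].
have huj := lpVS as_ tb (hu j).
have uBj : I s t (fun r => `|uj j r| `^ al) <= Bd.
  by apply: le_trans (uB j); apply: I_sub; [exact: as_|exact: tb|exact: (hu j).2|by move=> r _; exact: powR_ge0].
have dg := op_dgrowth mo st huj uBj.
have hsj := so_lpV mo (solnS as_ tb (hs j)).
have evj : evol ip i s t (Zj j) (fun r => A (uj j r)) by exact: so_evol (solnS as_ tb (hs j)).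
have en := energy_eq hG al1 st evj dg (so_cont (hs j)) hsj (so_iinv mo (solnS as_ tb (hs j))).
have hD := noiseS as_ tb (noiseB mo (hNj j) hN).
have bd := dg_bound hG al1 dg ze0 (no_lp hD).
have i1 := op_intg mo st huj hsj; have i2 := op_intg mo st huj (no_lp hD).
have -> : I s t (fun r => A (uj j r) (uj j r - N r)) =
    I s t (fun r => A (uj j r) (iinv i (Zj j r))) + I s t (fun r => A (uj j r) (Nj j r - N r)).
  by rewrite -ID//; congr I; apply/funext => r; rewrite -(dualD (Ad _)) /uj addrA.
have sI : I s t (fun r => `|Nj j r - N r| `^ al) <= I a b (fun r => `|Nj j r - N r| `^ al).
  by apply: I_sub; [exact: as_|exact: tb|exact: (no_lp (noiseB mo (hNj j) hN)).2|by move=> r _; exact: powR_ge0].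
have b3 := le_lt_trans (ler_norm _) (hJ3 j j3).
have b4 : ze `^ (1 - al) * I s t (fun r => `|Nj j r - N r| `^ al) <= e / 8.
  by rewrite -ler_pdivlMl// mulrC (le_trans sI)// ltW.
have b5 : ze * opB al C s t Bd <= e / 8.
  by rewrite -zeO ler_pM2l// ler_wpDr// ler_norm.
move: (hJ1 j j1) (hJ2 j j2) en bd b4 b5; rewrite /= !ltr_norml ler_norml.
set x1 := opB _ _ _ _ _; set x2 := I s t (fun r => A (uj j r) (iinv i (Zj j r))); set x3 := I s t (fun r => A _ _).
set x4 := ze `^ _ * _; rewrite /opB -/x1; clearbody x1 x2 x3 x4; gen_atoms; clear -mo hG Ad al1 al0 C0.
by move=> /andP[? ?] /andP[? ?] ? /andP[? ?] ? ?; lra.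
Qed.

End ClosureSoln.

(** * The implicit Euler scheme *)

Section Rothe.
Variables (R : realType) (V H : completeNormedModType R) (ip : H -> H -> R) (i : V -> H).
Variables (A : V -> V -> R) (al delta K C : R).
Hypothesis mo : monotone_op ip i A al delta K C.
Notation RM := (measurableTypeR R).
Let hG := mo_gel mo.
Let Ad := mo_dual mo.
Let al1 := mo_alpha mo.
Let al0 := mo_alpha0 mo.
Let C0 := mo_C0 mo.
Implicit Types (a b c s t e M : R) (Z : R -> H) (N y : R -> V) (z : H).
Local Notation soln := (soln ip i A al).
Local Notation noise := (noise i al).
Local Notation evol := (evol ip i).

Lemma aeab_ne a b c : aeab a b (fun t => t <> c).
Proof.
exists [set c]; split => //; first exact: lebesgue_measure_set1.
by move=> t /= ht; apply: contrapT => tc; apply: ht.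
Qed.

Lemma evol_glue a b c Z (F : R -> V -> R) : (forall w, intg a b (F ^~ w)) ->
  evol a c Z F -> evol c b Z F -> evol a b Z F.
Proof.
move=> iF e1 e2 s t w as_ st tb; have [tc|/ltW ct] := leP t c; first exact: e1.
have [sc|/ltW cs] := leP s c; last exact: e2.
have -> : Z t - Z s = (Z c - Z s) + (Z t - Z c) by rewrite [RHS]addrC addrA subrK.
by rewrite (ipDl hG) e1// e2// -I_split//; exact: (intgS as_ tb (iF w)).
Qed.

Lemma lpV_cont a b y : a <= b -> continuous y -> lpV al a b y.
Proof.
move=> ab cy; have by_ : bmeas (y : RM -> V) by exact: bmeas_continuous.
split=> //; have [M M0 hM] := cl_bounded ab cy.
apply: (intg_le (lpV_meas al by_) _ (intg_cst a b (M `^ al))) => t tab.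
rewrite ger0_norm ?powR_ge0// ge0_ler_powR ?nnegrE ?(ltW al0)//.
by have := hM t; rewrite (cl_id tab).
Qed.

(** Monotonicity at v' and v, where A v' - A v is represented by g' - g and i v' - i v = h g', gives
    (2 - h C) |g'| <= 2 |g|. The factor 1 + h C follows from (1 + l) (2 - l) >= 2 for 0 <= l <= 1.
    This keeps A bounded in H along the scheme. *)
Lemma euler_step h v g : 0 < h -> h * (C + `|K|) <= 1 -> (forall w, A v w = ip g (i w)) ->
  exists v' g', [/\ i v' - i v = h *: g', (forall w, A v' w = ip g' (i w)) & `|g'| <= (1 + h * C) * `|g|].
Proof.
move=> h0 hC hg; have [v' hv'] := resolvent mo (i v) h0 hC.
pose g' := h^-1 *: (i v' - i v).
have h'0 : h != 0 by rewrite gt_eqF.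
have e1 : i v' - i v = h *: g' by rewrite /g' scalerA mulfV// scale1r.
have e2 w : A v' w = ip g' (i w) by rewrite (ipZl hG) hv' mulKf.
exists v', g'; split => //.
have m := mo_mono mo v' v; rewrite e2 hg (iB hG) e1 -(ipBl hG) (ipZr hG) (ipBl hG) (ipxx hG) in m.
have cs := le_trans (ler_norm _) (cauchy_schwarz hG g g').
have g0 := normr_ge0 g; have g'0 := normr_ge0 g'.
have nh : `|h *: g'| = h * `|g'| by rewrite normrZ ger0_norm// ltW.
rewrite nh in m.
set x := `|g| in cs g0 *; set x' := `|g'| in m cs g'0 *; set p := ip g g' in m cs.
have K0 := normr_ge0 K; set k := `|K| in hC K0.
have hC1 : h * C <= 1 by move: hC; rewrite mulrDr; have := mulr_ge0 (ltW h0) K0; clear -mo hG Ad al1 al0 C0; lra.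
have hC0 : 0 <= h * C by rewrite mulr_ge0 ?(ltW h0).
move: m; rewrite (mulrCA 2 h) exprMn (_ : C * (h ^+ 2 * x' ^+ 2) = h * ((h * C) * x' ^+ 2)); last by ring.
rewrite ler_pM2l// => m.
have [->|x'n] := eqVneq x' 0; first by rewrite mulr_ge0// addr_ge0.
have x'p : 0 < x' by rewrite lt_neqAle eq_sym x'n.
set l := h * C in hC1 hC0 m *; clearbody l.
have m2 : (2 - l) * x' <= 2 * x.
  rewrite -(ler_pM2r x'p) -!mulrA -expr2; move: m cs; clearbody x x' p; clear -mo hG Ad al1 al0 C0; lra.
have m3 : (1 + l) * ((2 - l) * x') <= (1 + l) * (2 * x) by rewrite ler_wpM2l// addr_ge0.
have m4 : 0 <= l * (1 - l) * x' by rewrite mulr_ge0// mulr_ge0// subr_ge0.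
by move: m3 m4; clearbody x x'; clear -mo hG Ad al1 al0 C0; lra.
Qed.

Lemma euler_seq h v0 g0 : 0 < h -> h * (C + `|K|) <= 1 -> (forall w, A v0 w = ip g0 (i w)) ->
  exists (v : nat -> V) (g : nat -> H), v 0%N = v0 /\ forall k,
    [/\ i (v k.+1) - i (v k) = h *: g k.+1, (forall w, A (v k) w = ip (g k) (i w)) &
        `|g k| <= (1 + h * C) ^+ k * `|g0|].
Proof.
move=> h0 hC hg0.
have ex (p : V * H) : exists q : V * H, (forall w, A p.1 w = ip p.2 (i w)) ->
    [/\ i q.1 - i p.1 = h *: q.2, (forall w, A q.1 w = ip q.2 (i w)) & `|q.2| <= (1 + h * C) * `|p.2|].
  have [hp|np] := pselect (forall w, A p.1 w = ip p.2 (i w)); last by exists p.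
  by have [v' [g' hq]] := euler_step h0 hC hp; exists (v', g').
have [f hf] := choice ex.
pose s k := iter k f (v0, g0).
have hs k : forall w, A (s k).1 w = ip (s k).2 (i w).
  by elim: k => [|k IH]//; case: (hf _ IH).
exists (fun k => (s k).1), (fun k => (s k).2); split=> // k; split.
- by case: (hf _ (hs k)).
- exact: hs.
elim: k => [|k IH]; first by rewrite expr0 mul1r.
have [_ _ h1] := hf _ (hs k); apply: (le_trans h1).
rewrite exprS -mulrA ler_wpM2l// addr_ge0// mulr_ge0//; exact: ltW.
Qed.

(* y is the piecewise affine and u the piecewise constant interpolant of the
   implicit Euler scheme v. *)
Lemma rothe_glue a h (v : nat -> V) (g : nat -> H) M n : 0 < h ->
  (forall k, i (v k.+1) - i (v k) = h *: g k.+1 /\ forall w, A (v k) w = ip (g k) (i w)) ->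
  (forall k, (k <= n)%N -> `|g k| <= M) ->
  exists y u, [/\ continuous y, isstep u, y a = v 0%N, y (a + h * n%:R) = v n &
    evol a (a + h * n%:R) (fun t => i (y t)) (fun r => A (u r)) /\
    forall t, a <= t <= a + h * n%:R -> `|i (y t) - i (u t)| <= h * M /\ exists2 k, (k <= n)%N & u t = v k].
Proof.
move=> h0 hv; elim: n => [|n IH] gM.
  exists (fun=> v 0%N), (fun=> v 0%N); split => //; [by move=> t; exact: cvg_cst|exact: isstep_cst|].
  rewrite mulr0 addr0; split.
    move=> s t w as_ st ta; have -> : t = s by apply/eqP; rewrite eq_le st (le_trans ta as_).
    by rewrite subrr (ip0l hG) I_xx.
  move=> t tab; rewrite subrr normr0; split; last by exists 0%N.
  by rewrite mulr_ge0 ?(ltW h0)// (le_trans (normr_ge0 _) (gM 0%N _)).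
have {}IH := IH (fun k kn => gM k (leqW kn)).
have [y [u [cy su y0 yn [ev hyu]]]] := IH.
set c := a + h * n%:R in yn ev hyu.
have -> : a + h * n.+1%:R = c + h by rewrite /c -addrA -natr1 mulrDr mulr1.
have ac : a <= c by rewrite lerDl mulr_ge0// ltW.
have ch : c <= c + h by rewrite lerDl ltW.
clearbody c.
have h'0 : h != 0 by rewrite gt_eqF.
pose dv := h^-1 *: (v n.+1 - v n).
have idv : i dv = g n.+1 by rewrite (iZ hG) (iB hG) (hv n).1 scalerA mulVf// scale1r.
pose y' t := y (Num.min t c) + (Num.max t c - c) *: dv.
(* The value at the right end of the new interval, as the scheme is implicit. *)
pose u' t := if t < c then u t else v n.+1.
have yl t : t <= c -> y' t = y t by move=> tc; rewrite /y' min_l// max_r// subrr scale0r addr0.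
have yr t : c <= t -> y' t = v n + (t - c) *: dv by move=> ct; rewrite /y' min_r// max_l// yn.
have su' : isstep u' by apply: isstep_glue => //; exact: isstep_cst.
have cy' : continuous y'.
  move=> t; apply: cvgD; first apply: (@continuous_comp _ _ _ (fun t => Num.min t c) y).
  - by apply: continuous_min; [exact: cvg_id|exact: cvg_cst].
  - exact: cy.
  - apply: cvgZr_tmp.
    have cm r : {for r, continuous (fun t => Num.max t c)}.
      by apply: continuous_max; [exact: cvg_id|exact: cvg_cst].
    by apply: cvgB; [exact: cm|exact: cvg_cst].
exists y', u'; split => //.
- by rewrite yl.
- by rewrite yr// addrAC subrr add0r /dv scalerA mulfV// scale1r addrC subrK.
split.
- apply: (@evol_glue a _ c).
  + by move=> w; apply: (op_intg mo (le_trans ac ch)); [exact: lpV_step|exact: lpV_cst].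
  + move=> s t w as_ st tc; rewrite !yl ?(le_trans st)// ev//.
    apply: I_ae_eq; [exact: (measurable_op mo w (isstep_bmeas su))|exact: (measurable_op mo w (isstep_bmeas su'))|].
    apply: aeab_filter (aeab_ne s t c) => r /andP[_ rt] rc; rewrite /u'.
    by rewrite lt_neqAle (le_trans rt tc) andbT; move/eqP: rc => ->.
  + move=> s t w cs st tch; rewrite !yr ?(le_trans cs)//.
    have -> : i (v n + (t - c) *: dv) - i (v n + (s - c) *: dv) = (t - s) *: i dv.
      rewrite -(iB hG) -(iZ hG) opprD addrACA subrr add0r -scalerBl; congr (i (_ *: _)); ring.
    rewrite idv (ipZl hG) -(hv n.+1).2.
    rewrite mulrC -I_cst//; apply: I_eq => r /andP[sr rt].
    by rewrite /u' ltNge (le_trans cs sr).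
- move=> t /andP[at_ tch]; have [tc|ct] := ltP t c.
    rewrite yl ?(ltW tc)// /u' tc; have [|h1 [k kn uk]] := hyu t; first by rewrite at_ ltW.
    by split => //; exists k => //; exact: leqW kn.
  rewrite yr// /u' ltNge ct /=; split; last by exists n.+1.
  rewrite -(iB hG).
  have -> : v n + (t - c) *: dv - v n.+1 = (t - c - h) *: dv.
    have hdv : h *: dv = v n.+1 - v n by rewrite /dv scalerA mulfV// scale1r.
    by rewrite [in RHS]scalerBl hdv opprB addrCA addrA.
  rewrite (iZ hG) idv normrZ ler_pM//; last exact: gM.
  by rewrite ler_norml; move: h0 ct tch; clear -mo hG Ad al1 al0 C0 => ? ? ?; apply/andP; split; lra.
Qed.

End Rothe.

Section RotheSoln.
Variables (R : realType) (V H : completeNormedModType R) (ip : H -> H -> R) (i : V -> H).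
Variables (A : V -> V -> R) (al delta K C : R).
Hypothesis mo : monotone_op ip i A al delta K C.
Notation RM := (measurableTypeR R).
Let hG := mo_gel mo.
Let Ad := mo_dual mo.
Let al1 := mo_alpha mo.
Let al0 := mo_alpha0 mo.
Let C0 := mo_C0 mo.
Implicit Types (a b c s t e M : R) (Z : R -> H) (N y : R -> V) (z : H).
Local Notation soln := (soln ip i A al).
Local Notation noise := (noise i al).
Local Notation evol := (evol ip i).

(** M bounds A u in H for all step widths, by (1 + h C)^k <= exp (C (b - a)). L bounds the scheme in
    H, and Bu follows from coercivity, where A u tested with u is at most M L in absolute value. *)
Lemma rothe a b v0 g0 : a < b -> (forall w, A v0 w = ip g0 (i w)) ->
  exists M Bu : R, [/\ 0 <= M, 0 <= Bu & forall n : nat, (b - a) * (C + `|K|) <= n.+1%:R ->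
    exists y u, [/\ continuous y, isstep u, y a = v0, evol a b (fun t => i (y t)) (fun r => A (u r)) &
      forall t, a <= t <= b -> [/\ `|i (y t) - i (u t)| <= (b - a) / n.+1%:R * M, `|u t| `^ al <= Bu &
        forall w, `|A (u t) w| <= M * `|i w|]]].
Proof.
move=> ab hg0; have d0 := mo_delta mo.
pose M := expR (C * (b - a)) * `|g0|.
have M0 : 0 <= M by rewrite mulr_ge0 ?expR_ge0.
have ba : 0 < b - a by rewrite subr_gt0.
pose L := `|i v0| + (b - a) * M.
have L0 : 0 <= L by rewrite addr_ge0// mulr_ge0// ltW.
pose Bu := (C + `|K| * L ^+ 2 + 2 * (M * L)) / delta.
have Bu0 : 0 <= Bu by rewrite divr_ge0 ?(ltW d0)// !addr_ge0 ?mulr_ge0 ?sqr_ge0.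
exists M, Bu; split => // n hn.
have n0 : 0 < n.+1%:R :> R by rewrite ltr0n.
pose h := (b - a) / n.+1%:R; have h0 : 0 < h by rewrite divr_gt0.
have hnE : h * n.+1%:R = b - a by rewrite mulfVK// gt_eqF.
have hC : h * (C + `|K|) <= 1 by rewrite /h mulrAC ler_pdivrMr// mul1r.
have [v [g [v00 hv]]] := euler_seq mo h0 hC hg0.
have hC0 : 0 <= h * C by rewrite mulr_ge0 ?(ltW h0).
have gM k : (k <= n.+1)%N -> `|g k| <= M.
  move=> kn; case: (hv k) => _ _ h1; apply: (le_trans h1); rewrite ler_wpM2r//.
  have : (1 + h * C) ^+ k <= expR (h * C * k%:R).
    by rewrite expRM_natr lerXn2r ?nnegrE ?expR_ge0 ?addr_ge0 ?expR_ge1Dx.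
  move=> h2; apply: (le_trans h2); rewrite ler_expR mulrAC mulrC ler_wpM2l// -hnE.
  by rewrite ler_pM2l// ler_nat.
have hv2 k : i (v k.+1) - i (v k) = h *: g k.+1 /\ forall w, A (v k) w = ip (g k) (i w) by case: (hv k).
have ivk k : (k <= n.+1)%N -> `|i (v k)| <= `|i v0| + h * k%:R * M.
  elim: k => [_|k IH kn]; first by rewrite v00 mulr0 mul0r addr0.
  rewrite -(subrK (i (v k)) (i (v k.+1))) (hv2 k).1 addrC (le_trans (ler_normD _ _))//.
  have -> : `|i v0| + h * k.+1%:R * M = (`|i v0| + h * k%:R * M) + h * M by rewrite -natr1; ring.
  rewrite lerD ?IH ?(ltnW kn)// normrZ ger0_norm ?(ltW h0)// ler_wpM2l ?(ltW h0)//; exact: gM.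
have ivL k : (k <= n.+1)%N -> `|i (v k)| <= L.
  move=> kn; rewrite (le_trans (ivk _ kn))// lerD2l ler_wpM2r// -hnE ler_pM2l// ler_nat.
  exact: kn.
have Auw k w : (k <= n.+1)%N -> `|A (v k) w| <= M * `|i w|.
  move=> kn; rewrite (hv2 k).2 (le_trans (cauchy_schwarz hG _ _))// ler_wpM2r//; exact: gM.
have vB k : (k <= n.+1)%N -> `|v k| `^ al <= Bu.
  move=> kn; rewrite ler_pdivlMr// mulrC.
  have co := mo_coer mo (v k); have ub := ler_normlP _ _ (Auw k (v k) kn).
  have h1 : M * `|i (v k)| <= M * L by rewrite ler_wpM2l// ivL.
  have h2 : K * `|i (v k)| ^+ 2 <= `|K| * L ^+ 2.
    rewrite (@le_trans _ _ (`|K| * `|i (v k)| ^+ 2))//; first by rewrite ler_wpM2r ?sqr_ge0// ler_norm.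
    by rewrite ler_wpM2l// lerXn2r ?nnegrE// ivL.
  case: ub => ub _; move: co ub h1 h2; set x1 := M * `|_|; set x2 := M * L; set x3 := K * _; set x4 := _ * L ^+ 2.
  clearbody x1 x2 x3 x4; set x5 := delta * _; clearbody x5; set x6 := A _ _; clearbody x6; clear -mo hG Ad al1 al0 C0.
  by lra.
have [y [u [cy su y0 _ []]]] := rothe_glue mo a h0 hv2 gM.
rewrite hnE addrCA subrr addr0 => ev hyu.
exists y, u; split => //; first by rewrite y0.
by move=> t /hyu[h1 [k kn uk]]; split=> //; rewrite uk; [exact: vB|move=> w; exact: Auw].
Qed.

Lemma I_le_cst a b t (f : R -> R) c : a <= t <= b -> 0 <= c -> intg a b f ->
  (forall r, a <= r <= t -> f r <= c) -> I a t f <= c * (b - a).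
Proof.
move=> /andP[at_ tb] c0 hf fc.
have := I_le (intgS (lexx a) tb hf) (intg_cst a t c) (aeabW fc).
move=> /le_trans; apply; rewrite I_cst// ler_wpM2l// lerD2r//.
Qed.

(* The interpolant i y solves the equation with noise u - y, so that est2_raw
   applies to it; u - y tends to 0 in H but is only bounded in V, which is why est2
   and closure_soln are of no use here. *)
Lemma soln_domain a b v0 g0 : a < b -> (forall w, A v0 w = ip g0 (i w)) ->
  exists Z, soln a b (fun=> 0) (i v0) Z.
Proof.
move=> ab hg0; have ab' := ltW ab.
have [M [Bu [M0 Bu0 hR]]] := rothe ab hg0.
have ba : 0 < b - a by rewrite subr_gt0.
(* Starting at the index J0 makes every step width small enough for [resolvent]. *)
pose J0 := Num.trunc ((b - a) * (C + `|K|)).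
have hJ0 j : (b - a) * (C + `|K|) <= (j + J0).+1%:R.
  apply/ltW/(lt_le_trans (truncnS_gt _)); by rewrite ler_nat ltnS leq_addl.
have [y hy] := choice (fun j => hR _ (hJ0 j)).
have [u hu] := choice hy.
pose ep j : R := (b - a) / (j + J0).+1%:R * M.
have ep0 j : 0 <= ep j by rewrite mulr_ge0// divr_ge0// ltW.
have ep_small e : 0 < e -> exists J, forall j, (J <= j)%N -> ep j <= e.
  move=> e0; pose J := Num.trunc (e^-1 * ((b - a) * M)); exists J => j Jj.
  rewrite /ep mulrAC ler_pdivrMr ?ltr0n// -ler_pdivrMl//.
  apply/ltW/(lt_le_trans (truncnS_gt _)); rewrite ler_nat ltnS.
  exact: leq_trans Jj (leq_addr _ _).
have cy j : continuous (y j) by case: (hu j).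
have su j : isstep (u j) by case: (hu j).
have ev j : evol a b (fun t => i (y j t)) (fun r => A (u j r)) by case: (hu j).
have yu j t : a <= t <= b -> `|i (y j t) - i (u j t)| <= ep j by case: (hu j) => _ _ _ _ h /h[].
have uB j t : a <= t <= b -> `|u j t| `^ al <= Bu by case: (hu j) => _ _ _ _ h /h[].
have AM j t w : a <= t <= b -> `|A (u j t) w| <= M * `|i w| by case: (hu j) => _ _ _ _ h /h[].
have cZ j : continuous (fun t => i (y j t)).
  by move=> t; apply: (@continuous_comp _ _ _ (y j) i); [exact: cy|exact: i_cont hG _].
pose Nj j t := u j t - y j t.
have hy_lp j : lpV al a b (y j) := lpV_cont mo ab' (cy j).
have hu_lp j : lpV al a b (u j) by exact: lpV_step.
have hNj j : noise a b (Nj j).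
  apply: (noiseB mo); first exact: (noise_step mo).
  by split => //; apply: intg_cont; exact: sqr_cont.
have hs j : soln a b (Nj j) (i v0) (fun t => i (y j t)).
  split => //.
  - by case: (hu j) => _ _ ->.
  - by apply: aeabW => t _; exists (y j t).
  - by under eq_fun do rewrite (iinvK hG); exact: (hy_lp j).2.
  - move=> s t w as_ st tb; rewrite ev//; apply: I_eq => r _.
    by rewrite (iinvK hG) /Nj addrC subrK.
have iNj j t : a <= t <= b -> `|i (Nj j t)| <= ep j.
  by move=> tab; rewrite /Nj (iB hG) distrC yu.
have [|Z [cZZ hZ]] := unif_limit ab' cZ.
  (* Here 2 C belongs to the squared noise difference, where eta^2 <= eta since eta <= 1, and 4 M to
     twice the difference of A u_j and A u_k, each bounded by M in H, tested with a vector of H-norm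
     at most eta. *)
  move=> e e0; pose kap := (2 * C + 4 * M) * (b - a); pose E := expR (2 * C * (b - a)).
  have E0 : 0 < E by exact: expR_gt0.
  have kap0 : 0 <= kap by rewrite mulr_ge0 ?(ltW ba)// addr_ge0 ?mulr_ge0.
  have kE0 : 0 < 1 + kap * E by rewrite ltr_pwDl// mulr_ge0// ltW.
  pose et := Num.min 1 (e ^+ 2 / (1 + kap * E)) / 2.
  have et0 : 0 < et by rewrite divr_gt0// lt_min ltr01 divr_gt0// exprn_gt0.
  have [J hJ] := ep_small _ et0; exists J => j k Jj Jk t tab.
  pose eta := ep j + ep k.
  have eta0 : 0 <= eta by rewrite addr_ge0.
  have eta2 : eta <= et + et by rewrite lerD ?hJ.
  have etaE : et + et = Num.min 1 (e ^+ 2 / (1 + kap * E)).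
    by rewrite /et -splitr.
  have eta1 : eta <= 1 by rewrite (le_trans eta2)// etaE ge_min lexx.
  have etae : eta * (1 + kap * E) <= e ^+ 2.
    by rewrite -ler_pdivlMr// (le_trans eta2)// etaE ge_min lexx orbT.
  have Njk r : a <= r <= b -> `|i (Nj j r - Nj k r)| <= eta.
    by move=> rab; rewrite (iB hG) (le_trans (ler_normB _ _))// lerD ?iNj.
  have hD := noiseB mo (hNj j) (hNj k).
  have := est2_raw mo (q := kap * eta) ab' (hNj j) (hNj k) (hs j) (hs k) _ tab.
  rewrite subrr normr0 expr0n add0r => hq.
  rewrite -(@ler_pXn2r _ 2)// ?nnegrE ?(ltW e0)//; apply: (le_trans (hq _)); last first.
    by rewrite (le_trans _ etae)// (_ : eta * _ = eta + kap * eta * E) ?lerDr//; ring.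
  move=> r /andP[ar rb].
  have rab s : a <= s <= r -> a <= s <= b by move=> /andP[-> /le_trans]; apply.
  have b1 : I a r (fun s => `|i (Nj j s - Nj k s)| ^+ 2) <= eta * (b - a).
    apply: I_le_cst => //; [by rewrite ar|exact: no_sq hD|move=> s /rab sab].
    rewrite expr2 (le_trans (ler_pM _ _ (Njk s sab) (Njk s sab)))// ler_piMr//.
  have b2 : I a r (fun s => A (iinv i (i (y j s)) + Nj j s) (- (Nj j s - Nj k s)) -
                         A (iinv i (i (y k s)) + Nj k s) (- (Nj j s - Nj k s))) <= 2 * M * eta * (b - a).
    apply: I_le_cst => //; [by rewrite ar|by rewrite !mulr_ge0| |move=> s /rab sab].
      apply: intgB.
        by apply: (op_intg mo ab'); [exact: (so_u mo (hNj j) (hs j))|exact: lpVN (no_lp hD)].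
      by apply: (op_intg mo ab'); [exact: (so_u mo (hNj k) (hs k))|exact: lpVN (no_lp hD)].
    rewrite !(iinvK hG) /Nj !(addrC (y _ _)) !subrK -/(Nj j s) -/(Nj k s).
    set x := - _; have xe : `|i x| <= eta by rewrite /x (iN hG) normrN Njk.
    have m1 := le_trans (ler_norm _) (AM j s x sab).
    have /ler_normlP[m2 _] := AM k s x sab.
    have m3 := ler_wpM2l M0 xe.
    by rewrite (le_trans (lerD m1 m2))// -mulrA -mulr2n -[leLHS]mulr_natl ler_wpM2l.
  have C20 : 0 <= 2 * C by rewrite mulr_ge0.
  have b3 := lerD (ler_wpM2l C20 b1) (ler_wpM2l (ler0n R 2) b2).
  by apply: (le_trans b3); rewrite le_eqVlt; apply/orP; left; apply/eqP; rewrite /kap; ring.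
have Zptw t : a <= t <= b -> i (y j t) @[j --> \oo] --> Z t.
  move=> tab; apply/cvgrPdist_le => e e0; have [J hJ] := hZ _ e0.
  by exists J => // j /= Jj; rewrite distrC hJ.
have ep_cvg : ep j @[j --> \oo] --> (0 : R).
  apply/cvgr0Pnorm_le => e /ep_small[J hJ]; exists J => // j /= Jj.
  by rewrite ger0_norm ?hJ.
have uptw t : a <= t <= b -> i (u j t) @[j --> \oo] --> Z t.
  move=> tab; have -> : (fun j => i (u j t)) = (fun j => i (y j t) - (i (y j t) - i (u j t))).
    by apply/funext => j; rewrite opprB addrC subrK.
  rewrite -[Z t]subr0; apply: cvgB; first exact: Zptw.
  apply/cvgr0Pnorm_le => e /ep_small[J hJ]; exists J => // j /= Jj.
  by rewrite (le_trans (yu j t tab))// hJ.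
have uI s t j : a <= s -> s <= t -> t <= b -> I s t (fun r => `|u j r| `^ al) <= Bu * (b - a).
  move=> as_ st tb; have h := I_le_cst (a := a) (b := b) (t := b) (f := fun r => `|u j r| `^ al).
  rewrite (@le_trans _ _ (I a b (fun r => `|u j r| `^ al)))//.
    by apply: I_sub; [exact: as_|exact: tb|exact: (hu_lp j).2|by move=> r _; exact: powR_ge0].
  by apply: h => //; [rewrite ab' lexx|exact: (hu_lp j).2|move=> r; exact: uB].
have ua : aeab a b (fun t => i (u j t) @[j --> \oo] --> Z t + i 0).
  by apply: aeabW => t tab; rewrite (i0 hG) addr0; exact: uptw.
have [rZ hZv] := fatou_range mo cZZ hu_lp (fun j => uI a b j (lexx a) ab' (lexx b)) (lpV_cst al a b 0) ua.
exists Z; split => //.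
- apply: (norm_cvg_unique (Zptw a _)); first by rewrite lexx.
  have -> : (fun j => i (y j a)) = (fun=> i v0) by apply/funext => j; exact: so_init (hs j).
  exact: cvg_cst.
- exact: hZv.2.
move=> s t w as_ st tb.
have sub r : s <= r <= t -> a <= r <= b.
  by move=> /andP[sr rt]; rewrite (le_trans as_ sr) (le_trans rt tb).
have [sH dsH] := H_dense_seq hG.
pose gg j r := `|i (u j r) - (Z r + i 0)| ^+ 2.
have mg j : measurable_fun [set: RM] (gg j).
  have bm : bmeas ((fun r => i (u j r) - (Z r + i 0)) : RM -> H).
    apply: (bmeasB dsH); first exact: (bmeas_i hG (hu_lp j).1).
    by under eq_fun do rewrite (i0 hG) addr0; exact: bmeas_continuous.
  have h := bmeas_normr bm; rewrite /gg; under eq_fun do rewrite expr2; exact: measurable_funM.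
have ggs e : 0 < e -> exists J, forall j, (J <= j)%N -> forall r, s <= r <= t -> gg j r <= e ^+ 2.
  move=> e0; have e2 : 0 < e / 2 by rewrite divr_gt0.
  have [J1 hJ1] := hZ _ e2; have [J2 hJ2] := ep_small _ e2; exists (maxn J1 J2) => j.
  rewrite geq_max => /andP[j1 j2] r /sub rab.
  rewrite /gg (i0 hG) addr0 lerXn2r ?nnegrE ?(ltW e0)//.
  rewrite -(subrK (i (y j r)) (i (u j r))) -addrA (le_trans (ler_normD _ _))// (splitr e) lerD//.
    by rewrite distrC (le_trans (yu _ _ rab))// hJ2.
  exact: hJ1.
have gg0 : I s t (gg j) @[j --> \oo] --> (0 : R).
  apply/cvgr0Pnorm_le => e e0.
  pose e' := Num.min 1 (e / (1 + (t - s))).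
  have d0 : 0 < 1 + (t - s) by rewrite ltr_pwDl// subr_ge0.
  have e'0 : 0 < e' by rewrite lt_min ltr01 divr_gt0.
  have e'e : e' * (1 + (t - s)) <= e by rewrite -ler_pdivlMr// ge_min lexx orbT.
  have [J hJ] := ggs _ e'0; exists J => // j /= Jj.
  rewrite (le_trans (@I_abs_le _ s t (gg j) (fun=> e' ^+ 2) (mg j) (intg_cst _ _ _) _))//.
    by move=> r rst; rewrite ger0_norm ?hJ// /gg sqr_ge0.
  rewrite I_cst// (le_trans _ e'e)// (@le_trans _ _ (e' * (t - s)))//.
    by rewrite ler_wpM2r ?subr_ge0// expr2 ler_piMr ?(ltW e'0)// ge_min lexx.
  by rewrite ler_wpM2l ?(ltW e'0)// lerDr.
apply: (@minty_limit _ _ _ _ _ _ _ _ _ _ mo s t (fun j t => i (y j t)) u Z (fun=> 0) (Bu * (b - a))) => //.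
- by move=> j r q v sr rq qt; apply: ev => //; [exact: le_trans sr|exact: le_trans tb].
- by move=> j; exact: lpVS as_ tb (hu_lp j).
- by move=> j; exact: uI.
- by move=> e /hZ[J hJ]; exists J => j Jj r /sub; exact: hJ.
- exact: lpV_cst.
- by under eq_fun do rewrite (i0 hG) normr0 expr0n; exact: intg_cst.
- exact: (aeabS as_ tb ua).
- move=> j; have h1 : intg s t (fun r => 2 * `|i (u j r)| ^+ 2 + 2 * `|Z r| ^+ 2).
    apply: intgD; apply: intgZ; first exact: (no_sq (noise_step mo s t (su j))).
    by apply: intg_cont; exact: sqr_cont.
  apply: (intg_le (mg j) _ h1) => r _; rewrite ger0_norm /gg ?sqr_ge0// (i0 hG) addr0.
  by rewrite -(normrN (Z r)) (normD2_le hG).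
move=> e e0.
have q1 : 0 < e / 4 by rewrite divr_gt0.
pose q := 1 + M * (t - s); have q0 : 0 < q by rewrite ltr_pwDl// mulr_ge0// subr_ge0.
have q2 : 0 < e / 8 / q by rewrite !divr_gt0.
have sq r : a <= r <= b -> `|i (y j r)| ^+ 2 @[j --> \oo] --> `|Z r| ^+ 2.
  move=> rab; rewrite expr2; under eq_fun do rewrite expr2.
  by apply: cvgM; apply: cvg_norm; exact: Zptw.
have /cvgrPdist_lt/(_ _ q1)[J1 _ hJ1] := sq t (introT andP (conj (le_trans as_ st) tb)).
have /cvgrPdist_lt/(_ _ q1)[J2 _ hJ2] := sq s (introT andP (conj as_ (le_trans st tb))).
have [J3 hJ3] := ep_small _ q2.
exists (maxn J1 (maxn J2 J3)) => j; rewrite !geq_max => /and3P[j1 j2 j3].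
have huj := lpVS as_ tb (hu_lp j); have hyj := lpVS as_ tb (hy_lp j).
have dg := op_dgrowth mo st huj (uI s t j as_ st tb).
have evj : evol s t (fun t => i (y j t)) (fun r => A (u j r)).
  by move=> r p v sr rq qt; apply: ev => //; [exact: le_trans sr|exact: le_trans tb].
have en := energy_eq hG al1 st evj dg (cZ j) hyj (aeabW (fun r _ => erefl)).
have i1 := op_intg mo st huj hyj; have hd := lpVB hG al1 huj hyj; have i2 := op_intg mo st huj hd.
have -> : I s t (fun r => A (u j r) (u j r - 0)) =
    I s t (fun r => A (u j r) (y j r)) + I s t (fun r => A (u j r) (u j r - y j r)).
  by rewrite -ID//; congr I; apply/funext => r; rewrite -(dualD (Ad _)) subr0 addrC subrK.
have b1 : `|I s t (fun r => A (u j r) (u j r - y j r))| <= e / 8.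
  rewrite (le_trans (@I_abs_le _ s t _ (fun=> M * ep j) i2.1 (intg_cst _ _ _) _))//.
    move=> r /sub rab; rewrite (le_trans (AM _ _ _ rab))// ler_wpM2l//.
    by rewrite (iB hG) distrC yu.
  rewrite I_cst// mulrAC; have h8 := hJ3 j j3; rewrite ler_pdivlMr// in h8.
  by rewrite (le_trans _ h8)// mulrC ler_wpM2l// lerDr.
have := hJ1 j j1; have := hJ2 j j2; move: en b1; rewrite /= !ltr_norml ler_norml.
set x2 := I _ _ _; set x3 := I _ _ _; clearbody x2 x3; gen_atoms; clear -mo hG Ad al1 al0 C0.
by move=> ? /andP[? ?] /andP[? ?] /andP[? ?]; lra.
Qed.

End RotheSoln.

(** * Existence *)

Section Summable.
Variable R : realType.
Implicit Types (a b : R).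

(** The partial sums have integrals at most 2, so by Fatou's lemma the series converges almost
    everywhere, and its terms tend to 0. *)
Lemma aeab_cvg0 a b (f : nat -> R -> R) : (forall n, intg a b (f n)) -> (forall n t, 0 <= f n t) ->
  (forall n, I a b (f n) <= 2^-1 ^+ n) -> aeab a b (fun t => f n t @[n --> \oo] --> (0 : R)).
Proof.
move=> hf f0 hI.
pose S n t := series (f ^~ t) n.
have SS n t : S n.+1 t = S n t + f n t by rewrite /S seriesSr.
have S0 n t : 0 <= S n t by rewrite /S /series/=; apply: sumr_ge0.
have [iS IS] : (forall n, intg a b (S n)) /\ (forall n, I a b (S n) <= 2 - 2 * 2^-1 ^+ n).
  suff h n : intg a b (S n) /\ I a b (S n) <= 2 - 2 * 2^-1 ^+ n by split=> n; case: (h n).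
  elim: n => [|n [h1 h2]].
    have -> : S 0%N = fun=> 0 by apply/funext => t; rewrite /S /series/= big_geq.
    split; first exact: intg_cst.
    rewrite expr0 mulr1 subrr; have [ab|ba] := leP a b; first by rewrite I_cst// mul0r.
    by rewrite /I set_itv_ge ?bnd_simp -?ltNge// Rintegral_set0.
  have -> : S n.+1 = fun t => S n t + f n t by apply/funext => t; rewrite SS.
  split; first exact: intgD.
  rewrite ID// exprS mulrA mulfV// mul1r; move: h2 (hI n); set x := _ ^+ n.
  by set y := I _ _ _; set z := I _ _ _; clearbody x y z; clear; lra.
have B2 n : I a b (S n) <= 2 by rewrite (le_trans (IS n))// gerBl mulr_ge0// exprn_ge0// invr_ge0.
have [g [_ _ _ hg]] := I_fatou iS S0 B2.
apply: aeab_filter hg => t _ hg; apply: cvg_series_cvg_0.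
have nd : nondecreasing_seq (S ^~ t) by apply/nondecreasing_seqP => n; rewrite SS lerDl.
apply: (nondecreasing_is_cvgn nd); exists (g t + 1) => _ [n _ <-].
by have [m nm hm] := hg 1 ltr01 n; rewrite (le_trans (nd _ _ nm)).
Qed.

End Summable.

Section Existence.
Variables (R : realType) (V H : completeNormedModType R) (ip : H -> H -> R) (i : V -> H).
Variables (A : V -> V -> R) (al delta K C : R).
Hypothesis mo : monotone_op ip i A al delta K C.
Notation RM := (measurableTypeR R).
Let hG := mo_gel mo.
Let Ad := mo_dual mo.
Let al1 := mo_alpha mo.
Let al0 := mo_alpha0 mo.
Let C0 := mo_C0 mo.
Implicit Types (a b c s t e M : R) (Z : R -> H) (N y : R -> V) (z : H).
Local Notation soln := (soln ip i A al).
Local Notation noise := (noise i al).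

Lemma noise_cst a b v : noise a b (fun=> v).
Proof. exact: (noise_step mo a b (isstep_cst v)). Qed.

Lemma soln_point a N z : soln a a N z (fun=> z).
Proof.
split => //; [by move=> t; exact: cvg_cst| |exact: intg_cst|].
  apply: aeab_filter (aeab_ne a a a) => t /andP[ta at_] tn; exfalso; apply: tn.
  by apply/eqP; rewrite eq_le at_ ta.
move=> s t w as_ st ta; have -> : t = s by apply/eqP; rewrite eq_le st (le_trans ta as_).
by rewrite subrr (ip0l hG) I_xx.
Qed.

Lemma soln_noise0 a b z : a < b -> exists Z, soln a b (fun=> 0) z Z.
Proof.
move=> ab; have ex (j : nat) : exists p : V * (R -> H), `|z - i p.1| < j.+1%:R^-1 /\ soln a b (fun=> 0) (i p.1) p.2.
  have [|v [g [zv hg]]] := domain_dense mo z (e := j.+1%:R^-1); first by rewrite invr_gt0 ltr0n.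
  by have [Z hZ] := soln_domain mo ab hg; exists (v, Z).
have [p hp] := choice ex.
have cz (f : V -> R) : f 0 = 0 -> I a b (fun=> f (0 - 0)) @[j --> \oo] --> (0 : R).
  by move=> f0; rewrite subr0 f0 I_cst ?(ltW ab)// mul0r; exact: cvg_cst.
apply: (closure_soln mo (Nj := fun _ _ => 0) (zj := fun j => i (p j).1) (Zj := fun j => (p j).2) (ltW ab)) => //.
- exact: noise_cst.
- by move=> _; exact: noise_cst.
- apply/cvgrPdist_lt => e e0; near=> j; case: (hp j) => h _; apply: (lt_trans h).
  by near: j; exact: (near_infty_natSinv_lt (PosNum e0)).
- by apply: (cz (fun v => `|v| `^ al)); rewrite normr0 powR0// gt_eqF.
- by apply: (cz (fun v => `|i v| ^+ 2)); rewrite (i0 hG) normr0 expr0n.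
- by apply: aeabW => t _; exact: cvg_cst.
- by move=> j; case: (hp j).
Unshelve. all: by end_near. Qed.

Lemma soln_noise_cst a b z v : a < b -> exists Z, soln a b (fun=> v) z Z.
Proof.
move=> ab; have [Z0 h0] := soln_noise0 (z + i v) ab.
have sub t : range i (Z0 t) -> iinv i (Z0 t - i v) = iinv i (Z0 t) - v.
  by move=> r; rewrite -{1}(i_iinv hG r) -(iB hG) (iinvK hG).
have [h1 h2 h3 h4 h5] := h0.
have cZ : continuous (fun t => Z0 t - i v) by move=> t; apply: cvgB; [exact: h1|exact: cvg_cst].
exists (fun t => Z0 t - i v); split => //.
- by rewrite h2 addrK.
- by apply: aeab_filter h3 => t _ [y _ <-]; exists (y - v) => //; rewrite (iB hG).
- have bZ : bmeas ((fun t => iinv i (Z0 t - i v)) : RM -> V).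
    by apply: (bmeas_iinv hG); exact: bmeas_continuous.
  have ig := (lpVB hG al1 (so_lpV mo h0) (lpV_cst al a b v)).2.
  apply: (intg_le_ae (lpV_meas al bZ) ig).
  by apply: aeab_filter h3 => t _ r; rewrite ger0_norm ?powR_ge0// sub.
- move=> s t w as_ st tb; rewrite opprB addrA subrK h5//.
  have bZ : bmeas ((fun t => iinv i (Z0 t - i v)) : RM -> V).
    by apply: (bmeas_iinv hG); exact: bmeas_continuous.
  have [sV dV] := V_dense_seq hG.
  apply: I_ae_eq.
  + by apply: (measurable_op mo); under eq_fun do rewrite addr0; exact (so_bmeas mo h0).
  + by apply: (measurable_op mo); apply: (bmeasD dV bZ); exact: bmeas_cst.
  + by apply: aeab_filter (aeabS as_ tb h3) => r _ hr; rewrite (sub _ hr) subrK addr0.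
Qed.

Lemma soln_noise_step N : isstep N -> forall a b z, a < b -> exists Z, soln a b N z Z.
Proof.
elim=> [v|c f g sf IHf sg IHg] a b z ab; first exact: soln_noise_cst.
have sn : isstep (fun t => if t < c then f t else g t) by exact: isstep_glue.
have [ca|ac] := leP c a.
  have [Z hZ] := IHg a b z ab; exists Z.
  apply: (soln_ext mo _ _ _ hZ); [exact: (noise_step mo)|exact: (noise_step mo)|].
  by apply: aeabW => t /andP[at_ _]; rewrite ltNge (le_trans ca at_).
have ef q : aeab a q (fun t => q <= c -> f t = (if t < c then f t else g t)).
  by apply: aeab_filter (aeab_ne a q c) => t /andP[_ tq] tc qc; rewrite lt_neqAle (le_trans tq qc) andbT; move/eqP: tc => ->.
have [bc|cb] := leP b c.
  have [Z hZ] := IHf a b z ab; exists Z.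
  apply: (soln_ext mo _ _ _ hZ); [exact: (noise_step mo)|exact: (noise_step mo)|].
  by apply: aeab_filter (ef b) => t _; apply.
have [Z1 h1] := IHf a c z ac.
have [Z2 h2] := IHg c b (Z1 c) cb.
apply: (soln_glue mo (ltW ac) (ltW cb) (noise_step mo a b sn) (Z1 := Z1) (Z2 := Z2)).
  apply: (soln_ext mo _ _ _ h1); [exact: (noise_step mo)|exact: (noise_step mo)|].
  by apply: aeab_filter (ef c) => t _; apply.
apply: (soln_ext mo _ _ _ h2); [exact: (noise_step mo)|exact: (noise_step mo)|].
by apply: aeabW => t /andP[ct _]; rewrite ltNge ct.
Qed.

(** One quantity for both parts of [noise]: its integral controls convergence in L^al(V) and in
    L^2(H) at once. *)
Definition cost (v : V) : R := `|v| `^ al + `|i v| ^+ 2.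

Lemma cost_ge0 v : 0 <= cost v.
Proof. by rewrite addr_ge0 ?powR_ge0 ?sqr_ge0. Qed.

Lemma cost_bmeas d (X : measurableType d) (f : X -> V) : bmeas f -> measurable_fun [set: X] (fun x => cost (f x)).
Proof.
move=> bf; apply: measurable_funD.
  by apply: (measurableT_comp (measurable_powR al)); exact: bmeas_normr.
by under eq_fun do rewrite expr2; apply: measurable_funM; exact: bmeas_normr (bmeas_i hG bf).
Qed.

Lemma cost_noise a b N : noise a b N -> intg a b (fun t => cost (N t)).
Proof. by move=> [[_ h1] h2]; exact: intgD. Qed.

Lemma cost_I a b N : noise a b N -> I a b (fun t => `|N t| `^ al) <= I a b (fun t => cost (N t)) /\
  I a b (fun t => `|i (N t)| ^+ 2) <= I a b (fun t => cost (N t)).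
Proof.
move=> hN; split; (apply: I_le; [|exact: cost_noise|]).
- exact: (no_lp hN).2.
- by apply: aeabW => t _; rewrite lerDl sqr_ge0.
- exact: no_sq hN.
- by apply: aeabW => t _; rewrite lerDr powR_ge0.
Qed.

Lemma cost_stepapprox (s : nat -> V) a b N : dense_seq s -> s 0%N = 0 -> a <= b -> noise a b N ->
  stepapprox s cost a b N.
Proof.
move=> ds s0 ab hN; apply: (step_dense (kap := 2 `^ al + 2) ds s0 cost_ge0) => //.
- by rewrite /cost normr0 (i0 hG) normr0 expr0n powR0 ?addr0// gt_eqF.
- move=> v w; rewrite /cost (iD hG); have h1 := normD2_le hG (i v) (i w).
  have h2 : `|v + w| `^ al <= 2 `^ al * (`|v| `^ al + `|w| `^ al).
    apply: le_trans (powRD_le (ltW al0) (normr_ge0 _) (normr_ge0 _)).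
    by rewrite ge0_ler_powR ?nnegrE// ?ler_normD// ?addr_ge0// ltW.
  have p0 : 0 <= 2 `^ al :> R by exact: powR_ge0.
  have v0 := powR_ge0 `|v| al; have w0 := powR_ge0 `|w| al.
  have v2 := sqr_ge0 `|i v|; have w2 := sqr_ge0 `|i w|.
  move: h1 h2 v2 w2 v0 w0 p0; set y1 := _ ^+ 2; set y2 := _ ^+ 2; set y3 := _ ^+ 2; set p := 2 `^ al.
  clearbody y1 y2 y3 p; gen_atoms; clear -mo hG Ad al1 al0 C0 => ? ? v2 w2 v0 w0 p0.
  have := mulr_ge0 p0 v2; have := mulr_ge0 p0 w2; lra.
- move=> e e0; have [k k0 hk] := i_bounded hG.
  have e2 : 0 < e / 2 by rewrite divr_gt0.
  have k1 : 0 < k ^+ 2 + 1 by rewrite ltr_wpDl ?sqr_ge0.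
  exists (Num.min 1 (Num.min (e / 2) (e / 2 / (k ^+ 2 + 1)))).
    by rewrite !lt_min ltr01 e2 divr_gt0.
  move=> v; rewrite !lt_min => /and3P[v1 v2 v3].
  rewrite (splitr e) ltr_leD//.
    have [->|vn0] := eqVneq v 0; first by rewrite normr0 powR0// gt_eqF.
    by rewrite (le_lt_trans _ v2)// ge1r_powR ?ltW// ?normr_gt0 ?vn0 ?ltW.
  rewrite ltr_pdivlMr// in v3.
  have n0 := normr_ge0 v; have h1 := hk v.
  have h2 : `|i v| ^+ 2 <= (k * `|v|) ^+ 2 by rewrite lerXn2r ?nnegrE ?mulr_ge0.
  apply: (le_trans h2); rewrite exprMn (le_trans _ (ltW v3))// mulrC.
  rewrite (@le_trans _ _ (`|v| * k ^+ 2))//; last by rewrite ler_wpM2l// lerDl.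
  by rewrite ler_wpM2r ?sqr_ge0// expr2 ler_piMr// ltW.
- by move=> f; exact: cost_bmeas.
- exact: (no_lp hN).1.
- exact: cost_noise.
Qed.

Lemma V_dense_seq0 : exists s : nat -> V, dense_seq s /\ s 0%N = 0.
Proof.
have [s ds] := V_dense_seq hG; exists (fun n => if n is m.+1 then s m else 0); split => //.
by move=> v eps /ds-/(_ v)[n hn]; exists n.+1.
Qed.

Lemma soln_exists a b N z : a <= b -> noise a b N -> exists Z, soln a b N z Z.
Proof.
rewrite le_eqVlt => /predU1P[<- _|ab hN]; first by exists (fun=> z); exact: soln_point.
have ab' := ltW ab; have [s [ds s0]] := V_dense_seq0.
have hsa : stepapprox s cost a b N := cost_stepapprox ds s0 ab' hN.
(* The rate 2^-j is summable, so the step noises converge at almost every time without passing to a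
   subsequence, as [closure_soln] demands. *)
have ex (j : nat) : exists T, I a b (fun t => cost (N t - stepT s T t)) < 2^-1 ^+ j.
  have [|T [_ hT]] := hsa (2^-1 ^+ j); last by exists T.
  by rewrite exprn_gt0// invr_gt0.
have [T hT] := choice ex.
pose Nj j := stepT s (T j).
have sNj j : isstep (Nj j) by exact: stepT_isstep.
have [Zj hZj] := choice (fun j => soln_noise_step (sNj j) z ab).
have hNj j : noise a b (Nj j) := noise_step mo a b (sNj j).
have hD j := noiseB mo hN (hNj j); have hD' j := noiseB mo (hNj j) hN.
have costN v : cost (- v) = cost v by rewrite /cost normrN (iN hG) normrN.
have hT' j : I a b (fun t => cost (Nj j t - N t)) <= 2^-1 ^+ j.
  by apply/ltW/(le_lt_trans _ (hT j)); under eq_fun do rewrite -costN opprB.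
have q0 : (2^-1 : R) ^+ j @[j --> \oo] --> (0 : R).
  by apply: cvg_expr; rewrite ger0_norm ?invr_ge0// invf_lt1// ltr1n.
have sq0 (f : nat -> R) : (forall j, 0 <= f j) -> (forall j, f j <= 2^-1 ^+ j) -> f j @[j --> \oo] --> (0 : R).
  move=> f0 fq; apply: (@squeeze_cvgr _ _ _ _ (fun=> 0) _ _ _ _ _ q0); last exact: cvg_cst.
  by apply: nearW => j; rewrite f0 fq.
apply: (closure_soln mo (Nj := Nj) (zj := fun=> z) (Zj := Zj) ab' hN hNj) => //.
- exact: cvg_cst.
- apply: sq0 => j; first by apply: I_ge0 => t _; exact: powR_ge0.
  exact: le_trans (cost_I (hD' j)).1 (hT' j).
- apply: sq0 => j; first by apply: I_ge0 => t _; exact: sqr_ge0.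
  exact: le_trans (cost_I (hD' j)).2 (hT' j).
have := aeab_cvg0 (fun j => cost_noise (hD' j)) (fun j t => cost_ge0 _) hT'.
apply: aeab_filter => t _ ct; apply/cvgrPdist_le => e e0.
have ea : 0 < e `^ al by exact: powR_gt0.
move/cvgr0Pnorm_lt : ct => /(_ _ ea); apply: filterS => j.
rewrite ger0_norm ?cost_ge0// => hj; rewrite leNgt; apply/negP => hlt.
have := gt0_ltr_powR al0; move=> /(_ e `|N t - Nj j t|); rewrite !nnegrE (ltW e0) => /(_ isT (normr_ge0 _) hlt).
apply/negP; rewrite -leNgt; apply: le_trans (ltW hj).
by rewrite /cost distrC lerDl sqr_ge0.
Qed.

End Existence.

(** * Global solutions *)

Section BorelReal.
Variable R : realType.
Notation RM := (measurableTypeR R).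

Lemma borelRE (X : set R) : borel X = measurable (X : set RM).
Proof.
apply/propext; split => [bX|mX].
  by apply: (bmeas_borel (f := id : RM -> R)) bX => U; exact: open_measurable.
have : (RGenOpens.G (R:=R)).-sigma.-measurable X by rewrite -RGenOpens.measurableE.
apply: smallest_sub; first exact: smallest_sigma_algebra.
by move=> _ [a [b ->]]; apply: borel_open; exact: interval_open.
Qed.

Lemma intg_fin a b (f : RM -> R) : measurable_fun [set: RM] f -> (forall t, 0 <= f t) ->
  (\int[@lebesgue_measure R]_(t in `[a, b]) (f t)%:E < +oo)%E -> intg a b f.
Proof.
move=> mf f0 h; split => //; apply/integrableP; split.
  by apply/measurable_EFinP; exact: measurable_funTS.
by under eq_integral do rewrite gee0_abs ?lee_fin//.
Qed.

Lemma intg_ltoo a b (f : RM -> R) : (forall t, 0 <= f t) -> intg a b f ->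
  (\int[@lebesgue_measure R]_(t in `[a, b]) (f t)%:E < +oo)%E.
Proof.
move=> f0 [_ /integrableP[_ h]]; apply: le_lt_trans h.
rewrite le_eqVlt; apply/orP; left; apply/eqP; apply: eq_integral => t _.
by rewrite /= ger0_norm.
Qed.

(** [locLp] constrains f on D only; the extension by 0 is measurable on the whole line, as [intg]
    demands. *)
Lemma bmeas_locLp (T : normedModType R) (p : R) (D : set R) (f : R -> T) : measurable (D : set RM) ->
  locLp p D f -> bmeas ((fun t => if `[< D t >] then f t else 0) : RM -> T).
Proof.
move=> mD [hf _] U oU.
have m1 : measurable (D `&` f @^-1` U : set RM) by rewrite -borelRE; apply: hf; exact: borel_open.
have m2 := measurableI _ _ (measurableC mD) (@bmeas_cst _ RM T 0 U oU).
rewrite (_ : _ @^-1` _ = (D `&` f @^-1` U) `|` (~` D `&` (fun=> 0) @^-1` U)); first exact: measurableU.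
apply/seteqP; split => [t /=|t /= [[Dt ft]|[Dt ft]]].
- by have [Dt|nDt] := pselect (D t); [rewrite asboolT//; left|rewrite asboolF//; right].
- by rewrite asboolT.
- by rewrite asboolF.
Qed.

End BorelReal.

Section Global.
Variables (R : realType) (V H : completeNormedModType R) (ip : H -> H -> R) (i : V -> H).
Variables (A : V -> V -> R) (al delta K C : R).
Hypothesis mo : monotone_op ip i A al delta K C.
Notation RM := (measurableTypeR R).
Let hG := mo_gel mo.
Let Ad := mo_dual mo.
Let al1 := mo_alpha mo.
Let al0 := mo_alpha0 mo.
Let C0 := mo_C0 mo.
Implicit Types (a b c s t e M : R) (Z : R -> H) (N y : R -> V) (z : H).
Local Notation soln := (soln ip i A al).
Local Notation noise := (noise i al).

Lemma locLp_noise a b N : locLp al setT N -> locLp 2 setT (fun t => i (N t)) -> noise a b N.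
Proof.
move=> h1 h2.
have bN : bmeas (N : RM -> V).
  have := bmeas_locLp measurableT h1; congr bmeas; apply/funext => t; by rewrite asboolT.
split; first (split => //; apply: intg_fin; [exact: lpV_meas|by move=> t; exact: powR_ge0|]).
  by have := h1.2 a b; rewrite setTI.
apply: intg_fin; [exact: (bmeas_norm2 mo bN)|by move=> t; exact: sqr_ge0|].
have := h2.2 a b; rewrite setTI; congr (_ < _)%E; apply: eq_integral => t _.
by rewrite -powR_mulrn.
Qed.

Definition gsoln s N z Z := forall T, s <= T -> soln s T N z Z.

Lemma gsoln_unique s N z Z Z' : (forall T, noise s T N) -> gsoln s N z Z -> gsoln s N z Z' ->
  forall t, s <= t -> Z t = Z' t.
Proof.
move=> hN hs hs' t st; apply: (soln_unique mo st (hN t) (hs t st) (hs' t st)).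
by rewrite st lexx.
Qed.

(** By uniqueness the solutions on the intervals [s, s + n] agree where they overlap, so at time t
    any n >= t - s may be used. Continuity at t is read off from one n that serves up to t + 1. *)
Lemma gsoln_exists s N z : (forall T, noise s T N) -> exists Z, gsoln s N z Z.
Proof.
move=> hN; have sn (n : nat) : s <= s + n%:R by rewrite lerDl.
have [Zn hZn] := choice (fun n => soln_exists mo z (sn n) (hN (s + n%:R))).
pose n t := (Num.trunc (t - s)).+1.
pose m t := Num.max s t.
pose Z t := Zn (n t) (m t).
have cm t : {for t, continuous m}.
  by apply: continuous_max; [exact: cvg_cst|exact: cvg_id].
have ZE k t : t <= s + k%:R -> Z t = Zn k (m t).
  move=> tk; have sm : s <= m t by rewrite le_max lexx.
  have mk : m t <= s + k%:R by rewrite ge_max sn.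
  have mn : m t <= s + (n t)%:R.
    by rewrite ge_max sn -lerBlDl ltW// truncnS_gt.
  apply: (soln_unique mo (a := s) (b := m t) (N := N) (z := z) (Z := Zn (n t)) (Z' := Zn k)) => //; last by rewrite sm lexx.
    by rewrite -(so_init (hZn (n t))); exact: (solnS (lexx s) mn (hZn (n t))).
  by rewrite -(so_init (hZn k)); exact: (solnS (lexx s) mk (hZn k)).
have cZ : continuous Z.
  move=> t; pose k := (n (t + 1)).
  have tk : t + 1 < s + k%:R by rewrite -ltrBlDl truncnS_gt.
  have tk' : t <= s + k%:R by rewrite (le_trans _ (ltW tk))// lerDl.
  have h : Zn k (m r) @[r --> t] --> Zn k (m t).
    by apply: (@continuous_comp _ _ _ m (Zn k)); [exact: cm|exact: (so_cont (hZn k))].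
  rewrite /continuous_at (ZE k t tk'); apply: cvg_trans h; apply: near_eq_cvg.
  have : \forall r \near t, r < t + 1 by exists 1 => //= r /=; rewrite ltr_norml => /andP[? _]; lra.
  by apply: filterS => r rt; rewrite (ZE k)// ltW// (lt_trans rt).
exists Z => T sT; have Tk : T <= s + (n T)%:R by rewrite -lerBlDl ltW// truncnS_gt.
apply: (soln_eq_on mo (Z := Zn (n T))) => //.
  move=> t /andP[st tT]; rewrite (ZE (n T)) ?(le_trans tT)// /m max_r//.
by rewrite -(so_init (hZn (n T))); exact: (solnS (lexx s) Tk (hZn (n T))).
Qed.

(** Freezing Z before s translates continuity relative to [s, +oo[ into the continuity on the whole
    line that [soln] demands. *)
Lemma within_max s Z : {within `[s, +oo[, continuous Z} <-> continuous (fun t => Z (Num.max s t)).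
Proof.
have cm t : {for t, continuous (fun t => Num.max s t)}.
  by apply: continuous_max; [exact: cvg_cst|exact: cvg_id].
rewrite subspace_continuousP; split => [h t|h x].
  have := h (Num.max s t); rewrite /= in_itv /= andbT le_max lexx => /(_ isT) {}h U /h.
  rewrite /within /= => /(cm t) h2; change (nbhs t [set r | U (Z (Num.max s r))]).
  have h3 : nbhs t [set r | Num.max s r \in `[s, +oo[ -> U (Z (Num.max s r))] := h2.
  by apply: filterS h3 => r /=; apply; rewrite /= in_itv /= andbT le_max lexx.
rewrite /= in_itv /= andbT => sx U hU.
have := h x; rewrite /continuous_at max_r// => /(_ U hU) h2.
have h3 : nbhs x [set r | U (Z (Num.max s r))] := h2.
change (nbhs x [set r | r \in `[s, +oo[ -> U (Z r)]).
apply: filterS h3 => r /=; rewrite in_itv /= andbT => Ur sr.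
by move: Ur; rewrite max_r.
Qed.

(** The V-valued version Zv is determined up to null sets only; it agrees almost everywhere with
    [iinv i] of Z and can be exchanged for it under the integral. The initial value comes from the
    equation at t = s and the density of V in H. *)
Lemma is_solution_gsoln s N x Z : (forall T, noise s T N) -> is_solution ip i A al N s x Z ->
  gsoln s N (x - i (N s)) (fun t => Z (Num.max s t)).
Proof.
move=> hN [cZ [Zv [lZ aeZ ev]]] T sT.
pose Z' t := Z (Num.max s t); have cZ' : continuous Z' by apply/within_max.
pose Zw t := if `[< `[s, +oo[%classic t >] then Zv t else 0.
have bW : bmeas (Zw : RM -> V) by apply: bmeas_locLp lZ; exact: measurable_itv.
have Zw_in t : s <= t -> Zw t = Zv t by move=> st; rewrite /Zw asboolT//= in_itv/= st.
have Z_in t : s <= t -> Z' t = Z t by move=> st; rewrite /Z' max_r.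
have sub t : s <= t -> (`[s, t]%classic : set R) = `[s, +oo[%classic `&` `[s, t]%classic.
  by move=> st; apply/esym/setIidPr => r /=; rewrite !in_itv/= andbT => /andP[].
have lW t : s <= t -> lpV al s t Zw.
  move=> st; split=> //; apply: intg_fin; [exact: lpV_meas|by move=> r; exact: powR_ge0|].
  have -> : (\int[@lebesgue_measure R]_(r in `[s, t]) (`|Zw r| `^ al)%:E =
             \int[@lebesgue_measure R]_(r in `[s, t]) (`|Zv r| `^ al)%:E)%E.
    by apply: eq_integral => r; rewrite inE /= in_itv /= => /andP[sr _]; rewrite Zw_in.
  rewrite (sub t st); exact (lZ.2 s t).
have aeW : aeab s T (fun t => Z' t = i (Zw t)).
  apply: (@filterS _ _ (aeF R)) aeZ => t h /andP[st tT].
  by rewrite Zw_in// Z_in// h//= in_itv/= st.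
have aeI : aeab s T (fun t => iinv i (Z' t) = Zw t).
  by apply: aeab_filter aeW => t _ ->; rewrite (iinvK hG).
have evI t w : s <= t -> ip (Z' t) (i w) = ip (x - i (N s)) (i w) + I s t (fun r => A (Zw r + N r) w).
  move=> st; rewrite Z_in//; have [_ ->] := ev t w st; congr (_ + _).
  by apply: I_eq => r /andP[sr _]; rewrite Zw_in.
have init : Z' s = x - i (N s).
  by apply: (dense_eq hG) => w; rewrite evI// I_xx addr0.
have bI : bmeas ((fun t => iinv i (Z' t)) : RM -> V).
  by apply: (bmeas_iinv hG); exact: bmeas_continuous.
have [sV dV] := V_dense_seq hG.
split => //.
- by apply: aeab_filter aeW => t _ e; exists (Zw t); rewrite -?e.
- apply: (intg_le_ae (lpV_meas al bI) (lW T sT).2).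
  by apply: aeab_filter aeI => t _ ->; rewrite ger0_norm// powR_ge0.
- move=> r t w sr rt tT; have st := le_trans sr rt.
  have iF : intg s t (fun q => A (Zw q + N q) w).
    apply: (op_intg mo st _ (lpV_cst al s t w)).
    by apply: (lpVD hG al1 (lW t st)); exact: no_lp (hN t).
  rewrite (ipBl hG) !evI// (I_split sr rt iF) opprD addrACA subrr add0r addrAC subrr add0r.
  apply: I_ae_eq.
  + by apply: (measurable_op mo); apply: (bmeasD dV bW); exact: (no_lp (hN T)).1.
  + by apply: (measurable_op mo); apply: (bmeasD dV bI); exact: (no_lp (hN T)).1.
  + by apply: aeab_filter (aeabS sr tT aeI) => q _; rewrite /Z' => ->.
Qed.

Lemma gsoln_is_solution s N x Z : (forall T, noise s T N) -> gsoln s N (x - i (N s)) Z ->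
  is_solution ip i A al N s x Z.
Proof.
move=> hN hs; have cZ := so_cont (hs s (lexx s)).
split.
  apply/within_max => t; apply: (@continuous_comp _ _ _ (fun t => Num.max s t) Z); last exact: cZ.
  by apply: continuous_max; [exact: cvg_cst|exact: cvg_id].
pose Zv t := iinv i (Z t); exists Zv.
have bI : bmeas (Zv : RM -> V).
  by apply: (bmeas_iinv hG); exact: bmeas_continuous.
have sT t : s <= Num.max s t by rewrite le_max lexx.
split.
- split => [B bB|a b].
    rewrite borelRE; apply: measurableI; first exact: measurable_itv.
    exact: bmeas_borel bI _ bB.
  have := intg_ltoo (fun t => powR_ge0 _ _) (so_lp (hs _ (sT b))).
  apply: le_lt_trans; apply: ge0_subset_integral.
  + by apply: measurableI; exact: measurable_itv.
  + exact: measurable_itv.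
  + by apply/measurable_EFinP; apply: measurable_funTS; exact: lpV_meas.
  + by move=> t _; rewrite lee_fin powR_ge0.
  + move=> t [] /=; rewrite !in_itv /= andbT => st /andP[_ tb].
    by rewrite st le_max tb orbT.
- have : forall n : nat, {ae @lebesgue_measure R, forall t, s <= t <= s + n%:R -> Z t = i (Zv t)}.
    move=> n; have := so_iinv mo (hs (s + n%:R) _); rewrite lerDl => /(_ (ler0n _ _)).
    by apply: aeab_filter => t _ ->.
  move=> /(@ae_foralln _ _ _ (@lebesgue_measure R)); apply: (@filterS _ _ (aeF R)) => t h; rewrite /= in_itv /= andbT => st.
  apply: (h (Num.trunc (t - s)).+1); rewrite st -lerBlDl ltW// truncnS_gt//.
- move=> t w st; have h := hs t st.
  have iF : intg s t (fun q => A (Zv q + N q) w).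
    by apply: (op_intg mo st (so_u mo (hN t) h)); exact: lpV_cst.
  split; first exact: iF.2.
  have := so_evol h w (lexx s) st (lexx t); rewrite (ipBl hG) (so_init h).
  by move=> /eqP; rewrite subr_eq addrC => /eqP.
Qed.

End Global.

(** * Stability in the data and invariance under time shifts *)

Section Stability.
Variables (R : realType) (V H : completeNormedModType R) (ip : H -> H -> R) (i : V -> H).
Variables (A : V -> V -> R) (al delta K C : R).
Hypothesis mo : monotone_op ip i A al delta K C.
Notation RM := (measurableTypeR R).
Let hG := mo_gel mo.
Let Ad := mo_dual mo.
Let al1 := mo_alpha mo.
Let al0 := mo_alpha0 mo.
Let C0 := mo_C0 mo.
Implicit Types (a b c s t e M : R) (Z : R -> H) (N y : R -> V) (z : H).
Local Notation soln := (soln ip i A al).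
Local Notation noise := (noise i al).
Local Notation gsoln := (gsoln ip i A al).
Local Notation cost := (cost i al).

(** Data within distance 1 of N and z obey a common bound M0, so [est1] gives one Bd for all of them
    and [est2_small] applies. Hence eta does not depend on the nearby solution. *)
Lemma soln_stable a b e N z Z : a <= b -> 0 < e -> noise a b N -> soln a b N z Z ->
  exists eta, 0 < eta /\ forall N' z' Z', noise a b N' -> soln a b N' z' Z' ->
    `|z - z'| <= eta -> I a b (fun t => cost (N t - N' t)) <= eta ->
    forall t, a <= t <= b -> `|Z t - Z' t| <= e.
Proof.
move=> ab e0 hN hs.
pose n1 := I a b (fun t => `|N t| `^ al); pose n2 := I a b (fun t => `|i (N t)| ^+ 2).
have n10 : 0 <= n1 by apply: I_ge0 => t _; exact: powR_ge0.
have n20 : 0 <= n2 by apply: I_ge0 => t _; exact: sqr_ge0.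
have p1 : 1 <= 2 `^ al :> R by rewrite -[leLHS](powRr0 2) ler_powR ?(ltW al0) ?ler1n.
pose M0 := (`|z| + 1) ^+ 2 + 2 `^ al * (1 + n1) + 2 * (1 + n2).
have q1 : 0 <= (`|z| + 1) ^+ 2 by exact: sqr_ge0.
have q2 : 0 <= 2 `^ al * (1 + n1) by rewrite mulr_ge0 ?powR_ge0 ?addr_ge0.
have q3 : 0 <= 2 * (1 + n2) by rewrite mulr_ge0 ?addr_ge0.
have M00 : 0 <= M0 by rewrite !addr_ge0.
have [Bd hBd] := est1 mo ab M00.
have [eta0 [eta00 he]] := est2_small mo Bd ab e0.
have n1M : n1 <= M0.
  rewrite /M0 addrAC ler_wpDl// ?addr_ge0// (@le_trans _ _ (1 * (1 + n1)))//; first by rewrite mul1r lerDr.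
  by rewrite ler_wpM2r// addr_ge0.
have n2M : n2 <= M0.
  rewrite /M0 ler_wpDl// ?addr_ge0// (@le_trans _ _ (1 * (1 + n2)))//; first by rewrite mul1r lerDr.
  by rewrite ler_wpM2r ?addr_ge0// ler1n.
have zM : `|z| ^+ 2 <= M0.
  by rewrite /M0 -addrA ler_wpDr ?addr_ge0// lerXn2r ?nnegrE ?addr_ge0// lerDl.
exists (Num.min 1 eta0); split; first by rewrite lt_min ltr01.
move=> N' z' Z' hN' hs'; rewrite !le_min => /andP[z1 z2] /andP[c1 c2].
have hD := noiseB mo hN hN'; have [k1 k2] := cost_I hD.
have hD' := noiseB mo hN' hN.
have s1 : I a b (fun t => `|N' t - N t| `^ al) <= 1.
  by under eq_fun do rewrite distrC; exact: le_trans k1 c1.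
have s2 : I a b (fun t => `|i (N' t - N t)| ^+ 2) <= 1.
  under eq_fun do rewrite (iB hG) distrC -(iB hG); exact: le_trans k2 c1.
have [l1 l2] := noise_bound mo hN hN'.
apply: (he N N' z z' Z Z') => //.
- exact: (hBd _ _ _ hN hs).
- apply: (hBd _ _ _ hN' hs').
  + rewrite /M0 -addrA ler_wpDr ?addr_ge0// lerXn2r ?nnegrE ?addr_ge0//.
    by rewrite -(subrK z z') (le_trans (ler_normD _ _))// addrC lerD2l distrC.
  + rewrite (le_trans l1)// /M0 addrAC ler_wpDl ?addr_ge0// ler_wpM2l ?powR_ge0// lerD2r//.
  + by rewrite (le_trans l2)// /M0 ler_wpDl ?addr_ge0// ler_wpM2l// lerD2r.
- exact: le_trans k2 c2.
- exact: le_trans k1 c2.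
Qed.

Lemma aeab_translate s a b (P : R -> Prop) : aeab (a + s) (b + s) P -> aeab a b (fun t => P (t + s)).
Proof.
move=> [B [mB B0 hB]]; exists ((fun t : RM => t + s : RM) @^-1` B); split.
- by rewrite -[X in measurable X]setTI; exact: translation_measurable.
- by rewrite -B0 -(lebesgue_translation s mB).
- by move=> t /= ht; apply: hB => /= h; apply: ht => tab; apply: h; rewrite !lerD2r.
Qed.

(** A sees only the sum of solution and noise: moving the constant k from the noise to the solution
    leaves its argument unchanged, and Lebesgue measure is invariant under the time shift. *)
Lemma soln_shift s a b N N' k z Z : a <= b -> noise (a + s) (b + s) N -> noise a b N' ->
  (forall t, N (t + s) = N' t + k) -> soln (a + s) (b + s) N z Z ->
  soln a b N' (z + i k) (fun t => Z (t + s) + i k).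
Proof.
move=> ab hN hN' NN' hs; have [h1 h2 h3 h4 h5] := hs.
have cZ : continuous (fun t => Z (t + s)).
  move=> t; apply: (@continuous_comp _ _ _ (fun t => t + s) Z); last exact: h1.
  by apply: cvgD; [exact: cvg_id|exact: cvg_cst].
have cY : continuous (fun t => Z (t + s) + i k) by move=> t; apply: cvgD; [exact: cZ|exact: cvg_cst].
have r3 := aeab_translate h3.
have sub t : range i (Z (t + s)) -> iinv i (Z (t + s) + i k) = iinv i (Z (t + s)) + k.
  by move=> r; rewrite -{1}(i_iinv hG r) -(iD hG) (iinvK hG).
have bY : bmeas ((fun t => iinv i (Z (t + s) + i k)) : RM -> V).
  by apply: (bmeas_iinv hG); exact: bmeas_continuous.
have lY : lpV al a b (fun t => iinv i (Z (t + s))).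
  split; first by apply: (bmeas_iinv hG); exact: bmeas_continuous.
  exact: intg_translate h4.
split => //.
- by rewrite h2.
- by apply: aeab_filter r3 => t _ [y _ <-]; exists (y + k) => //; rewrite (iD hG).
- apply: (intg_le_ae (lpV_meas al bY) (lpVD hG al1 lY (lpV_cst al a b k)).2).
  by apply: aeab_filter r3 => t _ r; rewrite ger0_norm ?powR_ge0// sub.
move=> r t w ar rt tb.
rewrite opprD addrACA subrr addr0 h5 ?lerD2r//.
rewrite -I_translate; last first.
  apply: (op_intg mo); rewrite ?lerD2r//; last exact: lpV_cst.
  by apply: lpVS (so_u mo hN hs); rewrite lerD2r.
have [sV dV] := V_dense_seq hG.
apply: I_ae_eq.
- apply: (measurable_op mo); under eq_fun do rewrite NN' addrA.
  apply: (bmeasD dV); last exact: bmeas_cst.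
  by apply: (bmeasD dV); [exact: lY.1|exact: (no_lp hN').1].
- by apply: (measurable_op mo); apply: (bmeasD dV bY); exact: (no_lp hN').1.
- by apply: aeab_filter (aeabS ar tb r3) => q _ hq; rewrite (sub _ hq) NN' addrAC -addrA.
Qed.

Lemma gsoln_shift s N N' k z Z : (forall a b, noise a b N) -> (forall a b, noise a b N') ->
  (forall t, N (t + s) = N' t + k) -> gsoln s N z Z -> gsoln 0 N' (z + i k) (fun t => Z (t + s) + i k).
Proof.
move=> hN hN' NN' hs T T0; apply: (soln_shift T0 (hN _ _) (hN' _ _) NN').
by rewrite add0r; apply: hs; rewrite lerDr.
Qed.

Lemma gsolnS s r N z Z : s <= r -> gsoln s N z Z -> gsoln r N (Z r) Z.
Proof. by move=> sr hs T rT; apply: (solnS sr (lexx T) (hs T (le_trans sr rT))). Qed.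

End Stability.

(** * Measurable dependence and the flow *)

Section Products.

Lemma prod_sigmaE d1 d2 (X1 : measurableType d1) (X2 : measurableType d2) :
  prod_sigma (@measurable _ X1) (@measurable _ X2) = @measurable _ (X1 * X2)%type.
Proof.
rewrite measurable_prod_measurableType; congr smallest; apply/seteqP; split => X /=.
  by move=> [A [B [mA [mB ->]]]]; exists A => //; exists B.
by move=> [A mA [B mB <-]]; exists A, B.
Qed.

Lemma bmeas_precomp d d' (X : measurableType d) (Y : measurableType d') (T : topologicalType)
    (f : Y -> T) (q : X -> Y) : measurable_fun [set: X] q -> bmeas f -> bmeas (fun x => f (q x)).
Proof. by move=> mq bf U oU; rewrite -[X in measurable X]setTI; exact: (mq measurableT (f @^-1` U) (bf U oU)). Qed.

Variable R : realType.
Notation RM := (measurableTypeR R).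

Lemma measurable_HB d (X : measurableType d) (H : normedModType R) (f : X -> H) :
  bmeas f <-> measurable_fun [set: X] (f : X -> g_sigma_algebraType (@open H)).
Proof.
split => [bf _ B mB|mf U oU]; first by rewrite setTI; exact: bmeas_borel bf _ mB.
by rewrite -[X in measurable X]setTI; apply: mf => //; exact: sub_gen_smallest.
Qed.

(** Tonelli's theorem on the whole line, for f multiplied by the indicator of [a, b]. *)
Lemma measurable_I d (X : measurableType d) a b (f : RM * X -> R) :
  measurable_fun [set: RM * X] f -> (forall p, 0 <= f p) ->
  measurable_fun [set: X] (fun w => I a b (fun r => f (r, w))).
Proof.
move=> mf f0.
pose g (p : RM * X) : \bar R := (f p * \1_(`[a, b]%classic : set RM) p.1)%:E.
have mg : measurable_fun [set: RM * X] g.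
  apply/measurable_EFinP; apply: measurable_funM => //.
  by apply: measurableT_comp => //; exact: measurable_indic.
have g0 p : (0 <= g p)%E by rewrite lee_fin mulr_ge0.
have mG := @measurable_fun_fubini_tonelli_G _ _ RM X R (@lebesgue_measure R) g mg g0.
have -> : (fun w => I a b (fun r => f (r, w))) = fine \o fubini_G (@lebesgue_measure R) g.
  apply/funext => w; rewrite /I /Rintegral /fubini_G /=; congr fine.
  rewrite integral_mkcond; apply: eq_integral => r _; rewrite /patch /g /= indicE.
  by case: ifPn => _; rewrite ?mulr1 ?mulr0.
by apply: measurableT_comp => //; exact: measurable_fine.
Qed.

End Products.

Section Measurability.
Variables (R : realType) (V H : completeNormedModType R) (ip : H -> H -> R) (i : V -> H).
Variables (A : V -> V -> R) (al delta K C : R).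
Hypothesis mo : monotone_op ip i A al delta K C.
Context (d : measure_display) (Omega : measurableType d).
Variable N : R -> Omega -> V.
Notation RM := (measurableTypeR R).
Notation HB := (g_sigma_algebraType (@open H)).
Hypothesis hN : forall w a b, noise i al a b (N ^~ w).
Hypothesis mN : bmeas (fun p : RM * Omega => N p.1 p.2).
Let hG := mo_gel mo.
Local Notation soln := (soln ip i A al).
Local Notation gsoln := (gsoln ip i A al).
Local Notation cost := (cost i al).

(* The solutions for countably many pairs (step noise, initial value) approximate
   all others; an approximating pair is selected measurably with first_index. *)
Lemma bmeas_gsoln_cl (G : Omega -> H -> R -> H) (m : R) : 0 <= m ->
  (forall w z, gsoln 0 (N ^~ w) z (G w z)) ->
  bmeas (fun p : (RM * HB) * Omega => G p.2 p.1.2 (cl 0 m p.1.1)).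
Proof.
move=> m0 hsol; have [s [ds s0]] := V_dense_seq0 mo; have [e de] := H_dense_seq hG.
pose code k : GenTree.tree nat * nat := odflt (GenTree.Leaf 0%N, 0%N) (unpickle k).
pose st k := stepT s (code k).1.
have sst k : isstep (st k) by exact: stepT_isstep.
have [ze hze] := choice (fun k => soln_exists mo (e (code k).2) m0 (noise_step mo 0 m (sst k))).
pose P n k (p : (RM * HB) * Omega) := `|e (code k).2 - p.1.2| <= n.+1%:R^-1 /\
  I 0 m (fun t => cost (N t p.2 - st k t)) <= n.+1%:R^-1.
have mfst : measurable_fun [set: (RM * HB) * Omega] (fun p => p.1.1).
  exact: (measurableT_comp measurable_fst measurable_fst).
have bz : bmeas (fun p : (RM * HB) * Omega => p.1.2 : H).
  apply/measurable_HB; exact: (measurableT_comp measurable_snd measurable_fst).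
have [sV dV] := V_dense_seq hG.
have mP n k : measurable [set p | P n k p].
  have -> : [set p | P n k p] = [set p | `|e (code k).2 - p.1.2| <= n.+1%:R^-1] `&`
     [set p | I 0 m (fun t => cost (N t p.2 - st k t)) <= n.+1%:R^-1] by [].
  apply: measurableI; apply: measurable_leset; try exact: measurable_cst.
    by apply: bmeas_normr; apply: (bmeasB de) => //; exact: bmeas_cst.
  suff mI : measurable_fun [set: Omega] (fun w => I 0 m (fun t => cost (N t w - st k t))).
    exact: (measurableT_comp mI measurable_snd).
  apply: (@measurable_I R _ Omega 0 m (fun p => cost (N p.1 p.2 - st k p.1))) => [|p]; last exact: cost_ge0.
  apply: (cost_bmeas mo); apply: (bmeasB dV mN).
  by apply: (bmeas_precomp measurable_fst); exact: isstep_bmeas.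
have exP n p : exists k, P n k p.
  have n0 : 0 < n.+1%:R^-1 :> R by rewrite invr_gt0 ltr0n.
  have [l hl] := de p.1.2 _ n0.
  have hsa : stepapprox s cost 0 m (N ^~ p.2) := cost_stepapprox mo ds s0 m0 (hN p.2 0 m).
  have [T [_ hT]] := hsa _ n0.
  exists (pickle (T, l)); rewrite /P /st /code pickleK /=; split; last exact: ltW.
  by rewrite distrC ltW.
have [kap hkap] := choice (fun n => first_index (mP n) (exP n)).
apply: (bmeas_lim (f := fun n (p : (RM * HB) * Omega) => ze (kap n p) (cl 0 m p.1.1))) => [n|p].
  apply: (bmeas_piecewise (F := fun k p => ze k (cl 0 m p.1.1))) => k; first exact: (hkap n).1.
  apply: (bmeas_precomp mfst (f := fun t => ze k (cl 0 m t))).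
  apply: bmeas_continuous => t; apply: (@continuous_comp _ _ _ (cl 0 m) (ze k)).
    exact: cl_continuous.
  exact: (so_cont (hze k)).
apply/cvgrPdist_le => eps eps0.
have [eta [eta0 he]] := soln_stable mo m0 eps0 (hN p.2 0 m) (hsol p.2 p.1.2 m m0).
have [n0 _ hn0] := near_infty_natSinv_lt (PosNum eta0); exists n0 => // n /= nn.
have [h1 h2] := (hkap n).2 p; have hn := ltW (hn0 n nn).
apply: (he _ _ _ (noise_step mo 0 m (sst _)) (hze _)); rewrite ?cl_itv//.
  by rewrite distrC (le_trans h1).
exact: le_trans h2 hn.
Qed.

(** At a given time the clamp to [0, m] is eventually the clamp to [0, +oo[, so the sequence in m is
    eventually constant. *)
Lemma bmeas_gsoln (G : Omega -> H -> R -> H) : (forall w z, gsoln 0 (N ^~ w) z (G w z)) ->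
  bmeas (fun p : (RM * HB) * Omega => G p.2 p.1.2 (Num.max 0 p.1.1)).
Proof.
move=> hsol; apply: (bmeas_lim (f := fun (m : nat) (p : (RM * HB) * Omega) => G p.2 p.1.2 (cl 0 m%:R p.1.1))) => [m|p].
  exact: bmeas_gsoln_cl.
apply: cvg_near_cst.
exists (Num.trunc p.1.1).+1 => // m /= hm; rewrite /cl (@min_r _ _ m%:R)//.
by apply/ltW/(lt_le_trans (truncnS_gt _)); rewrite ler_nat.
Qed.

End Measurability.

Section Flow.
Variables (R : realType) (V H : completeNormedModType R) (ip : H -> H -> R) (i : V -> H).
Variables (A : V -> V -> R) (al delta K C : R).
Hypothesis mo : monotone_op ip i A al delta K C.
Context (d : measure_display) (Omega : measurableType d).
Variables (theta : R -> Omega -> Omega) (N : R -> Omega -> V).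
Notation RM := (measurableTypeR R).
Notation HB := (g_sigma_algebraType (@open H)).
Hypothesis hN : forall w a b, noise i al a b (N ^~ w).
Hypothesis mN : bmeas (fun p : RM * Omega => N p.1 p.2).
Hypothesis mtheta : measurable_fun [set: RM * Omega] (fun p => theta p.1 p.2).
Hypothesis Nstat : forall s t w, N t w - N s w = N (t - s) (theta s w) - N 0 (theta s w).
Variable Zf : R -> Omega -> H -> R -> H.
Hypothesis hZf : forall s w x, is_solution ip i A al (N ^~ w) s x (Zf s w x).
Let hG := mo_gel mo.
Local Notation soln := (soln ip i A al).
Local Notation gsoln := (gsoln ip i A al).
Local Notation cost := (cost i al).
Let S t s w x := Zf s w x t + i (N t w).
(** Values of Zf before its starting time are arbitrary; freezing them gives a [gsoln]. *)
Let Zm s w x t := Zf s w x (Num.max s t).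

Lemma gsoln_Zm s w x : gsoln s (N ^~ w) (x - i (N s w)) (Zm s w x).
Proof. exact: (is_solution_gsoln mo (fun T => hN w s T) (hZf s w x)). Qed.

Lemma Zm_id s w x t : s <= t -> Zm s w x t = Zf s w x t.
Proof. by move=> st; rewrite /Zm max_r. Qed.

Lemma flow_init s w x : S s s w x = x.
Proof. by rewrite /S -Zm_id// (so_init (gsoln_Zm w x (lexx s))) subrK. Qed.

(** The restarted equation has initial value S r s w x - N r w, which is the old solution at time r.
    The old solution therefore solves it too, and uniqueness applies. *)
Lemma flow_semigroup s r t w x : s <= r -> r <= t -> S t r w (S r s w x) = S t s w x.
Proof.
move=> sr rt; rewrite /S; congr (_ + _).
rewrite -!Zm_id ?(le_trans sr)//.
apply: (gsoln_unique mo (fun T => hN w r T) (@gsoln_Zm r w _)) => //.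
by rewrite addrK; exact: (gsolnS sr (@gsoln_Zm s w x)).
Qed.

(** By [Nstat] the noise shifted by s is the noise along theta s w plus the constant k. Carried over
    to the solution, k turns the initial value x - N s w into x - N 0 (theta s w), and it cancels
    again when the noise is added to form S. *)
Lemma flow_shift s t w x : s <= t -> S t s w x = S (t - s) 0 (theta s w) x.
Proof.
move=> st; set w' := theta s w; pose k := N s w - N 0 w'.
have Nk q : N (q + s) w = N q w' + k.
  by rewrite /k addrCA -(addrK s q) -Nstat addrK addrCA subrr addr0.
have h1 := gsoln_shift mo (hN w) (hN w') Nk (@gsoln_Zm s w x).
have h2 := @gsoln_Zm 0 w' x.
have kE : x - i (N s w) + i k = x - i (N 0 w') by rewrite (iB hG) addrA subrK.
rewrite kE in h1.
have ts : 0 <= t - s by rewrite subr_ge0.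
have := gsoln_unique mo (fun T => hN w' 0 T) h1 h2 ts.
rewrite subrK !Zm_id// /S => <-.
by have := Nk (t - s); rewrite subrK => ->; rewrite (iD hG) -addrA; congr (_ + _); exact: addrC.
Qed.

Lemma flow_cont s t w : s <= t -> continuous (S t s w).
Proof.
move=> st x; apply: cvgD; last exact: cvg_cst.
apply/cvgrPdist_le => e e0.
have [eta [eta0 he]] := soln_stable mo st e0 (hN w s t) (gsoln_Zm w x st).
apply/nbhs_ballP; exists eta => //= y; rewrite -ball_normE /= => xy.
have := he _ _ _ (hN w s t) (gsoln_Zm w y st).
rewrite opprD addrACA subrr addr0 (ltW xy).
have -> : I s t (fun r => cost (N r w - N r w)) = 0.
  under eq_fun do rewrite subrr /cost normr0 (i0 hG) normr0 expr0n powR0 ?gt_eqF ?(mo_alpha0 mo)// addr0.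
  by rewrite I_cst// mul0r.
move=> /(_ isT (ltW eta0) t); rewrite st lexx !Zm_id//; exact.
Qed.

(** [bmeas_gsoln] is measurable in the initial value of Z, while S is parametrised by x; the
    measurable substitution x - i (N 0 w) connects them. Negative times, where S carries no
    information, are sent to 0. *)
Lemma bmeas_flow0 : bmeas (fun p : (RM * HB) * Omega => S (Num.max 0 p.1.1) 0 p.2 p.1.2 : H).
Proof.
pose G w z := Zm 0 w (z + i (N 0 w)).
have hGs w z : gsoln 0 (N ^~ w) z (G w z).
  by have := @gsoln_Zm 0 w (z + i (N 0 w)); rewrite addrK.
have [eH dH] := H_dense_seq hG.
have m11 : measurable_fun [set: (RM * HB) * Omega] (fun p => p.1.1).
  exact: (measurableT_comp measurable_fst measurable_fst).
have b12 : bmeas (fun p : (RM * HB) * Omega => p.1.2 : H).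
  by apply/measurable_HB; exact: (measurableT_comp measurable_snd measurable_fst).
have m2 : measurable_fun [set: (RM * HB) * Omega] (fun p => p.2) := measurable_snd.
have bN0 : bmeas (fun p : (RM * HB) * Omega => i (N 0 p.2)).
  apply: (bmeas_i hG); apply: (bmeas_precomp (q := fun p : (RM * HB) * Omega => (0 : RM, p.2)) _ mN).
  by apply: measurable_fun_pair => //; exact: measurable_cst.
have bNt : bmeas (fun p : (RM * HB) * Omega => i (N (Num.max 0 p.1.1) p.2)).
  apply: (bmeas_i hG); apply: (bmeas_precomp (q := fun p : (RM * HB) * Omega => (Num.max 0 p.1.1 : RM, p.2)) _ mN).
  by apply: measurable_fun_pair => //; apply: measurable_maxr => //; exact: measurable_cst.
apply: (bmeasD dH) bNt.
have mq : measurable_fun [set: (RM * HB) * Omega]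
    (fun p => ((p.1.1, p.1.2 - i (N 0 p.2) : HB), p.2) : (RM * HB) * Omega).
  apply: measurable_fun_pair => //; apply: measurable_fun_pair => //.
  by apply/measurable_HB; exact: (bmeasB dH).
have := bmeas_precomp mq (bmeas_gsoln mo hN mN hGs).
by congr bmeas; apply/funext => -[[t x] w] /=; rewrite /G subrK Zm_id// le_max lexx.
Qed.

Let borelE3 : prod_sigma (prod_sigma (prod_sigma (@borel R) (@borel R)) (@borel H)) measurable =
  @measurable _ (((RM * RM) * HB) * Omega)%type.
Proof.
have RME : @borel R = @measurable _ RM by apply/funext => X; exact: borelRE.
by rewrite -(prod_sigmaE ((RM * RM) * HB)%type Omega) -(prod_sigmaE (RM * RM)%type HB) -(prod_sigmaE RM RM) RME.
Qed.

Let borelE2 : prod_sigma (prod_sigma (@borel R) (@borel H)) measurable =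
  @measurable _ ((RM * HB) * Omega)%type.
Proof.
have RME : @borel R = @measurable _ RM by apply/funext => X; exact: borelRE.
by rewrite -(prod_sigmaE (RM * HB)%type Omega) -(prod_sigmaE RM HB) RME.
Qed.

(** [flow_shift] moves the starting time into theta s w, so joint measurability in both times
    follows from that of theta and of the single map with starting time 0. *)
Lemma flow_measurable (B : set H) : borel B ->
  prod_sigma (prod_sigma (prod_sigma (@borel R) (@borel R)) (@borel H)) measurable
    [set p | p.1.1.2 <= p.1.1.1 /\ B (S p.1.1.1 p.1.1.2 p.2 p.1.2)].
Proof.
move=> bB; rewrite borelE3.
pose X := (((RM * RM) * HB) * Omega)%type.
have mt : measurable_fun [set: X] (fun p => p.1.1.1).
  exact: (measurableT_comp measurable_fst (measurableT_comp measurable_fst measurable_fst)).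
have ms : measurable_fun [set: X] (fun p => p.1.1.2).
  exact: (measurableT_comp measurable_snd (measurableT_comp measurable_fst measurable_fst)).
have mx : measurable_fun [set: X] (fun p => p.1.2) := measurableT_comp measurable_snd measurable_fst.
have mw : measurable_fun [set: X] (fun p => p.2) := measurable_snd.
pose q (p : X) : (RM * HB) * Omega := ((p.1.1.1 - p.1.1.2, p.1.2), theta p.1.1.2 p.2).
have mq : measurable_fun [set: X] q.
  apply: measurable_fun_pair; first by apply: measurable_fun_pair => //; exact: measurable_funB.
  exact: (measurableT_comp mtheta (measurable_fun_pair ms mw)).
have m1 := measurable_leset ms mt.
have m2 := bmeas_borel (bmeas_precomp mq bmeas_flow0) bB.
rewrite (_ : [set p | _] = [set p : X | p.1.1.2 <= p.1.1.1] `&`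
   (fun p : X => S (Num.max 0 (q p).1.1) 0 (q p).2 (q p).1.2) @^-1` B); first exact (measurableI _ _ m1 m2).
by apply/seteqP; split => -[[[t s] x] w] /= [st]; rewrite max_r ?subr_ge0// -flow_shift.
Qed.

Lemma rds_measurable (B : set H) : borel B ->
  prod_sigma (prod_sigma (@borel R) (@borel H)) measurable
    [set p | 0 <= p.1.1 /\ B (S p.1.1 0 p.2 p.1.2)].
Proof.
move=> bB; rewrite borelE2.
have mt : measurable_fun [set: (RM * HB) * Omega] (fun p => p.1.1).
  exact: (measurableT_comp measurable_fst measurable_fst).
have m1 := measurable_leset (@measurable_cst _ _ ((RM * HB) * Omega)%type R setT 0) mt.
have m2 := bmeas_borel bmeas_flow0 bB.
rewrite (_ : [set p | _] = [set p : (RM * HB) * Omega | 0 <= p.1.1] `&`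
   (fun p => S (Num.max 0 p.1.1) 0 p.2 p.1.2) @^-1` B); first exact (measurableI _ _ m1 m2).
by apply/seteqP; split => -[[t x] w] /= [t0]; rewrite max_r.
Qed.

Lemma flow_stochastic : cont_stochastic_flow theta S.
Proof.
split; [exact: flow_measurable|by move=> *; exact: flow_semigroup|by move=> *; exact: flow_shift|].
by move=> *; exact: flow_cont.
Qed.

Lemma flow_rds : cont_RDS theta (fun t w x => S t 0 w x).
Proof.
split; [exact: rds_measurable|by move=> *; exact: flow_init| |by move=> *; exact: flow_cont].
move=> t s w x t0 s0; rewrite -(flow_semigroup (r := s))//; last by rewrite lerDr.
by rewrite flow_shift ?lerDr// addrK.
Qed.

End Flow.

Theorem theorem1p1
  (R : realType)
  (V H : completeNormedModType R) (ip : H -> H -> R) (i : V -> H)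
  (A : V -> V -> R)
  (d : measure_display) (Omega : measurableType d)
  (P : probability Omega R) (theta : R -> Omega -> Omega)
  (Ft : R -> set (set Omega)) (N : R -> Omega -> V)
  (alpha delta K C : R) :
  gelfand_triple ip i ->
  (forall v, is_dual (A v)) ->
  (forall B, borel_dual B -> @borel V (A @^-1` B)) ->
  metric_dyn_sys P theta ->
  filtration Ft ->
  (forall t B, @borel V B -> Ft t (N t @^-1` B)) ->
  1 < alpha -> 0 < delta ->
  (* (H1) hemicontinuity *)
  (forall v v1 v2 : V, continuous (fun s : R => A (v1 + s *: v2) v)) ->
  (* (H2) weak monotonicity *)
  (forall v1 v2 : V,
     2 * (A v1 (v1 - v2) - A v2 (v1 - v2)) <= C * `|i (v1 - v2)| ^+ 2) ->
  (* (H3) coercivity *)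
  (forall v : V, 2 * A v v + delta * `|v| `^ alpha <= C + K * `|i v| ^+ 2) ->
  (* (H4) growth *)
  (forall v : V, opnorm (A v) <= C * (1 + `|v| `^ (alpha - 1))) ->
  (* (S1) *)
  (forall s t w, N t w - N s w = N (t - s) (theta s w) - N 0 (theta s w)) ->
  (* (S2) *)
  (forall w, locLp alpha setT (fun t => N t w) /\
             locLp 2 setT (fun t => i (N t w))) ->
  (* (S3) *)
  (forall B, @borel V B ->
     prod_sigma (@borel R) measurable [set p : R * Omega | B (N p.1 p.2)]) ->
  (* the solutions exist and are unique ... *)
  (forall s w x, exists Z : R -> H, is_solution ip i A alpha (N^~ w) s x Z) /\
  (forall s w x (Z1 Z2 : R -> H),
     is_solution ip i A alpha (N^~ w) s x Z1 ->
     is_solution ip i A alpha (N^~ w) s x Z2 ->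
     forall t, s <= t -> Z1 t = Z2 t) /\
  (* ... and for Zf s w x t = Z(t,s;w)x, S is a continuous stochastic flow and
     phi is a continuous RDS *)
  (forall Zf : R -> Omega -> H -> R -> H,
     (forall s w x, is_solution ip i A alpha (N^~ w) s x (Zf s w x)) ->
     let S := fun t s w x => Zf s w x t + i (N t w) in
     cont_stochastic_flow theta S /\
     cont_RDS theta (fun t w x => S t 0 w x)).
Proof.
move=> hG Ad Am [mth _ _ _] _ _ al1 d0 hemi mono coer grow S1 S2 S3.
have mo : monotone_op ip i A alpha delta K C by [].
have hN w a b : noise i alpha a b (N ^~ w).
  by have [h1 h2] := S2 w; exact: (locLp_noise mo).
have RME : @borel R = @measurable _ (measurableTypeR R) by apply/funext => X; exact: borelRE.
split; [|split].
- move=> s w x; have [Z hZ] := gsoln_exists mo (x - i (N s w)) (hN w s).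
  by exists Z; exact: (gsoln_is_solution mo (hN w s) hZ).
- move=> s w x Z1 Z2 h1 h2 t st.
  have := gsoln_unique mo (hN w s) (is_solution_gsoln mo (hN w s) h1)
    (is_solution_gsoln mo (hN w s) h2) st.
  by rewrite max_r.
move=> Zf hZf S.
have mN : bmeas (fun p : measurableTypeR R * Omega => N p.1 p.2).
  move=> U oU; have := S3 U (borel_open oU); by rewrite RME prod_sigmaE.
have mtheta : measurable_fun [set: measurableTypeR R * Omega] (fun p => theta p.1 p.2).
  by move=> _ B mB; rewrite setTI; have := mth B mB; rewrite RME prod_sigmaE.
split; first exact (flow_stochastic mo hN mN mtheta S1 hZf).
exact (flow_rds mo hN mN S1 hZf).
Qed.
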